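(* Let $k$ be an algebraically closed field of arbitrary characteristic. Let $\mathbf\Gamma=(I,\{V_{ij}\},\{E_{ij}\})$ be a modulated graph over $k$ with underlying graph $\Gamma$, and let $A=(\dim V_{ij})_{i,j\in I}$ be the adjacency matrix of $\Gamma$. Assume that $\Gamma$ is connected and not of ADET type. Let $D=(d_{ij})_{i,j\in I}$ be the matrix over $k$ with $d_{ij}=\operatorname{Tr}(E_{ij}(E_{ji}^t)^{-1})$, and assume that $D$ admits a nondegenerate eigenvalue $\lambda\in k$. Then the preprojective algebra $P(\mathbf\Gamma)$ is Koszul and its matrix Hilbert series equals $(1-At+t^2)^{-1}$.
   Context: **Modulated graph.** A modulated graph $\mathbf\Gamma$ over $k$ consists of a finite set $I$, finite dimensional $k$-vector spaces $V_{ij}$ ($i,j\in I$), and nondegenerate bilinear forms $E_{ij}:V_{ij}\otimes V_{ji}\to k$ for all $i,j\in I$ (so $\dim V_{ij}=\dim V_{ji}$). The underlying graph $\Gamma$ has vertex set $I$ and $\dim V_{ij}$ edges joining $i$ and $j$ ($\dim V_{ii}$ loops at $i$). **Graded spaces.** $I\times I$-graded vector spaces form a tensor category with $(V\otimes W)_{ij}=\bigoplus_{m}V_{im}\otimes W_{mj}$ and unit $\mathbf 1$ with $\mathbf 1_{ii}=k$, $\mathbf 1_{ij}=0$ for $i\neq j$. The forms $E_{ij}$ assemble to $E:V\otimes V\to\mathbf 1$ with $V=\bigoplus V_{ij}$. Let $E^*:\mathbf 1\to V\otimes V$ be the dual of $E$, i.e. the map with $(E\otimes \mathrm{id})(\mathrm{id}\otimes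 E^* )=\mathrm{id}_V=(\mathrm{id}\otimes E)(E^*\otimes\mathrm{id})$. Explicitly, its component at $i$ is $\sum_{j}\sum_a v_a\otimes w_a\in\bigoplus_j V_{ij}\otimes V_{ji}$, where for each $j$, $(v_a)$ is a basis of $V_{ij}$ and $(w_a)$ is the basis of $V_{ji}$ with $E_{ji}(w_a,v_b)=\delta_{ab}$. **Preprojective algebra.** Let $T(V)=\bigoplus_{n\ge0}V^{\otimes n}$ be the tensor algebra in this category (the path algebra of $\Gamma$, with degree zero part $\mathbf 1$, i.e. the semisimple algebra $\bigoplus_{i\in I}k$). The preprojective algebra $P(\mathbf\Gamma)$ is the quotient of $T(V)$ by the two-sided ideal generated by the image of $E^*:\mathbf 1\to T^2(V)=V\otimes V$. It is graded by $n$; Koszul means Koszul as a graded algebra over its semisimple degree zero part. The matrix Hilbert series is $\sum_{n\ge0}\bigl(\dim (P(\mathbf\Gamma)_n)_{ij}\bigr)_{i,j\in I}\,t^n$, a power series with integer $I\times I$ matrix coefficients. **Trace.** In $\operatorname{Tr}(E_{ij}(E_{ji}^t)^{-1})$, $E_{ij}$ is viewed as the map $V_{ij}\to V_{ji}^*$, $v\mapsto E_{ij}(v,-)$, and $E_{ji}^t$ as the map $V_{ij}\to V_{ji}^*$, $v\mapsto E_{ji}(-,v)$. **Nondegenerate eigenvalue.** An eigenvalue $\lambda$ of a matrix $(b_{ij})_{i,j\in I}$ is nondegenerate if there is a $\lambda$-eigenvector $(r_i)_{i\in I}$ (so $\sum_j b_{ij}r_j=\lambda r_i$) with $\prod_{i\in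 I}r_i\ne0$. **ADET type.** A connected graph is of ADET type if it is a simply laced Dynkin diagram $A_n$ ($n\ge1$), $D_n$ ($n\ge4$), $E_6,E_7,E_8$, or a tadpole $T_n$ ($n\ge1$), i.e. the path on $n$ vertices with one loop added at one end vertex. *)

(* Defs.v *)
From HB Require Import structures.
From mathcomp Require Import all_boot all_order all_algebra.
From mathcomp Require Import finmap boolp classical_sets.
From mathcomp.multinomials Require Import monalg.

Set Implicit Arguments.
Unset Strict Implicit.
Unset Printing Implicit Defensive.

Import GRing.Theory.
Local Open Scope quotient_scope.
Local Open Scope classical_set_scope.
Local Open Scope ring_scope.

Record quiver := Quiver {
  qvtx : finType;
  qarr : finType;
  qsrc : qarr -> qvtx;
  qtgt : qarr -> qvtx }.

Section Paths.
Variable Q : quiver.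

Fixpoint chain (i : qvtx Q) (s : seq (qarr Q)) : bool :=
  if s is a :: s' then (qsrc a == i) && chain (qtgt a) s' else true.

(* A path is a starting vertex together with a composable list of arrows, read
   from left to right; the starting vertex distinguishes the trivial paths. *)
Record qpath := QPath {
  pword : qvtx Q * seq (qarr Q);
  _ : chain pword.1 pword.2 }.
HB.instance Definition _ := [isSub for pword].
HB.instance Definition _ := [Choice of qpath by <:].

Definition pstart (p : qpath) : qvtx Q := (pword p).1.
Definition pend (p : qpath) : qvtx Q := last (pword p).1 (map (@qtgt Q) (pword p).2).
Definition plen (p : qpath) : nat := size (pword p).2.
Definition ptriv (i : qvtx Q) : qpath := @QPath (i, [::]) isT.

Lemma chain1 a : chain (qsrc a) [:: a].
Proof. by rewrite /= eqxx. Qed.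

Definition parr (a : qarr Q) : qpath := @QPath (qsrc a, [:: a]) (chain1 a).

Definition pcomp (p q : qpath) : option qpath :=
  if pend p == pstart q then insub ((pword p).1, (pword p).2 ++ (pword q).2) else None.

Lemma chain_cat i s1 s2 :
  chain i (s1 ++ s2) = chain i s1 && chain (last i (map (@qtgt Q) s1)) s2.
Proof. by elim: s1 i => //= a s1 IH i; rewrite IH andbA. Qed.

Lemma pcomp_val p q : pend p = pstart q ->
  omap val (pcomp p q) = Some ((val p).1, (val p).2 ++ (val q).2).
Proof.
move=> epq; rewrite /pcomp epq eqxx; case: insubP => [u _ /= -> //|].
case/negP; rewrite /= chain_cat; apply/andP; split; first exact: (valP p).
by move: epq; rewrite /pend /pstart => ->; exact: (valP q).
Qed.

Lemma pcompA p q r :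
  obind (pcomp p) (pcomp q r) = obind (fun u => pcomp u r) (pcomp p q).
Proof.
have inj : injective (omap (val : qpath -> _)).
  by move=> [x|] [y|] //= [] /val_inj ->.
have F (x y z : qpath) : pcomp x y = Some z ->
    [/\ pend x = pstart y, pstart z = pstart x, pend z = pend y &
        (val z).2 = (val x).2 ++ (val y).2].
  rewrite /pcomp; case: eqP => // e; case: insubP => // u _ eu [<-].
  split=> //; rewrite /pstart /pend ?eu //= map_cat last_cat.
  by move: e; rewrite /pend /pstart => ->.
have N (x y : qpath) : pcomp x y = None -> pend x <> pstart y.
  by move=> exy e; move: (pcomp_val e); rewrite exy.
case eqr: (pcomp q r) => [u|] /=; last first.
  case epq: (pcomp p q) => [v|] //=.
  have [_ _ ev _] := F _ _ _ epq.
  by rewrite /pcomp ev; case: eqP => // e; case: (N _ _ eqr).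
have [e1 s1 t1 l1] := F _ _ _ eqr.
case epq: (pcomp p q) => [v|] /=; last first.
  by rewrite /pcomp s1; case: eqP => // e; case: (N _ _ epq).
have [e2 s2 t2 l2] := F _ _ _ epq.
apply: inj; rewrite !pcomp_val ?s1 ?t2 // l1 l2 catA.
by congr (Some (_, _)); rewrite -/(pstart v) s2.
Qed.

Lemma pcomp_triv_l i p : pcomp (ptriv i) p = if i == pstart p then Some p else None.
Proof.
rewrite /pcomp /pend /=; case: eqP => // ->.
by case: insubP => [u _ eu|/negP[]]; last exact: (valP p);
  congr Some; apply: val_inj; rewrite eu; case: p {eu} => -[].
Qed.

Lemma pcomp_triv_r i p : pcomp p (ptriv i) = if pend p == i then Some p else None.
Proof.
rewrite /pcomp /pstart /= cats0; case: eqP => // _.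
by case: insubP => [u _ eu|/negP[]]; last exact: (valP p);
  congr Some; apply: val_inj; rewrite eu; case: p {eu} => -[].
Qed.

End Paths.

Section PathAlgebra.
Variables (k : fieldType) (Q : quiver).

Lemma malg_basisE (x : {malg k[qpath Q]}) :
  x = \sum_(p <- msupp x) mcoeff p x *: mkmalgU p 1.
Proof.
rewrite [LHS]monalgE; apply: eq_bigr => p _; apply/malgP => q.
rewrite [RHS]mcoeffZ [LHS]mcoeffU [X in _ * X]mcoeffU.
by case: (p == q); [exact: (esym (mulr1 _)) | exact: (esym (mulr0 _))].
Qed.

Definition pathalg : Type := {malg k[qpath Q]}.
HB.instance Definition _ := GRing.Lmodule.on pathalg.

End PathAlgebra.

HB.lock Definition pbasis (k : fieldType) (Q : quiver) (p : qpath Q) :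
  pathalg k Q := mkmalgU p 1.

HB.lock Definition pprod (k : fieldType) (Q : quiver) (p q : qpath Q) :
  pathalg k Q := oapp (@pbasis k Q) 0 (pcomp p q).

HB.lock Definition pathalg_mul (k : fieldType) (Q : quiver) (x y : pathalg k Q) :
  pathalg k Q :=
  \sum_(p <- msupp x) \sum_(q <- msupp y) (mcoeff p x * mcoeff q y) *: pprod k p q.

Section PathAlgebraTheory.
Variables (k : fieldType) (Q : quiver).
Local Notation pathalg := (pathalg k Q).
Local Notation pathalg_mul := (@pathalg_mul k Q).
Local Notation pprod := (@pprod k Q).
Local Notation pbasis := (@pbasis k Q).

Definition pathalg_one : pathalg := \sum_i pbasis (ptriv i).

Lemma pathalg_mulw (d1 d2 : {fset qpath Q}) (x y : pathalg) :
  (msupp x `<=` d1)%fset -> (msupp y `<=` d2)%fset ->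
  pathalg_mul x y =
    \sum_(p <- d1) \sum_(q <- d2) (mcoeff p x * mcoeff q y) *: pprod p q.
Proof.
move=> s1 s2; rewrite pathalg_mul.unlock (big_fset_incl _ s1) /=.
  apply/eq_bigr=> p _; apply/big_fset_incl => // q _ /mcoeff_outdom ->.
  by rewrite mulr0 scale0r.
move=> p _ /mcoeff_outdom e; rewrite big1 // => q _.
by rewrite e mul0r scale0r.
Qed.

Lemma pathalg_mulDl : left_distributive pathalg_mul +%R.
Proof.
move=> x y z.
rewrite (pathalg_mulw (msuppD_le x y) (fsubset_refl _)).
rewrite (pathalg_mulw (fsubsetUl (msupp x) (msupp y)) (fsubset_refl _)).
rewrite (pathalg_mulw (fsubsetUr (msupp x) (msupp y)) (fsubset_refl _)).
rewrite -big_split; apply: eq_bigr => p _; rewrite -big_split.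
by apply: eq_bigr => q _; rewrite mcoeffD mulrDl scalerDl.
Qed.

Lemma pathalg_mulDr : right_distributive pathalg_mul +%R.
Proof.
move=> x y z.
rewrite (pathalg_mulw (fsubset_refl _) (msuppD_le y z)).
rewrite (pathalg_mulw (fsubset_refl _) (fsubsetUl (msupp y) (msupp z))).
rewrite (pathalg_mulw (fsubset_refl _) (fsubsetUr (msupp y) (msupp z))).
rewrite -big_split; apply: eq_bigr => p _; rewrite -big_split.
by apply: eq_bigr => q _; rewrite mcoeffD mulrDr scalerDl.
Qed.

Lemma pathalg_mulZl a x y : pathalg_mul (a *: x) y = a *: pathalg_mul x y.
Proof.
rewrite (pathalg_mulw (msuppZ_le a x) (fsubset_refl _)) [in RHS]pathalg_mul.unlock
  scaler_sumr.
apply: eq_bigr => p _; rewrite scaler_sumr; apply: eq_bigr => q _.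
by rewrite mcoeffZ scalerA mulrA.
Qed.

Lemma pathalg_mulZr a x y : pathalg_mul x (a *: y) = a *: pathalg_mul x y.
Proof.
rewrite (pathalg_mulw (fsubset_refl _) (msuppZ_le a y)) [in RHS]pathalg_mul.unlock
  scaler_sumr.
apply: eq_bigr => p _; rewrite scaler_sumr; apply: eq_bigr => q _.
by rewrite mcoeffZ scalerA mulrCA mulrA.
Qed.

Lemma pathalg_mul0l x : pathalg_mul 0 x = 0.
Proof. by rewrite -[0 in LHS](scale0r (0 : pathalg)) pathalg_mulZl scale0r. Qed.

Lemma pathalg_mul0r x : pathalg_mul x 0 = 0.
Proof. by rewrite -[0 in LHS](scale0r (0 : pathalg)) pathalg_mulZr scale0r. Qed.

Lemma pathalg_mulsl J (r : seq J) (P : pred J) (F : J -> pathalg) y :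
  pathalg_mul (\sum_(j <- r | P j) F j) y = \sum_(j <- r | P j) pathalg_mul (F j) y.
Proof.
exact: (big_morph (pathalg_mul^~ y) (fun a b => pathalg_mulDl a b y)
         (pathalg_mul0l y)).
Qed.

Lemma pathalg_mulsr J (r : seq J) (P : pred J) (F : J -> pathalg) y :
  pathalg_mul y (\sum_(j <- r | P j) F j) = \sum_(j <- r | P j) pathalg_mul y (F j).
Proof.
exact: (big_morph (pathalg_mul y) (fun a b => pathalg_mulDr y a b)
         (pathalg_mul0r y)).
Qed.

Lemma pathalg_mulUU p q : pathalg_mul (pbasis p) (pbasis q) = pprod p q.
Proof.
rewrite pbasis.unlock.
rewrite (pathalg_mulw (msuppU_le (k := p) (x := 1)) (msuppU_le (k := q) (x := 1))).
by rewrite !big_seq_fset1 !mcoeffUU mulr1 scale1r.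
Qed.

Lemma pathalgE (x : pathalg) : x = \sum_(p <- msupp x) mcoeff p x *: pbasis p.
Proof. by rewrite pbasis.unlock; exact: malg_basisE. Qed.

Lemma pathalg_ext (f g : pathalg -> pathalg) : linear f -> linear g ->
  (forall p, f (pbasis p) = g (pbasis p)) -> f =1 g.
Proof.
move=> lf lg efg x.
pose F := GRing.isLinear.Build _ _ _ _ f lf.
pose G := GRing.isLinear.Build _ _ _ _ g lg.
pose f' : {linear pathalg -> pathalg} := HB.pack f F.
pose g' : {linear pathalg -> pathalg} := HB.pack g G.
rewrite -[f x]/(f' x) -[g x]/(g' x).
rewrite [X in f' X](pathalgE x) [X in g' X](pathalgE x) !linear_sum.
by apply: eq_bigr => p _; rewrite !linearZ /= efg.
Qed.

Lemma pathalg_linl y : linear (pathalg_mul^~ y).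
Proof. by move=> a u v; rewrite /= pathalg_mulDl pathalg_mulZl. Qed.

Lemma pathalg_linr y : linear (pathalg_mul y).
Proof. by move=> a u v; rewrite /= pathalg_mulDr pathalg_mulZr. Qed.

Lemma pathalg_mulA : associative pathalg_mul.
Proof.
move=> x y z.
apply: (pathalg_ext (f := fun x => pathalg_mul x (pathalg_mul y z))
    (g := fun x => pathalg_mul (pathalg_mul x y) z)) => [a u v|a u v|p] /=.
- by rewrite !pathalg_linl.
- by rewrite !pathalg_linl.
apply: (pathalg_ext (f := fun y => pathalg_mul (pbasis p) (pathalg_mul y z))
    (g := fun y => pathalg_mul (pathalg_mul (pbasis p) y) z)) => [a u v|a u v|q] /=.
- by rewrite pathalg_linl pathalg_linr.
- by rewrite pathalg_linr pathalg_linl.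
apply: (pathalg_ext (f := fun z => pathalg_mul (pbasis p) (pathalg_mul (pbasis q) z))
  (g := fun z => pathalg_mul (pathalg_mul (pbasis p) (pbasis q)) z))
  => [a u v|a u v|r] /=.
- by rewrite !pathalg_linr.
- by rewrite !pathalg_linr.
rewrite !pathalg_mulUU pprod.unlock; have := pcompA p q r.
case: (pcomp q r) => [u|]; case: (pcomp p q) => [v|] /= e.
- by rewrite !pathalg_mulUU pprod.unlock e.
- by rewrite pathalg_mulUU pathalg_mul0l pprod.unlock e.
- by rewrite pathalg_mulUU pathalg_mul0r pprod.unlock -e.
- by rewrite pathalg_mul0l pathalg_mul0r.
Qed.

Lemma pathalg_mul1l : left_id pathalg_one pathalg_mul.
Proof.
apply: pathalg_ext => [a u v|a u v|p] /=; first exact: pathalg_linr.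
  by [].
rewrite pathalg_mulsl (bigD1 (pstart p)) //= big1 ?addr0 => [|i ne].
  by rewrite pathalg_mulUU pprod.unlock pcomp_triv_l eqxx.
by rewrite pathalg_mulUU pprod.unlock pcomp_triv_l (negbTE ne).
Qed.

Lemma pathalg_mul1r : right_id pathalg_one pathalg_mul.
Proof.
apply: pathalg_ext => [a u v|a u v|p] /=; first exact: pathalg_linl.
  by [].
rewrite pathalg_mulsr (bigD1 (pend p)) //= big1 ?addr0 => [|i ne].
  by rewrite pathalg_mulUU pprod.unlock pcomp_triv_r eqxx.
by rewrite pathalg_mulUU pprod.unlock pcomp_triv_r eq_sym (negbTE ne).
Qed.

HB.instance Definition _ := GRing.Zmodule_isPzRing.Build pathalg
  pathalg_mulA pathalg_mul1l pathalg_mul1r pathalg_mulDl pathalg_mulDr.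

(* [algType] is reserved to nonzero rings in MathComp, and the path algebra of
   the empty quiver is zero; hence the compatibility of the two structures is
   stated as lemmas. *)
Lemma pathalg_scaleAl (a : k) (x y : pathalg) : a *: (x * y) = (a *: x) * y.
Proof. by rewrite -[RHS]/(pathalg_mul _ _) pathalg_mulZl. Qed.

Lemma pathalg_scaleAr (a : k) (x y : pathalg) : a *: (x * y) = x * (a *: y).
Proof. by rewrite -[RHS]/(pathalg_mul _ _) pathalg_mulZr. Qed.

Definition pathalg_deg (n : nat) : set pathalg :=
  [set x | forall p, p \in msupp x -> plen p = n].

End PathAlgebraTheory.

Section BoundQuiverAlgebra.
Variables (k : fieldType) (Q : quiver) (G : set (pathalg k Q)).
Local Notation T := (pathalg k Q).

Definition ideal_gen : set T := [set x | exists2 s : seq (T * T * T),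
  (forall t, t \in s -> G t.1.2) & x = \sum_(t <- s) t.1.1 * t.1.2 * t.2].

Lemma ideal_gen0 : ideal_gen 0.
Proof. by exists [::] => //; rewrite big_nil. Qed.

Lemma ideal_genD x y : ideal_gen x -> ideal_gen y -> ideal_gen (x + y).
Proof.
move=> [s sG ->] [s' s'G ->]; exists (s ++ s'); last by rewrite big_cat.
by move=> t; rewrite mem_cat => /orP[/sG|/s'G].
Qed.

Lemma ideal_genMl a x : ideal_gen x -> ideal_gen (a * x).
Proof.
move=> [s sG ->]; exists [seq (a * t.1.1, t.1.2, t.2) | t <- s].
  by move=> _ /mapP[t ts ->] /=; exact: sG ts.
by rewrite big_map mulr_sumr; apply: eq_bigr => t _; rewrite !mulrA.
Qed.

Lemma ideal_genMr a x : ideal_gen x -> ideal_gen (x * a).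
Proof.
move=> [s sG ->]; exists [seq (t.1.1, t.1.2, t.2 * a) | t <- s].
  by move=> _ /mapP[t ts ->] /=; exact: sG ts.
by rewrite big_map mulr_suml; apply: eq_bigr => t _; rewrite !mulrA.
Qed.

Lemma ideal_genN x : ideal_gen x -> ideal_gen (- x).
Proof. by move=> Gx; rewrite -mulN1r; exact: ideal_genMl. Qed.

Lemma ideal_genZ (a : k) x : ideal_gen x -> ideal_gen (a *: x).
Proof.
by move=> Gx; rewrite -[x]mul1r pathalg_scaleAl; exact: ideal_genMl.
Qed.

Definition ideal_eqv (x y : T) : bool := `[< ideal_gen (x - y) >].

Lemma ideal_eqv_refl : reflexive ideal_eqv.
Proof. by move=> x; apply/asboolP; rewrite subrr; exact: ideal_gen0. Qed.

Lemma ideal_eqv_sym : symmetric ideal_eqv.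
Proof.
by move=> x y; apply/asboolP/asboolP => /ideal_genN; rewrite opprB.
Qed.

Lemma ideal_eqv_trans : transitive ideal_eqv.
Proof.
move=> y x z /asboolP xy /asboolP yz; apply/asboolP.
by rewrite -(subrKA y); exact: ideal_genD.
Qed.

Canonical ideal_equiv :=
  EquivRel ideal_eqv ideal_eqv_refl ideal_eqv_sym ideal_eqv_trans.

Definition bqalg : Type := {eq_quot ideal_equiv}.
HB.instance Definition _ := Choice.on bqalg.
HB.instance Definition _ := EqQuotient.on bqalg.

Definition bqpi (x : T) : bqalg := \pi_bqalg x.

Lemma bqpiP x y : bqpi x = bqpi y <-> ideal_gen (x - y).
Proof.
split=> [/eqP|xy]; first by rewrite /bqpi (eqmodE ideal_equiv) => /asboolP.
by apply/eqP; rewrite /bqpi (eqmodE ideal_equiv); apply/asboolP.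
Qed.

Lemma bqpi_repr x : bqpi (repr x) = x.
Proof. exact: reprK. Qed.

Lemma bqpi_ind (P : bqalg -> Prop) : (forall x, P (bqpi x)) -> forall x, P x.
Proof. by move=> H x; rewrite -(bqpi_repr x). Qed.

Lemma repr_bqpi x : ideal_gen (repr (bqpi x) - x).
Proof. by apply/bqpiP; rewrite bqpi_repr. Qed.

Definition bq_add (x y : bqalg) := bqpi (repr x + repr y).
Definition bq_opp (x : bqalg) := bqpi (- repr x).
Definition bq_mul (x y : bqalg) := bqpi (repr x * repr y).
Definition bq_scale (a : k) (x : bqalg) := bqpi (a *: repr x).

Lemma bq_addE x y : bq_add (bqpi x) (bqpi y) = bqpi (x + y).
Proof.
apply/bqpiP; rewrite opprD addrACA.
by apply: ideal_genD; exact: repr_bqpi.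
Qed.

Lemma bq_oppE x : bq_opp (bqpi x) = bqpi (- x).
Proof. by apply/bqpiP; rewrite -opprD; apply: ideal_genN; exact: repr_bqpi. Qed.

Lemma bq_mulE x y : bq_mul (bqpi x) (bqpi y) = bqpi (x * y).
Proof.
apply/bqpiP; rewrite -(subrKA (repr (bqpi x) * y)) -mulrBr -mulrBl.
by apply: ideal_genD; [apply: ideal_genMl | apply: ideal_genMr];
  exact: repr_bqpi.
Qed.

Lemma bq_scaleE a x : bq_scale a (bqpi x) = bqpi (a *: x).
Proof.
by apply/bqpiP; rewrite -scalerBr; apply: ideal_genZ; exact: repr_bqpi.
Qed.

Lemma bq_addA : associative bq_add.
Proof.
elim/bqpi_ind=> x; elim/bqpi_ind=> y; elim/bqpi_ind=> z.
by rewrite !bq_addE addrA.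
Qed.

Lemma bq_addC : commutative bq_add.
Proof.
by elim/bqpi_ind=> x; elim/bqpi_ind=> y; rewrite !bq_addE addrC.
Qed.

Lemma bq_add0 : left_id (bqpi 0) bq_add.
Proof. by elim/bqpi_ind=> x; rewrite bq_addE add0r. Qed.

Lemma bq_addN : left_inverse (bqpi 0) bq_opp bq_add.
Proof. by elim/bqpi_ind=> x; rewrite bq_oppE bq_addE addNr. Qed.

HB.instance Definition _ := GRing.isZmodule.Build bqalg
  bq_addA bq_addC bq_add0 bq_addN.

Lemma bqpiD x y : bqpi (x + y) = bqpi x + bqpi y.
Proof. by rewrite -[RHS]/(bq_add _ _) bq_addE. Qed.

Lemma bq_mulA : associative bq_mul.
Proof.
elim/bqpi_ind=> x; elim/bqpi_ind=> y; elim/bqpi_ind=> z.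
by rewrite !bq_mulE mulrA.
Qed.

Lemma bq_mul1l : left_id (bqpi 1) bq_mul.
Proof. by elim/bqpi_ind=> x; rewrite bq_mulE mul1r. Qed.

Lemma bq_mul1r : right_id (bqpi 1) bq_mul.
Proof. by elim/bqpi_ind=> x; rewrite bq_mulE mulr1. Qed.

Lemma bq_mulDl : left_distributive bq_mul +%R.
Proof.
elim/bqpi_ind=> x; elim/bqpi_ind=> y; elim/bqpi_ind=> z.
by rewrite -bqpiD !bq_mulE mulrDl bqpiD.
Qed.

Lemma bq_mulDr : right_distributive bq_mul +%R.
Proof.
elim/bqpi_ind=> x; elim/bqpi_ind=> y; elim/bqpi_ind=> z.
by rewrite -bqpiD !bq_mulE mulrDr bqpiD.
Qed.

HB.instance Definition _ := GRing.Zmodule_isPzRing.Build bqalg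
  bq_mulA bq_mul1l bq_mul1r bq_mulDl bq_mulDr.

Lemma bqpiM x y : bqpi (x * y) = bqpi x * bqpi y.
Proof. by rewrite -[RHS]/(bq_mul _ _) bq_mulE. Qed.

Lemma bqpi1 : bqpi 1 = 1.
Proof. by []. Qed.

Lemma bq_scaleA a b x : bq_scale a (bq_scale b x) = bq_scale (a * b) x.
Proof. by elim/bqpi_ind: x => x; rewrite !bq_scaleE scalerA. Qed.

Lemma bq_scale1 : left_id 1 bq_scale.
Proof. by elim/bqpi_ind=> x; rewrite bq_scaleE scale1r. Qed.

Lemma bq_scaleDr : right_distributive bq_scale +%R.
Proof.
move=> a; elim/bqpi_ind=> x; elim/bqpi_ind=> y.
by rewrite -bqpiD !bq_scaleE scalerDr bqpiD.
Qed.

Lemma bq_scaleDl x : {morph bq_scale^~ x : a b / a + b}.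
Proof.
by move=> a b; elim/bqpi_ind: x => x; rewrite /= !bq_scaleE scalerDl bqpiD.
Qed.

HB.instance Definition _ := GRing.Zmodule_isLmodule.Build k bqalg
  bq_scaleA bq_scale1 bq_scaleDr bq_scaleDl.

Lemma bqpiZ a x : bqpi (a *: x) = a *: bqpi x.
Proof. by rewrite -[RHS]/(bq_scale _ _) bq_scaleE. Qed.

Lemma bqalg_scaleAl (a : k) (x y : bqalg) : a *: (x * y) = (a *: x) * y.
Proof.
elim/bqpi_ind: x => x; elim/bqpi_ind: y => y.
by rewrite -(bqpiM x y) -(bqpiZ a x) -(bqpiM _ y) -bqpiZ pathalg_scaleAl.
Qed.

Lemma bqalg_scaleAr (a : k) (x y : bqalg) : a *: (x * y) = x * (a *: y).
Proof.
elim/bqpi_ind: x => x; elim/bqpi_ind: y => y.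
by rewrite -(bqpiM x y) -(bqpiZ a y) -(bqpiM x) -bqpiZ pathalg_scaleAr.
Qed.

Definition bqalg_deg (n : nat) : set bqalg := bqpi @` pathalg_deg n.

Definition bqalg_comp (n : nat) (i j : qvtx Q) : set bqalg :=
  [set bqpi (pbasis k (ptriv i)) * x * bqpi (pbasis k (ptriv j))
    | x in bqalg_deg n].

End BoundQuiverAlgebra.

Section GradedModules.

(* [gr] exhibits the additive group [M] as the direct sum of the [gr n]. *)
Definition graded_group (M : zmodType) (gr : nat -> set M) : Prop :=
  [/\ forall n, gr n 0,
      forall n x y, gr n x -> gr n y -> gr n (x - y),
      forall x, exists N, exists2 y : nat -> M,
        (forall n, gr n (y n)) & x = \sum_(n < N) y n
    & forall N (y : nat -> M), (forall n, gr n (y n)) ->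
        \sum_(n < N) y n = 0 -> forall n, (n < N)%N -> y n = 0].

Definition graded_ring (A : pzRingType) (gr : nat -> set A) : Prop :=
  [/\ graded_group gr, gr 0%N 1
    & forall m n x y, gr m x -> gr n y -> gr (m + n)%N (x * y)].

Variables (A : pzRingType) (gr : nat -> set A).

Definition graded_module (M : lmodType A) (grM : nat -> set M) : Prop :=
  graded_group grM /\
  forall m n a x, gr m a -> grM n x -> grM (m + n)%N (a *: x).

Definition generated_in_degree (M : lmodType A) (grM : nat -> set M) (d : nat) :=
  forall x, exists2 s : seq (A * M),
    (forall t, t \in s -> grM d t.2) & x = \sum_(t <- s) t.1 *: t.2.

Definition projective_module (P : lmodType A) : Prop :=
  forall (M N : lmodType A) (g : {linear M -> N}) (f : {linear P -> N}),
    (forall y, exists x, g x = y) ->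
    exists h : {linear P -> M}, forall x, g (h x) = f x.

Definition left_ideal0 (L : set A) : Prop :=
  [/\ L `<=` gr 0%N, L 0, forall x y, L x -> L y -> L (x - y)
    & forall a x, gr 0%N a -> L x -> L (a * x)].

(* Every left ideal of the ring [gr 0] has a complement. *)
Definition semisimple0 : Prop :=
  forall L, left_ideal0 L -> exists L', [/\ left_ideal0 L',
    forall x, L x -> L' x -> x = 0
    & forall x, gr 0%N x -> exists y z, [/\ L y, L' z & x = y + z]].

Definition positive_part : set A := [set x | exists N, exists2 y : nat -> A,
  (forall n, gr n.+1 (y n)) & x = \sum_(n < N) y n].

(* [K] is the graded left module [A_0 = A / A_{>0}], concentrated in degree 0. *)
Definition degree0_module (K : lmodType A) (pi : {linear A^o -> K}) : Prop :=
  (forall z, exists a, pi a = z) /\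
  (forall a, pi a = 0 <-> positive_part a).

(* A linear graded projective resolution
     ... -> res 2 -> res 1 -> res 0 -> A_0 -> 0
   with [res i] generated in degree [i]. *)
Definition has_linear_resolution : Prop :=
  exists (K : lmodType A) (pi : {linear A^o -> K})
    (res : nat -> lmodType A) (grr : forall i, nat -> set (res i))
    (d : forall i, {linear res i.+1 -> res i}) (eps : {linear res 0%N -> K}),
  [/\ degree0_module pi,
      forall i, [/\ graded_module (grr i), projective_module (res i)
                  & generated_in_degree (grr i) i],
      (forall i n x, grr i.+1 n x -> grr i n (d i x)) /\
      (forall n x, grr 0%N n.+1 x -> eps x = 0),
      (forall z, exists x, eps x = z) /\
      (forall x, eps x = 0 <-> exists y, d 0%N y = x)
    & forall i x, d i x = 0 <-> exists y, d i.+1 y = x].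

Definition koszul : Prop :=
  [/\ graded_ring gr, semisimple0 & has_linear_resolution].

End GradedModules.

Record modulated_graph (k : fieldType) := ModulatedGraph {
  mgvtx : finType;
  mgspace : mgvtx -> mgvtx -> vectType k;
  mgform : forall i j, {bilinear mgspace i j -> mgspace j i -> k^o};
  mgform_nondegl : forall i j (v : mgspace i j),
    (forall w, mgform i j v w = 0) -> v = 0;
  mgform_nondegr : forall i j (w : mgspace j i),
    (forall v, mgform i j v w = 0) -> w = 0 }.

Section ModulatedGraph.
Variables (k : fieldType) (Ga : modulated_graph k).
Local Notation I := (mgvtx Ga).
Local Notation V := (@mgspace k Ga).
Local Notation E := (@mgform k Ga).

Definition mgadj (i j : I) : nat := \dim {:V i j}.

(* [mgE i j] is the map [E_ij : v |-> E_ij(v, -)], and [mgEt i j] is the map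
   [E_ij^t : w |-> E_ij(-, w)]. *)
Definition mgE i j : 'Hom(V i j, 'Hom(V j i, k^o)) :=
  linfun (fun v => linfun (E i j v)).

Definition mgEt i j : 'Hom(V j i, 'Hom(V i j, k^o)) :=
  linfun (fun w => linfun (fun v => E i j v w)).

Lemma mgEE i j v w : mgE i j v w = E i j v w.
Proof.
rewrite /mgE; set f := (X in linfun X).
have lf : linear f.
  move=> a x y; apply/lfunP => z.
  rewrite /f lfunE add_lfunE scale_lfunE !lfunE /=.
  by rewrite linearPl.
pose F : {linear _ -> _} := HB.pack f (GRing.isLinear.Build _ _ _ _ f lf).
by rewrite -[linfun f]/(linfun F) lfunE /= /f lfunE.
Qed.

Lemma mgEtE i j v w : mgEt i j w v = E i j v w.
Proof.
have lg u : linear (fun v : V i j => E i j v u : k^o).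
  by move=> a x y; rewrite linearPl.
pose G u : {linear V i j -> k^o} :=
  HB.pack (fun v : V i j => E i j v u : k^o) (GRing.isLinear.Build _ _ _ _ _ (lg u)).
rewrite /mgEt; set f := (X in linfun X).
have lf : linear f.
  move=> a x y; apply/lfunP => z; rewrite !lfunE /= !lfunE /=.
  rewrite -[f _]/(linfun (G _)) -[f x]/(linfun (G _)) -[f y]/(linfun (G _)).
  by rewrite !lfunE /= linearPr.
pose F : {linear _ -> _} := HB.pack f (GRing.isLinear.Build _ _ _ _ f lf).
rewrite -[linfun f]/(linfun F) lfunE /= -[f w]/(linfun (G w)).
by rewrite lfunE.
Qed.

Definition lftrace (U : vectType k) (f : 'End(U)) : k :=
  \tr (passmx.mxof (vbasis {:U}) (vbasis {:U}) f).

Definition mgtrace (i j : I) : k := lftrace (mgE i j \o (mgEt j i)^-1)%VF.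

Definition mgquiver : quiver := @Quiver I
  {ij : I * I & 'I_(mgadj ij.1 ij.2)}
  (fun a => (tag a).1) (fun a => (tag a).2).

Definition mgarrow i j (a : 'I_(mgadj i j)) : qarr mgquiver :=
  Tagged (fun ij : I * I => 'I_(mgadj ij.1 ij.2)) (a : 'I_(mgadj (i, j).1 (i, j).2)).

(* The inclusion of [V_ij] in [T(V)], identified with the path algebra by means
   of the bases [vbasis] of the spaces. *)
Definition mginj i j (v : V i j) : pathalg k mgquiver :=
  \sum_(a < mgadj i j) coord (vbasis {:V i j}) a v *: pbasis k (parr (mgarrow a)).

(* The basis [w_a] of [V_ji] with [E_ji(w_a, v_b) = delta_ab], where
   [v = vbasis {:V i j}]. *)
Definition mgdual i j (a : 'I_(mgadj i j)) : V j i :=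
  ((mgE j i)^-1)%VF (linfun (coord (vbasis {:V i j}) a : V i j -> k^o)).

Lemma mgE_ker i j : lker (mgE i j) == 0%VS.
Proof.
apply/lker0P => x y /(congr1 (fun f => f - mgE i j y)).
rewrite subrr -linearB => e; apply/eqP; rewrite -subr_eq0; apply/eqP.
by apply: mgform_nondegl => w; rewrite -mgEE e lfunE.
Qed.

Lemma mgEt_ker i j : lker (mgEt i j) == 0%VS.
Proof.
apply/lker0P => x y /(congr1 (fun f => f - mgEt i j y)).
rewrite subrr -linearB => e; apply/eqP; rewrite -subr_eq0; apply/eqP.
by apply: mgform_nondegr => w; rewrite -mgEtE e lfunE.
Qed.

Lemma mgadj_dual i j : \dim {:'Hom(V i j, k^o)} = mgadj i j.
Proof. by rewrite /mgadj !dimvf /dim /= muln1. Qed.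

Lemma mgadj_sym i j : mgadj i j = mgadj j i.
Proof.
have le x y : (mgadj x y <= mgadj y x)%N.
  have <- : \dim (limg (mgE x y)) = mgadj x y.
    by apply: limg_dim_eq; rewrite (eqP (mgE_ker x y)) capv0.
  by rewrite -(mgadj_dual y x); apply: dimvS; exact: subvf.
by apply/eqP; rewrite eqn_leq !le.
Qed.

Lemma mgE_img i j : limg (mgE i j) = fullv.
Proof.
apply/eqP; rewrite eqEdim subvf mgadj_dual mgadj_sym.
have -> : \dim (limg (mgE i j)) = mgadj i j.
  by apply: limg_dim_eq; rewrite (eqP (mgE_ker i j)) capv0.
exact: leqnn.
Qed.

Lemma mgEt_img i j : limg (mgEt i j) = fullv.
Proof.
apply/eqP; rewrite eqEdim subvf mgadj_dual mgadj_sym.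
have -> : \dim (limg (mgEt i j)) = mgadj j i.
  by apply: limg_dim_eq; rewrite (eqP (mgEt_ker i j)) capv0.
exact: leqnn.
Qed.

Lemma mgdualP i j (a b : 'I_(mgadj i j)) :
  E j i (mgdual a) (vbasis {:V i j})`_b = (a == b)%:R.
Proof.
rewrite -mgEE /mgdual limg_lfunVK; last by rewrite mgE_img memvf.
set f : V i j -> k^o := coord _ a.
have lf : linear f by move=> c x y; rewrite /f linearP.
pose F : {linear V i j -> k^o} := HB.pack f (GRing.isLinear.Build _ _ _ _ f lf).
rewrite -[linfun f]/(linfun F) lfunE /= /f coord_free //.
by rewrite eq_sym.
by apply: basis_free; exact: vbasisP.
Qed.

Definition mgcoev (i : I) : pathalg k mgquiver :=
  \sum_(j : I) \sum_(a < mgadj i j)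
    mginj (vbasis {:V i j})`_a * mginj (mgdual a).

Definition preproj : Type := bqalg (range mgcoev).
HB.instance Definition _ := GRing.PzRing.on preproj.
HB.instance Definition _ := GRing.Lmodule.on preproj.

Definition preproj_deg (n : nat) : set preproj :=
  @bqalg_deg k mgquiver (range mgcoev) n.

Definition preproj_comp (n : nat) (i j : I) : set preproj :=
  @bqalg_comp k mgquiver (range mgcoev) n i j.

End ModulatedGraph.

Definition nondegenerate_eigenvalue (k : fieldType) (I : finType)
    (b : I -> I -> k) (lam : k) : Prop :=
  exists2 r : I -> k, (forall i, \sum_j b i j * r j = lam * r i)
    & \prod_i r i != 0.

Definition has_dim (k : fieldType) (M : lmodType k) (S : set M) (d : nat) : Prop :=
  exists b : 'I_d -> M,
    (forall c : 'I_d -> k, \sum_i c i *: b i = 0 -> forall i, c i = 0) /\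
    (forall x, S x <-> exists c : 'I_d -> k, x = \sum_i c i *: b i).

Section MatrixSeries.
Variable I : finType.

(* Square matrices over [I], the index set ['I_#|I|] being identified with [I]
   by [enum_val]. *)
Definition natmx (a : I -> I -> nat) : 'M[int]_#|I| :=
  \matrix_(i, j) (a (enum_val i) (enum_val j))%:Z.

(* Formal power series with coefficients in the ring of integer matrices. *)
Definition mxseries : Type := nat -> 'M[int]_#|I|.

Definition mxseries_mul (f g : mxseries) : mxseries :=
  fun n => \sum_(m < n.+1) f m *m g (n - m)%N.

Definition mxseries_one : mxseries := fun n => if n is 0 then 1%:M else 0.

Definition mxseries_inverse (f g : mxseries) : Prop :=
  mxseries_mul f g = mxseries_one /\ mxseries_mul g f = mxseries_one.

(* 1 - A t + t^2 *)
Definition preproj_denom (a : I -> I -> nat) : mxseries :=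
  fun n => match n with 0 => 1%:M | 1 => - natmx a | 2 => 1%:M | _ => 0 end.

End MatrixSeries.

Definition matrix_hilbert_series (k : fieldType) (Ga : modulated_graph k)
    (h : mxseries (mgvtx Ga)) : Prop :=
  exists2 d : nat -> mgvtx Ga -> mgvtx Ga -> nat,
    (forall n i j, has_dim (preproj_comp n i j) (d n i j)) &
    h = fun n => natmx (d n).

Section Graphs.
Variables (I : finType) (adj : I -> I -> nat).

Definition graph_connected : Prop :=
  (0 < #|I|)%N /\ forall i j, connect (fun x y => (0 < adj x y)%N) i j.

(* [std] gives the number of edges between the vertices 0, ..., n - 1. *)
Definition graph_iso (n : nat) (std : nat -> nat -> nat) : Prop :=
  exists2 f : I -> 'I_n, bijective f & forall i j, adj i j = std (f i) (f j).

Definition path_adj (i j : nat) : nat := (i.+1 == j) || (j.+1 == i).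

Definition tadpole_adj (i j : nat) : nat :=
  [|| i.+1 == j, j.+1 == i | (i == 0%N) && (j == 0%N)].

(* The path 0 - 1 - ... - (m - 1) with an extra vertex m attached to b < m. *)
Definition branch_adj (m b i j : nat) : nat :=
  [|| [&& i < m, j < m & (i.+1 == j) || (j.+1 == i)],
      (i == m) && (j == b) | (i == b) && (j == m)]%N.

Definition ADET_type : Prop := exists n : nat,
  [\/ (1 <= n)%N /\ graph_iso n path_adj,
      (4 <= n)%N /\ graph_iso n (branch_adj n.-1 (n - 3)),
      [\/ n = 6, n = 7 | n = 8]%N /\ graph_iso n (branch_adj n.-1 2)
    | (1 <= n)%N /\ graph_iso n tadpole_adj].

End Graphs.

(* Main.v *)
(** Put P = P(Gamma), let v_a be the basis of V given by the arrows and w_a the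
    dual basis, so that the relations say that sum_a v_a w_a = 0.  The complex
    of left modules 0 -> P -> P (x) V -> P -> P_0 -> 0, with maps
    x |-> (x v_a)_a and (y_a)_a |-> sum_a y_a w_a, is exact except possibly at
    its left end, simply because P is a quadratic quotient of the path algebra.
    So both claims hold as soon as no x <> 0 satisfies x V = 0.

    Fix a vertex i and let M_n be the degree n part of e_i P.  By induction on n
    every pair of graded endomorphisms of M_n and M_(n+1) compatible with right
    multiplication by V is a common scalar: if no nonzero element of M_n is
    killed by V, exactness makes an endomorphism of the pair (M_(n+1), M_(n+2))
    come from one of (M_n, M_(n+1)), as for reflection functors.  And if some
    x <> 0 in M_n is killed by V while M_(n+1) <> 0, a rank one map onto x,
    paired with 0, is not a scalar.  It remains to see that M_n never vanishes.
    A connected graph that is not of ADET type carries a positive integer vector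
    y with A y >= 2 y, and pairing the recursion
    dim M_(n+2) + dim M_n = A dim M_(n+1) with y shows that y . dim M_n strictly
    increases with n. *)
From HB Require Import structures.
Require Import Defs.
From mathcomp Require Import all_boot all_order all_algebra.
From mathcomp Require Import finmap boolp classical_sets zify.
From mathcomp.multinomials Require Import monalg.

Set Implicit Arguments.
Unset Strict Implicit.
Unset Printing Implicit Defensive.

(** * Graphs that are not of ADET type *)

(** The pair of [M_n] and [M_(n+1)] is a representation of the bipartite double of Gamma, which has
    two copies of the vertices and whose edges run from one copy to the other. Passing to the next
    pair takes the cokernel of [M_n] in [M_(n+1)] tensored with V, like a composite of reflection
    functors. Such a functor loses endomorphisms only by killing simple summands, and a socle
    element is exactly such a summand. This is why endomorphisms are carried through the induction
    instead of the socle itself. Loops fit in because the double of the tadpole T_n is the Dynkin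
    path A_(2n).

    The vector y originates in the null vectors of the affine diagrams and of their analogues with
    loops: on such a subgraph one has A y = 2 y, further edges only increase A y, and the support is
    then spread over the connected graph. What has to be shown is that a connected graph avoiding
    all these subgraphs is of ADET type. *)

Section Graphs.
Variables (I : finType) (adj : I -> I -> nat).
Hypothesis adjC : forall i j, adj i j = adj j i.

(** Zero entries are allowed, so that a vector supported on a subgraph qualifies. *)
Definition subharmonic (y : I -> nat) :=
  forall i, 2 * y i <= \sum_j adj i j * y j.

Lemma sum_uniq_le N (l : seq nat) (F : nat -> nat) :
  uniq l -> all (gtn N) l -> \sum_(j <- l) F j <= \sum_(j < N) F j.
Proof.
move=> Ul /allP lN; rewrite -(big_mkord xpredT F) /index_iota subn0.
have pe : perm_eq l [seq j <- iota 0 N | j \in l].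
  apply: uniq_perm => //; first by rewrite filter_uniq ?iota_uniq.
  move=> j; rewrite mem_filter mem_iota add0n /=.
  by case jl: (j \in l) => //=; apply/esym/(lN j jl).
by rewrite (perm_big _ pe) big_filter big_mkcond; apply: leq_sum => j _; case: ifP.
Qed.

(** Extending [c] by zero costs nothing: a vertex of weight 0 satisfies the inequality trivially.
    Injectivity of [s] makes the sum over the fibres in [y] collapse to [c]. *)
Lemma weighted_family N (s : nat -> I) (c : nat -> nat) :
  {in gtn N &, injective s} -> (exists2 i, i < N & 0 < c i) ->
  (forall i, i < N -> 0 < c i ->
     2 * c i <= \sum_(j < N) adj (s i) (s j) * c j) ->
  exists2 y, subharmonic y & exists i, 0 < y i.
Proof.
move=> inj [i0 i0N c0] H.
pose y z := \sum_(j < N) (s j == z) * c j.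
have ys i : i < N -> y (s i) = c i.
  move=> iN; rewrite /y (bigD1 (Ordinal iN)) //= eqxx mul1n big1 ?addn0 // => j ne.
  case: eqP => // /inj e; case/eqP: ne; apply: val_inj; rewrite /= e // inE.
  exact: ltn_ord.
exists y; last by exists (s i0); rewrite ys.
move=> z; case: (posnP (y z)) => [->|yz]; first by rewrite muln0.
have [i iN ez] : exists2 i, i < N & s i = z.
  move: yz; rewrite /y lt0n sum_nat_eq0 => /forallPn[i].
  by rewrite /= muln_eq0 negb_or eqb0 negbK => /andP[/eqP e _]; exists i.
rewrite -ez ys //; apply: leq_trans (H i iN _) _; first by rewrite -ys ?ez.
rewrite eq_leq //; under [RHS]eq_bigr => w _ do rewrite /y big_distrr /=.
rewrite exchange_big /=; apply: eq_bigr => j _.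
rewrite (bigD1 (s j)) //= eqxx mul1n big1 ?addn0 // => w /negbTE ne.
by rewrite eq_sym ne mul0n muln0.
Qed.

(** The form in which affine subgraphs are used. Each listed neighbour counts once, since
    multiplicities and further edges can only help; the subgraph need not be induced. *)
Lemma neighbor_family N (s : nat -> I) (c : nat -> nat) :
  {in gtn N &, injective s} -> (exists2 i, i < N & 0 < c i) ->
  (forall i, i < N -> 0 < c i -> exists l : seq nat,
    [/\ uniq l, all (fun j => (j < N) && (0 < adj (s i) (s j))) l
      & 2 * c i <= \sum_(j <- l) c j]) ->
  exists2 y, subharmonic y & exists i, 0 < y i.
Proof.
move=> inj c0 H; apply: (weighted_family inj c0) => i iN ci.
have [l [Ul al le]] := H i iN ci; apply: leq_trans le _.
have lN : all (gtn N) l by apply: sub_all al => j /andP[].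
apply: leq_trans _ (sum_uniq_le (fun j => adj (s i) (s j) * c j) Ul lN).
rewrite big_seq [leqRHS]big_seq; apply: leq_sum => j /(allP al)/andP[_ p].
by rewrite leq_pmull.
Qed.

Lemma escape (S : pred I) i0 i1 :
  (forall i j, connect (fun x y => 0 < adj x y) i j) -> S i0 -> ~~ S i1 ->
  exists u w, [/\ ~~ S u, S w & 0 < adj u w].
Proof.
move=> conn Si0 /negP Si1; apply: contrapT => no; case: Si1.
have cl : closed (fun x y => 0 < adj x y) S.
  move=> u w auw; rewrite !unfold_in; case Su: (S u); case Sw: (S w) => //.
    by case: no; exists w, u; rewrite adjC Sw.
  by case: no; exists u, w; rewrite Su.
by have := closed_connect cl (conn i0 i1); rewrite !unfold_in Si0.
Qed.

(** The support grows by one vertex at a time, by induction on the number of zeros; connectedness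
    provides a zero [u] adjacent to the support. *)
Lemma connected_subharmonic :
  (forall i j, connect (fun x y => 0 < adj x y) i j) ->
  (exists2 y, subharmonic y & exists i, 0 < y i) ->
  exists2 y, subharmonic y & forall i, 0 < y i.
Proof.
move=> conn [y yH [i0 yi0]].
move: {2}#|_| (leqnn #|[pred i | y i == 0]|) => n.
elim: n => [|n IH] in y yH yi0 *.
  rewrite leqn0 => /eqP/card0_eq y0; exists y => // i.
  by rewrite lt0n; move: (y0 i); rewrite !inE => ->.
move=> le; have [/forallP p|/forallPn/= [i1]] := boolP [forall i, 0 < y i].
  by exists y.
rewrite -eqn0Ngt => /eqP yi1.
have n1 : ~~ (0 < y i1) by rewrite yi1.
have [u [w [/= yu yw auw]]] := @escape (fun i => 0 < y i) i0 i1 conn yi0 n1.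
move: yu; rewrite -eqn0Ngt => /eqP yu.
(* Doubling makes room for the new entry: [y' u = 1] requires a neighbour sum of at least 2, which
   the doubled value at [w] supplies. *)
pose y' i := 2 * y i + (i == u).
have y'ge i : \sum_j adj i j * y' j = 2 * (\sum_j adj i j * y j) + adj i u.
  rewrite big_distrr /= [X in _ = _ + X](_ : _ = \sum_j adj i j * (j == u)).
    by rewrite -big_split; apply: eq_bigr => j _; rewrite mulnDr mulnCA.
  rewrite (bigD1 u) //= eqxx muln1 big1 ?addn0 // => j /negbTE ->.
  by rewrite muln0.
apply: (IH y').
- move=> i; rewrite y'ge /y'; have := yH i; case: eqP => [->|_]; last by lia.
  rewrite yu (bigD1 w) //=; have : 0 < adj u w * y w by rewrite muln_gt0 auw.
  by lia.
- by rewrite /y'; lia.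
rewrite -ltnS; apply: leq_trans le; apply: proper_card; apply/properP.
split; first by apply/fintype.subsetP => i; rewrite !inE /y'; lia.
by exists u; rewrite !inE /y' ?yu // eqxx.
Qed.

(** [m] counts edges, so there are [m.+1] vertices; values of [x] beyond [m] are arbitrary. *)
Definition ispath m (x : nat -> I) :=
  {in gtn m.+1 &, injective x} /\ forall i, i < m -> 0 < adj (x i) (x i.+1).

Lemma mem_mkseq_rev m (x : nat -> I) :
  mkseq (fun i => x (m - i)) m.+1 =i mkseq x m.+1.
Proof.
move=> z; apply/mapP/mapP => -[i]; rewrite mem_iota => im ->.
  by exists (m - i); rewrite // mem_iota; lia.
by exists (m - i); rewrite ?mem_iota ?subKn //; lia.
Qed.

Lemma ispath_rev m x : ispath m x -> ispath m (fun i => x (m - i)).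
Proof.
move=> [inj ed]; split.
  move=> i j; rewrite !inE => im jm /inj; rewrite !inE => e.
  have : m - i = m - j by apply: e; lia.
  by lia.
move=> i im; rewrite adjC; have := ed (m - i.+1).
by rewrite (_ : (m - i.+1).+1 = m - i); [apply; lia | lia].
Qed.

Lemma ispath_cons m x u : ispath m x -> (forall i, i <= m -> x i <> u) ->
  0 < adj u (x 0) -> ispath m.+1 (fun i => if i is i'.+1 then x i' else u).
Proof.
move=> [inj ed] xu au; split.
  move=> [|i] [|j] //; rewrite !inE !ltnS => im jm e.
  - by case: (xu j).
  - by case: (xu i).
  - by congr _.+1; apply: inj.
by move=> [|i] im //=; apply: ed.
Qed.

Lemma longest_path : 0 < #|I| -> exists m x,
  ispath m x /\ forall m' x', ispath m' x' -> m' <= m.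
Proof.
case/card_gt0P => i0 _.
have ex : exists m, `[< exists x, ispath m x >].
  exists 0; apply/asboolP; exists (fun=> i0); split=> // i j.
  by rewrite !inE !ltnS !leqn0 => /eqP -> /eqP ->.
have bd m : `[< exists x, ispath m x >] -> m <= #|I|.
  move=> /asboolP[x [inj _]].
  have injo : injective (fun i : 'I_m.+1 => x i).
    by move=> i j /inj e; apply: val_inj; apply: e; rewrite inE; apply: ltn_ord.
  by have := leq_card _ injo; rewrite card_ord; lia.
case: (ex_maxnP ex bd) => m /asboolP[x px] mx.
by exists m, x; split=> // m' x' px'; apply: mx; apply/asboolP; exists x'.
Qed.

Lemma graph_iso_enum n (s : nat -> I) std :
  {in gtn n &, injective s} -> (forall z, exists2 i, i < n & s i = z) ->
  (forall i j, i < n -> j < n -> adj (s i) (s j) = std i j) ->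
  graph_iso adj n std.
Proof.
move=> inj sur H.
have sur' z : exists i : 'I_n, s i == z.
  by have [i im e] := sur z; exists (Ordinal im); rewrite /= e.
pose f z := xchoose (sur' z).
have sf z : s (f z) = z by apply/eqP; exact: (xchooseP (sur' z)).
exists f; last by move=> i j; rewrite -H ?sf.
exists (fun i : 'I_n => s i) => // i; apply: val_inj; apply: inj; rewrite ?sf //.
by rewrite inE ltn_ord.
by rewrite inE ltn_ord.
Qed.

(** * Excluded configurations when no subharmonic vector exists *)

Hypothesis noy : ~ exists2 y, subharmonic y & exists i, 0 < y i.

(** A double loop or a double edge (affine A_1) carries the constant weight 1. *)
Lemma adj_le1 i j : adj i j <= 1.
Proof.
rewrite leqNgt; apply/negP => a2; apply: noy.
have [eij|/eqP nij] := eqVneq i j.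
  rewrite -eij in a2.
  apply: (@weighted_family 1 (fun=> i) (fun=> 1)); last 2 first.
  - by exists 0.
  - by move=> ? _ _; rewrite big_ord1; lia.
  by move=> [|?] [|?].
apply: (@weighted_family 2 (fun t => if t is 0 then i else j) (fun=> 1)).
- by move=> [|[|?]] [|[|?]] //= _ _ e; case: nij.
- by exists 0.
by move=> [|[|?]] // _ _; rewrite !big_ord_recl big_ord0 /=; have := adjC i j; lia.
Qed.

Lemma adj1 i j : 0 < adj i j -> adj i j = 1.
Proof. by have := adj_le1 i j; lia. Qed.

(** * Cycles, loops and forks along a path, with extra vertices at the indices above [m] *)

Section OnPath.
Variables (m N : nat) (s : nat -> I).
Hypotheses (mN : m < N) (inj : {in gtn N &, injective s}).
Hypothesis edge : forall i, i < m -> 0 < adj (s i) (s i.+1).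

Let edge' i : 0 < i <= m -> 0 < adj (s i) (s i.-1).
Proof. by case: i => // i /= im; rewrite adjC edge. Qed.

(** A chord closes the segment from [i] to [j] into a cycle, affine of type A, with constant weight
    1. *)
Lemma no_chord i j : i.+1 < j -> j <= m -> adj (s i) (s j) = 0.
Proof.
move=> ij jm; apply/eqP; rewrite -leqn0 leqNgt; apply/negP => a.
apply: noy; apply: (@neighbor_family N s (fun t => i <= t <= j)) => //.
  by exists i; lia.
move=> t tN ct.
have [e|n1] := eqVneq t i.
  exists [:: i.+1; j]; rewrite /= !inE ?big_cons ?big_nil e a edge; try lia.
  by split; lia.
have [e|n2] := eqVneq t j.
  by exists [:: j.-1; i]; rewrite /= !inE ?big_cons ?big_nil e (adjC _ (s i)) a edge';
    try lia; split; lia.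
exists [:: t.-1; t.+1]; rewrite /= !inE ?big_cons ?big_nil edge' ?edge; try lia.
by split; lia.
Qed.

(** A segment with a loop at both ends carries the constant weight 1, each loop standing for the
    missing neighbour; its bipartite double is a cycle. *)
Lemma one_loop i j : i < j -> j <= m -> 0 < adj (s i) (s i) -> adj (s j) (s j) = 0.
Proof.
move=> ij jm ai; apply/eqP; rewrite -leqn0 leqNgt; apply/negP => a.
apply: noy; apply: (@neighbor_family N s (fun t => i <= t <= j)) => //.
  by exists i; lia.
move=> t tN ct.
have [e|n1] := eqVneq t i.
  exists [:: i.+1; i]; rewrite /= !inE ?big_cons ?big_nil e ai edge; try lia.
  by split; lia.
have [e|n2] := eqVneq t j.
  by exists [:: j.-1; j]; rewrite /= !inE ?big_cons ?big_nil e a edge';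
    try lia; split; lia.
exists [:: t.-1; t.+1]; rewrite /= !inE ?big_cons ?big_nil edge' ?edge; try lia.
by split; lia.
Qed.

(** Again a cycle of weight 1: the segment from [p] to [q] closed up through [u]. *)
Lemma no_ear u p q : m < u < N -> p < q -> q <= m -> 0 < adj (s u) (s p) ->
  adj (s u) (s q) = 0.
Proof.
move=> uN pq qm ap; apply/eqP; rewrite -leqn0 leqNgt; apply/negP => a.
apply: noy; apply: (@neighbor_family N s (fun t => (p <= t <= q) || (t == u))) => //.
  by exists p; lia.
move=> t tN ct.
have [e|n1] := eqVneq t p.
  exists [:: p.+1; u]; rewrite /= !inE ?big_cons ?big_nil e (adjC _ (s u)) ap edge; try lia.
  by split; lia.
have [e|n2] := eqVneq t q.
  by exists [:: q.-1; u]; rewrite /= !inE ?big_cons ?big_nil e (adjC _ (s u)) a edge';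
    try lia; split; lia.
have [e|n3] := eqVneq t u.
  by exists [:: p; q]; rewrite /= !inE ?big_cons ?big_nil e a ap;
    try lia; split; lia.
exists [:: t.-1; t.+1]; rewrite /= !inE ?big_cons ?big_nil edge' ?edge; try lia.
by split; lia.
Qed.

(* Affine type D and its loop analogues: weight 2 on the segment, weight 1 on
   the extra vertices [F], and two more units of weight next to both ends. *)
Lemma no_affine_D a b (F La Lb : seq nat) : a <= b <= m ->
  (forall f, f \in F -> [/\ f < N, ~~ (a <= f <= b)
     & exists2 t, a <= t <= b & 0 < adj (s f) (s t)]) ->
  uniq (La ++ Lb) ->
  (forall t, t \in La -> ((t == a) || (t \in F)) && (0 < adj (s a) (s t))) ->
  (forall t, t \in Lb -> ((t == b) || (t \in F)) && (0 < adj (s b) (s t))) ->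
  let c t := if a <= t <= b then 2 else t \in F in
  2 <= \sum_(t <- La) c t -> 2 <= \sum_(t <- Lb) c t -> False.
Proof.
move=> abm HF Uab Ha Hb c sa sb.
apply: noy; apply: (@neighbor_family N s c) => //.
  by exists a; rewrite /c; [lia | case: ifP; lia].
have FN t : t \in F -> t < N by case/HF.
have aN t : t \in La -> t < N by case/Ha/andP => /orP[/eqP ->|/FN] //; lia.
have bN t : t \in Lb -> t < N by case/Hb/andP => /orP[/eqP ->|/FN] //; lia.
have c2 t : a <= t <= b -> c t = 2 by rewrite /c => ->.
move: Uab; rewrite cat_uniq => /and3P[Ua nab Ub].
have alla : all (fun j => (j < N) && (0 < adj (s a) (s j))) La.
  by apply/allP => t tl; rewrite aN //; case/andP: (Ha t tl).
have allb : all (fun j => (j < N) && (0 < adj (s b) (s j))) Lb.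
  by apply/allP => t tl; rewrite bN //; case/andP: (Hb t tl).
move=> t tN; rewrite {1}/c; case: ifP => tab; last first.
  case tF: (t \in F) => // _; have [_ _ [r rab ar]] := HF t tF.
  exists [:: r]; rewrite /= big_seq1 (c2 r) // ar; split=> //; try lia.
  by rewrite /c tab tF.
move=> _; rewrite c2 //.
have inseg r (L : seq nat) (z : nat) :
    (forall t, t \in L -> ((t == z) || (t \in F)) && (0 < adj (s z) (s t))) ->
    a <= r <= b -> r != z -> r \notin L.
  move=> HL rab rz; apply/negP => /HL/andP[/orP[/eqP e|/HF[_]]]; last by rewrite rab.
  by rewrite e eqxx in rz.
(* If [a = b], as in affine D_4, the single vertex of weight 2 needs a neighbour sum of 4 and uses
   both lists at once, hence their disjointness. Otherwise the next vertex of the segment supplies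
   the other 2. *)
have [ea|na] := eqVneq t a.
  have [eb|nb] := eqVneq a b.
    exists (La ++ Lb); rewrite ea cat_uniq Ua nab Ub all_cat alla {1}eb allb big_cat /=.
    by split=> //; lia.
  exists (a.+1 :: La); rewrite ea /= Ua alla edge ?big_cons ?c2; try lia.
  rewrite (inseg _ _ _ Ha); try lia.
  by split=> //; lia.
have [eb|nb] := eqVneq t b.
  exists (b.-1 :: Lb); rewrite eb /= Ub allb edge' ?big_cons ?c2; try lia.
  rewrite (inseg _ _ _ Hb); try lia.
  by split=> //; lia.
exists [:: t.-1; t.+1]; rewrite /= !inE ?big_cons ?big_nil edge' ?edge ?c2; try lia.
by split; lia.
Qed.

End OnPath.

(** Meant for the exceptional diagrams: with concrete weights [c] and neighbour indices [nb], the
    inequalities become a closed computation, and only the distinctness of the vertices and the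
    edges remain to be checked. *)
Lemma no_explicit_family (S : seq I) (c : seq nat) (nb : seq (seq nat)) :
  uniq S -> all (all (gtn (size S))) nb -> all uniq nb ->
  has (ltn 0) (take (size S) c) ->
  all (fun i => 2 * nth 0 c i <= \sum_(j <- nth [::] nb i) nth 0 c j) (iota 0 (size S)) ->
  (forall z0, forall i, i < size S -> forall j, j \in nth [::] nb i ->
     0 < adj (nth z0 S i) (nth z0 S j)) -> False.
Proof.
case: S => [|z0 S']; first by rewrite /= take0.
move: (z0 :: S') => S US nbN nbU c0 H Hadj.
apply: noy; apply: (@neighbor_family (size S) (nth z0 S) (nth 0 c)).
- by move=> i j iS jS /eqP; rewrite nth_uniq // => /eqP.
- case/(has_nthP 0): c0 => i; rewrite size_take => iS; rewrite nth_take.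
    by exists i => //; move: iS; case: ifP; lia.
  by move: iS; case: ifP; lia.
move=> i iS _; exists (nth [::] nb i); split.
- have [le|lt] := leqP (size nb) i; first by rewrite nth_default.
  by apply: (all_nthP [::] nbU).
- apply/allP => j jl; rewrite Hadj // andbT.
  have [le|lt] := leqP (size nb) i; first by rewrite nth_default in jl.
  by have /allP/(_ j jl) := all_nthP [::] nbN i lt.
- by apply: (allP H); rewrite mem_iota.
Qed.

(** * Neighbours of a longest path *)

Section Longest.
Variables (m : nat) (x : nat -> I).
Hypothesis px : ispath m x.
Let S0 := mkseq x m.+1.

Lemma mkseq_path_uniq : uniq S0.
Proof.
rewrite /S0 /mkseq map_inj_in_uniq ?iota_uniq // => i j.
by rewrite !mem_iota !add0n => im jm; apply: px.1.
Qed.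

Lemma nth_path_cat l z0 i : i <= m -> nth z0 (S0 ++ l) i = x i.
Proof. by move=> im; rewrite nth_cat size_mkseq ltnS im nth_mkseq. Qed.

Lemma nth_path_ext l z0 k : nth z0 (S0 ++ l) (m.+1 + k) = nth z0 l k.
Proof. by rewrite nth_cat size_mkseq ltnNge leq_addr addKn. Qed.

Lemma nth_path_inj l z0 : uniq (S0 ++ l) ->
  {in gtn (m.+1 + size l) &, injective (nth z0 (S0 ++ l))}.
Proof.
move=> U i j; rewrite !inE => im jm /eqP.
by rewrite nth_uniq // ?size_cat ?size_mkseq // => /eqP.
Qed.

Lemma nth_path_edge l z0 i : i < m ->
  0 < adj (nth z0 (S0 ++ l) i) (nth z0 (S0 ++ l) i.+1).
Proof. by move=> im; rewrite !nth_path_cat ?px.2 //; lia. Qed.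

Lemma mem_path i : i <= m -> x i \in S0.
Proof. by move=> im; apply/mapP; exists i; rewrite // mem_iota. Qed.

Lemma memP_path z : z \in S0 -> exists2 i, i <= m & x i = z.
Proof. by case/mapP => i; rewrite mem_iota /= => im ->; exists i. Qed.

Lemma path_no_chord i j : i.+1 < j -> j <= m -> adj (x i) (x j) = 0.
Proof.
have := @no_chord m m.+1 x (leqnn _) px.1 px.2; exact.
Qed.

(** A loop analogue of affine D: weight 2 at [x i], where the loop accounts for 2, and weight 1 at
    its two neighbours on the path. *)
Lemma path_no_loop_inside i : 0 < i < m -> adj (x i) (x i) = 0.
Proof.
move=> im; apply/eqP; rewrite -leqn0 leqNgt; apply/negP => a.
apply: (@no_affine_D m m.+1 x (leqnn _) px.1 px.2 i i [:: i.-1; i.+1]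
  [:: i] [:: i.-1; i.+1]).
- by lia.
- move=> f; rewrite !inE => /orP[]/eqP ->; split; try lia.
    exists i; rewrite ?leqnn //; have := px.2 i.-1.
    by rewrite prednK; [apply; lia | lia].
  by exists i; rewrite ?leqnn // adjC px.2; lia.
- by rewrite /= !inE; lia.
- by move=> t; rewrite inE => /eqP ->; rewrite eqxx a.
- move=> t; rewrite !inE => /orP[]/eqP ->; rewrite eqxx ?orbT /=.
    rewrite adjC; have := px.2 i.-1.
    by rewrite prednK; [apply; lia | lia].
  by rewrite px.2; lia.
- by rewrite big_seq1 leqnn.
by rewrite !big_cons big_nil !inE !eqxx orbT; do 2?case: ifP; lia.
Qed.

Hypothesis mx : forall m' x', ispath m' x' -> m' <= m.

Lemma no_extension u : u \notin S0 -> adj u (x 0) = 0 /\ adj u (x m) = 0.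
Proof.
move=> uS; have xu i : i <= m -> x i <> u.
  by move=> im e; rewrite -e mem_path in uS.
split; apply/eqP; rewrite -leqn0 leqNgt; apply/negP => a.
  by have := mx (ispath_cons px xu a); lia.
have px' := ispath_rev px.
have xu' i : i <= m -> x (m - i) <> u by move=> _; apply: xu; lia.
by have := mx (@ispath_cons _ _ u px' xu' _); rewrite subn0 => /(_ a); lia.
Qed.

Section Branch.
Variables (u : I) (p : nat).
Hypotheses (uS : u \notin S0) (pm : 0 < p < m) (aup : 0 < adj u (x p)).

Let Su := S0 ++ [:: u].
Let USu : uniq Su.
Proof. by rewrite /Su cats1 rcons_uniq uS mkseq_path_uniq. Qed.

Let edge i : i < m -> 0 < adj (x i) (x i.+1). Proof. exact: px.2. Qed.

Let inj_eq i j : i <= m -> j <= m -> (x i == x j) = (i == j).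
Proof. by move=> im jm; apply/eqP/eqP => [|->] //; apply: px.1. Qed.
Let u_notin i : i <= m -> (u == x i) = false.
Proof. by move=> im; apply/eqP => e; move: uS; rewrite e mem_path. Qed.
Let edge_le i j : i <= m -> j <= m -> (i == j.+1) || (j == i.+1) ->
  0 < adj (x i) (x j).
Proof.
move=> im jm /orP[]/eqP e; rewrite e ?edge //; last by rewrite -e.
by rewrite adjC edge // -e.
Qed.

Lemma branch_unique q : q <= m -> q != p -> adj u (x q) = 0.
Proof.
move=> qm qp.
have inj := @nth_path_inj [:: u] u USu.
have ed := @nth_path_edge [:: u] u.
have mN : m < m.+1 + 1 by lia.
have H := @no_ear m _ (nth u Su) mN inj ed (m.+1 + 0) _ _.
have uN : m < m.+1 + 0 < m.+1 + 1 by lia.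
case: (ltngtP q p) qp => // qp _.
  apply/eqP; rewrite -leqn0 leqNgt; apply/negP => a.
  have := H q p uN qp; rewrite nth_path_ext !nth_path_cat /=; lia.
by have := H p q uN qp qm; rewrite nth_path_ext !nth_path_cat /=; lia.
Qed.

(** Another loop analogue of affine D: weight 2 at [u] and [x p], a loop at [u], and weight 1 at the
    two path neighbours of [x p]. *)
Lemma branch_no_loop_u : adj u u = 0.
Proof.
apply/eqP; rewrite -leqn0 leqNgt; apply/negP => a.
have pe : p.-1.+1 = p by lia.
apply: (@no_explicit_family [:: u; x p; x p.-1; x p.+1] [:: 2; 2; 1; 1]
  [:: [:: 0; 1]; [:: 0; 2; 3]; [:: 1]; [:: 1]]) => //.
- move: USu; rewrite /Su cats1 rcons_uniq => _ /=.
  have inj i j : i <= m -> j <= m -> (x i == x j) = (i == j).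
    by move=> im jm; apply/eqP/eqP => [|->] //; apply: px.1.
  have nu i : i <= m -> (u == x i) = false.
    by move=> im; apply/eqP => e; move: uS; rewrite e mem_path.
  by rewrite !inE !nu ?inj; lia.
- by rewrite /= !big_cons !big_nil.
have e1 : 0 < adj (x p.-1) (x p) by have := edge (i := p.-1); rewrite pe; apply; lia.
have e2 : 0 < adj (x p) (x p.+1) by apply: edge; lia.
have e3 : 0 < adj (x p) (x p.-1) by rewrite adjC.
have e4 : 0 < adj (x p.+1) (x p) by rewrite adjC.
have e5 : 0 < adj (x p) u by rewrite adjC.
by move=> z0 [|[|[|[|?]]]] //= _ j; rewrite !inE;
  repeat (case/orP; [move/eqP-> | ]) => //; move/eqP->.
Qed.

(** Weight 2 on the segment from [x i] to [x p], the loop at one end and the leaves [u] and [x p.+1]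
    of weight 1 at the other. Loops beyond [p] are treated by reversing the path. *)
Lemma branch_no_loop_le i : i <= p -> adj (x i) (x i) = 0.
Proof.
move=> ip; apply/eqP; rewrite -leqn0 leqNgt; apply/negP => a.
have mN : m < m.+1 + 1 by lia.
have SE j : j <= m -> nth u Su j = x j by exact: nth_path_cat.
have Sm : nth u Su m.+1 = u by have := nth_path_ext [:: u] u 0; rewrite addn0.
apply: (@no_affine_D m _ (nth u Su) mN (@nth_path_inj [:: u] u USu)
  (@nth_path_edge [:: u] u) i p [:: p.+1; m.+1] [:: i] [:: p.+1; m.+1]).
- by lia.
- move=> f; rewrite !inE => /orP[]/eqP ->; split; try lia; exists p; try lia.
    by rewrite !SE ?edge_le; lia.
  by rewrite Sm SE //; lia.
- by rewrite /= !inE; lia.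
- by move=> t; rewrite inE => /eqP ->; rewrite eqxx SE ?a //; lia.
- move=> t; rewrite !inE => /orP[]/eqP ->; rewrite eqxx !(orTb, orbT, andTb).
    by rewrite !SE ?edge_le; lia.
  by rewrite Sm SE 1?adjC //; lia.
- by rewrite big_seq1 leqnn ip.
by rewrite !big_cons big_nil !inE !eqxx orbT; do 2?case: ifP; lia.
Qed.

(** Two branches give affine D: weight 2 between [x p] and [x q], leaves [x p.-1] and [u] at one
    end, [u'] and [x q.+1] at the other. The last leaf exists because maximality of the path forbids
    [q = m]. *)
Lemma branch_second u' q : u' \notin S0 -> u' != u -> q <= m -> p <= q ->
  adj u' (x q) = 0.
Proof.
move=> u'S u'u qm pq; apply/eqP; rewrite -leqn0 leqNgt; apply/negP => a.
have qm' : q < m.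
  rewrite ltn_neqAle qm andbT; apply/eqP => e.
  by move: a; rewrite e (no_extension u'S).2.
have U : uniq (S0 ++ [:: u; u']).
  rewrite cat_uniq; apply/and3P; split; first exact: mkseq_path_uniq.
    by apply/hasPn => z; rewrite !inE => /orP[]/eqP ->.
  by rewrite /= inE eq_sym u'u.
have mN : m < m.+1 + 2 by lia.
pose S2 := S0 ++ [:: u; u'].
have SE j : j <= m -> nth u S2 j = x j by exact: nth_path_cat.
have Sm : nth u S2 m.+1 = u by have := nth_path_ext [:: u; u'] u 0; rewrite addn0.
have Sm' : nth u S2 m.+2 = u' by have := nth_path_ext [:: u; u'] u 1; rewrite addn1.
apply: (@no_affine_D m _ (nth u S2) mN (@nth_path_inj [:: u; u'] u U)
  (@nth_path_edge [:: u; u'] u) p q [:: p.-1; m.+1; m.+2; q.+1]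
   [:: p.-1; m.+1] [:: m.+2; q.+1]).
- by lia.
- move=> f; rewrite !inE => /or4P[]/eqP ->; split; try lia.
  + by exists p; [lia | rewrite !SE ?edge_le; lia].
  + by exists p; [lia | rewrite Sm !SE; lia].
  + by exists q; [lia | rewrite Sm' !SE; lia].
  + by exists q; [lia | rewrite !SE ?edge_le; lia].
- by rewrite /= !inE; lia.
- move=> t; rewrite !inE => /orP[]/eqP ->; rewrite eqxx !(orTb, orbT, andTb).
    by rewrite !SE ?edge_le; lia.
  by rewrite Sm SE 1?adjC; lia.
- move=> t; rewrite !inE => /orP[]/eqP ->; rewrite eqxx !(orTb, orbT, andTb).
    by rewrite Sm' SE 1?adjC; lia.
  by rewrite !SE ?edge_le; lia.
- by rewrite !big_cons big_nil !inE !eqxx ?orbT; do 2?case: ifP; lia.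
by rewrite !big_cons big_nil !inE !eqxx ?orbT; do 2?case: ifP; lia.
Qed.

Lemma branch_leg u' : u' \notin S0 -> u' != u -> p <= m - p -> adj u' u = 0.
Proof.
move=> u'S u'u pp; apply/eqP; rewrite -leqn0 leqNgt; apply/negP => a.
have u'nu : (u == u') = false by rewrite eq_sym; apply/negbTE.
have u'_notin i : i <= m -> (u' == x i) = false.
  by move=> im; apply/eqP => e; rewrite e mem_path in u'S.
(* If [p = 1], replacing [x 0] by [u] gives a path of the same length, which [u'] prolongs. *)
have p2 : 1 < p.
  rewrite ltnNge; apply/negP => p1; have {p1} p1 : p = 1 by lia.
  have H : ispath m (fun i => if i is i'.+1 then x i'.+1 else u).
    split; last first.
      by move=> [|i] im /=; [move: aup; rewrite p1 | rewrite edge_le ?eqxx ?orbT //; lia].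
    move=> [|i] [|j] //; rewrite !inE !ltnS => im jm.
    - by move/eqP; rewrite u_notin.
    - by move/esym/eqP; rewrite u_notin.
    by move/eqP; rewrite inj_eq // => /eqP.
  have := mx (@ispath_cons _ _ u' H _ a); suff : forall i, i <= m ->
    (if i is i'.+1 then x i'.+1 else u) <> u' by move=> h /(_ h); lia.
  move=> [|i] im; first by apply/eqP; rewrite u'nu.
  by apply/eqP; rewrite eq_sym u'_notin.
(* affine E6 *)
apply: (@no_explicit_family [:: x p; x p.-1; x p.-2; x p.+1; x p.+2; u; u']
  [:: 3; 2; 1; 2; 1; 2; 1]
  [:: [:: 1; 3; 5]; [:: 0; 2]; [:: 1]; [:: 0; 4]; [:: 3]; [:: 0; 6]; [:: 5]]) => //.
- by rewrite /= !inE ?(eq_sym _ u) ?(eq_sym _ u') !u_notin ?u'_notin ?inj_eq ?u'nu; lia.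
- by rewrite /= !big_cons !big_nil.
have e5 : 0 < adj (x p) u by rewrite adjC.
have e6 : 0 < adj u u' by rewrite adjC.
by move=> z0 [|[|[|[|[|[|[|?]]]]]]] //= _ j; rewrite !inE;
  repeat (case/orP; [move/eqP-> | ]) => //=; try (move/eqP->) => //=;
  apply: edge_le; lia.
Qed.

(** The arms at [x p] have 1, [p] and [m - p] edges. Arms 1, 3, 3 form affine E_7 and arms 1, 2, 5
    affine E_8; the weight lists are their null vectors. What survives is the shape of D_n, E_6, E_7
    or E_8. *)
Lemma branch_legs : p <= m - p -> p = 1 \/ p = 2 /\ m - p <= 4.
Proof.
move=> pp; have [p1|[p2|p3]] : p = 1 \/ p = 2 \/ 3 <= p by lia.
- by left.
- right; split=> //; rewrite leqNgt; apply/negP => m4.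
  (* affine E8 *)
  apply: (@no_explicit_family
    [:: x 2; x 1; x 0; u; x 3; x 4; x 5; x 6; x 7]
    [:: 6; 4; 2; 3; 5; 4; 3; 2; 1]
    [:: [:: 1; 3; 4]; [:: 0; 2]; [:: 1]; [:: 0]; [:: 0; 5]; [:: 4; 6];
        [:: 5; 7]; [:: 6; 8]; [:: 7]]) => //.
  + by rewrite /= !inE ?(eq_sym _ u) ?u_notin ?inj_eq; lia.
  + by rewrite /= !big_cons !big_nil.
  have e4 : 0 < adj u (x 2) by move: aup; rewrite p2.
  have e5 : 0 < adj (x 2) u by rewrite adjC.
  by move=> z0 [|[|[|[|[|[|[|[|[|?]]]]]]]]] //= _ j; rewrite !inE;
    repeat (case/orP; [move/eqP-> | ]) => //=; try (move/eqP->) => //=;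
    apply: edge_le; lia.
(* affine E7 *)
case: (@no_explicit_family
  [:: x p; u; x p.-1; x p.-2; x p.-2.-1; x p.+1; x p.+2; x p.+3]
  [:: 4; 2; 3; 2; 1; 3; 2; 1]
  [:: [:: 1; 2; 5]; [:: 0]; [:: 0; 3]; [:: 2; 4]; [:: 3]; [:: 0; 6];
      [:: 5; 7]; [:: 6]]) => //.
+ by rewrite /= !inE ?(eq_sym _ u) ?u_notin ?inj_eq; lia.
+ by rewrite /= !big_cons !big_nil.
have e5 : 0 < adj (x p) u by rewrite adjC.
by move=> z0 [|[|[|[|[|[|[|[|?]]]]]]]] //= _ j; rewrite !inE;
  repeat (case/orP; [move/eqP-> | ]) => //=; try (move/eqP->) => //=;
  apply: edge_le; lia.
Qed.

End Branch.
End Longest.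

(** * Recognition of the graphs of ADET type *)

Lemma tadpole_iso m x : ispath m x -> (forall z, exists2 i, i < m.+1 & x i = z) ->
  0 < adj (x 0) (x 0) -> graph_iso adj m.+1 tadpole_adj.
Proof.
move=> px sur a0; apply: (graph_iso_enum px.1 sur) => i j im jm.
rewrite /tadpole_adj.
have ch i' j' : i'.+1 < j' -> j' <= m -> adj (x i') (x j') = 0 by exact: path_no_chord.
have ed i' : i' < m -> adj (x i') (x i'.+1) = 1 by move=> ?; apply/adj1/px.2.
have [e|[e|[e|[e|e]]]] : i = j \/ j = i.+1 \/ i = j.+1 \/ i.+1 < j \/ j.+1 < i by lia.
- rewrite -{}e in jm *; have [->|i0] := posnP i; first by rewrite adj1.
  by rewrite (one_loop (s := x) (leqnn _) px.1 px.2 i0 _ a0) //; lia.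
- by rewrite e ed; lia.
- by rewrite e adjC ed; lia.
- by rewrite ch; lia.
- by rewrite adjC ch; lia.
Qed.

Lemma branch_iso m x (px : ispath m x) (mx : forall m' x', ispath m' x' -> m' <= m)
    u p : u \notin mkseq x m.+1 -> 0 < p < m -> 0 < adj u (x p) ->
    (forall z, z != u -> z \in mkseq x m.+1) ->
  graph_iso adj m.+2 (branch_adj m.+1 p).
Proof.
move=> uS pm aup all_in.
have pxr := ispath_rev px.
have Er := mem_mkseq_rev m x.
have noloop i : i <= m -> adj (x i) (x i) = 0.
  move=> im; have [ip|pi] := leqP i p; first exact: (branch_no_loop_le px uS pm aup ip).
  have := @branch_no_loop_le _ _ pxr u (m - p) _ _ _ (m - i).
  by rewrite Er !subKn; try lia; apply=> //; lia.
apply: (graph_iso_enum (s := nth u (mkseq x m.+1 ++ [:: u]))).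
- have U : uniq (mkseq x m.+1 ++ [:: u]) by rewrite cats1 rcons_uniq uS mkseq_path_uniq.
  by have := @nth_path_inj m x [:: u] u U; rewrite addn1.
- move=> z; have [->|zu] := eqVneq z u.
    by exists m.+1 => //; have := @nth_path_ext m x [:: u] u 0; rewrite addn0.
  have [i im <-] := memP_path (all_in z zu).
  by exists i; [lia | exact: nth_path_cat].
have Su : nth u (mkseq x m.+1 ++ [:: u]) m.+1 = u.
  by have := @nth_path_ext m x [:: u] u 0; rewrite addn0.
have Sx i : i <= m -> nth u (mkseq x m.+1 ++ [:: u]) i = x i by exact: nth_path_cat.
have ed i : i < m -> adj (x i) (x i.+1) = 1 by move=> ?; apply/adj1/px.2.
have ch i j : i.+1 < j -> j <= m -> adj (x i) (x j) = 0 by exact: path_no_chord.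
have au i : i <= m -> adj u (x i) = (i == p).
  move=> im; have [->|ip] := eqVneq i p; first exact: adj1.
  exact: (branch_unique px uS pm aup im ip).
have uu : adj u u = 0 by exact: (branch_no_loop_u px uS pm aup).
move=> i j im jm; rewrite /branch_adj.
have [ei|ni] := eqVneq i m.+1; have [ej|nj] := eqVneq j m.+1.
- by rewrite ei ej Su uu; lia.
- by rewrite ei Su Sx ?au; lia.
- by rewrite ej Su Sx 1?adjC ?au; lia.
rewrite !Sx; try lia.
have [e|[e|[e|[e|e]]]] : i = j \/ j = i.+1 \/ i = j.+1 \/ i.+1 < j \/ j.+1 < i by lia.
- by rewrite e noloop; lia.
- by rewrite e ed; lia.
- by rewrite e adjC ed; lia.
- by rewrite ch; lia.
- by rewrite adjC ch; lia.
Qed.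

Lemma branch_ADET m x (px : ispath m x) (mx : forall m' x', ispath m' x' -> m' <= m)
    u p : (forall i j, connect (fun x y => 0 < adj x y) i j) ->
    u \notin mkseq x m.+1 -> 0 < p < m -> 0 < adj u (x p) -> p <= m - p ->
  ADET_type adj.
Proof.
move=> conn uS pm aup pp.
have pxr := ispath_rev px.
have Er := mem_mkseq_rev m x.
have uSr : u \notin mkseq (fun i => x (m - i)) m.+1 by rewrite Er.
have pmr : 0 < m - p < m by lia.
have aupr : 0 < adj u (x (m - (m - p))) by rewrite subKn //; lia.
(* Otherwise, by connectedness, an edge leads from a vertex outside to [u] or to the path. The first
   is excluded by [branch_leg], the second by [branch_second], applied to the reversed path if
   [q < p]. *)
have all_in z : z != u -> z \in mkseq x m.+1.
  move=> zu; apply: contrapT => /negP zS.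
  have [||w [y]] := @escape (fun w => (w == u) || (w \in mkseq x m.+1)) u z conn.
  - by rewrite eqxx.
  - by rewrite negb_or zu.
  case; rewrite negb_or => /andP[wu wS] /orP[/eqP->|/memP_path[q qm <-]].
    by rewrite (branch_leg px mx uS pm aup wS wu pp).
  have [pq|qp] := leqP p q; first by rewrite (branch_second px mx uS pm aup wS wu qm pq).
  have wSr : w \notin mkseq (fun i => x (m - i)) m.+1 by rewrite Er.
  have := @branch_second _ _ pxr mx u _ uSr pmr aupr w (m - q) wSr wu.
  by rewrite subKn //; lia.
have iso := branch_iso px mx uS pm aup all_in.
have all_in_r z : z != u -> z \in mkseq (fun i => x (m - i)) m.+1 by rewrite Er; exact: all_in.
have isor := branch_iso pxr mx uSr pmr aupr all_in_r.
(* With [n = m.+2], the standard D graph has its branch at [n - 3 = m - 1], so [p = 1] calls for the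
   reversed path; the E graphs branch at 2, which is [p] itself. *)
exists m.+2; have [p1|[p2 m4]] := branch_legs px uS pm aup pp.
  apply: Or42; split; first lia.
  by rewrite (_ : m.+2 - 3 = m - p) //; lia.
apply: Or43; move: iso; rewrite p2 => iso; split=> //.
have [e|[e|e]] : m = 4 \/ m = 5 \/ m = 6 by lia.
- by rewrite e; apply: Or31.
- by rewrite e; apply: Or32.
- by rewrite e; apply: Or33.
Qed.

(** Either a longest path exhausts the graph, which is then A or, with a loop at one end, T; or an
    edge leaves the path, necessarily from an inner vertex, and the graph is D or E. *)
Lemma no_subharmonic_ADET : graph_connected adj -> ADET_type adj.
Proof.
move=> [I0 conn]; have [m [x [px mx]]] := longest_path I0.
have pxr := ispath_rev px.
have [allin|] := boolP [forall z, z \in mkseq x m.+1].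
  have sur z : exists2 i, i < m.+1 & x i = z.
    by have [i im <-] := memP_path (forallP allin z); exists i.
  exists m.+1.
  have [l0|l0] := posnP (adj (x 0) (x 0)); last first.
    by apply: Or44; split=> //; exact: (tadpole_iso px sur l0).
  have [lm|lm] := posnP (adj (x m) (x m)); last first.
    apply: Or44; split=> //; apply: tadpole_iso pxr _ _; rewrite ?subn0 // => z.
    by have [i im <-] := sur z; exists (m - i); [lia | rewrite subKn].
  apply: Or41; split=> //; apply: (graph_iso_enum px.1 sur) => i j im jm.
  rewrite /path_adj.
  have ch i' j' : i'.+1 < j' -> j' <= m -> adj (x i') (x j') = 0 by exact: path_no_chord.
  have ed i' : i' < m -> adj (x i') (x i'.+1) = 1 by move=> ?; apply/adj1/px.2.
  have [e|[e|[e|[e|e]]]] : i = j \/ j = i.+1 \/ i = j.+1 \/ i.+1 < j \/ j.+1 < i by lia.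
  - rewrite -{}e in jm *; have [->|i0] := posnP i; first by rewrite l0; lia.
    have [->|nm] := eqVneq i m; first by rewrite lm; lia.
    by rewrite (path_no_loop_inside px); lia.
  - by rewrite e ed; lia.
  - by rewrite e adjC ed; lia.
  - by rewrite ch; lia.
  - by rewrite adjC ch; lia.
case/forallPn => z zS.
have [|u [w [/= uS /memP_path[p pm <-] a]]] :=
    @escape (mem (mkseq x m.+1)) (x 0) z conn _ zS.
  exact: mem_path.
have [u0 um] := no_extension px mx uS.
have p0 : 0 < p by case: (posnP p) => // e; move: a; rewrite e u0.
have pm' : p < m by rewrite ltn_neqAle pm andbT; apply/eqP => e; move: a; rewrite e um.
have pp : 0 < p < m by lia.
have [le|lt] := leqP p (m - p); first exact: (branch_ADET px mx conn uS pp a le).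
have Er := mem_mkseq_rev m x.
apply: (@branch_ADET m _ pxr mx u (m - p) conn); rewrite ?Er ?subKn //; lia.
Qed.

End Graphs.

Theorem not_ADET_subharmonic (I : finType) (adj : I -> I -> nat) :
  (forall i j, adj i j = adj j i) -> graph_connected adj -> ~ ADET_type adj ->
  exists2 y, subharmonic adj y & forall i, 0 < y i.
Proof.
move=> adjC conn nA; apply: connected_subharmonic => //; first exact: conn.2.
by apply: contrapT => noy; apply: nA; exact: no_subharmonic_ADET.
Qed.

Import GRing.Theory.
Local Open Scope classical_set_scope.
Local Open Scope ring_scope.

(** * Dimensions of subspaces *)

Section Dimension.
Variables (k : fieldType) (M : lmodType k).
Implicit Types S : set M.

Lemma has_dim_finType S (J : finType) (b : J -> M) :
  (forall c : J -> k, \sum_i c i *: b i = 0 -> forall i, c i = 0) ->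
  (forall x, S x <-> exists c : J -> k, x = \sum_i c i *: b i) ->
  has_dim S #|J|.
Proof.
move=> free span; exists (fun i => b (enum_val i)); split.
  move=> c c0 i; have := free (fun j => c (enum_rank j)).
  rewrite (reindex (fun i : 'I_#|J| => enum_val i)) /=; last exact/onW_bij/enum_val_bij.
  under eq_bigr do rewrite enum_valK.
  by move=> /(_ c0 (enum_val i)); rewrite enum_valK.
move=> x; split=> [/span[c ->]|[c ->]].
  exists (fun i => c (enum_val i)).
  by rewrite (reindex (fun i : 'I_#|J| => enum_val i)) //=; exact/onW_bij/enum_val_bij.
apply/span; exists (fun j => c (enum_rank j)).
rewrite [RHS](reindex (fun i : 'I_#|J| => enum_val i)) /=; last exact/onW_bij/enum_val_bij.
by apply: eq_bigr => i _; rewrite enum_valK.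
Qed.

Lemma sum_delta d (b : 'I_d -> M) i : \sum_j (j == i)%:R *: b j = b i.
Proof.
rewrite (bigD1 i) //= eqxx scale1r big1 ?addr0 // => j /negbTE ->.
by rewrite scale0r.
Qed.

Lemma has_dim_basis_mem S d (b : 'I_d -> M) :
  (forall x, S x <-> exists c : 'I_d -> k, x = \sum_i c i *: b i) ->
  forall i, S (b i).
Proof. by move=> bs i; apply/bs; exists (fun j => (j == i)%:R); rewrite sum_delta. Qed.

(** Expanding each basis in the other yields a [d] by [e] and an [e] by [d] matrix whose product is
    the identity. *)
Lemma has_dim_le S d e : has_dim S d -> has_dim S e -> (d <= e)%N.
Proof.
move=> [b [bf bs]] [b' [b'f b's]].
have Sb := has_dim_basis_mem bs.
have Sb' := has_dim_basis_mem b's.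
have [C HC] : {C : 'I_d -> 'I_e -> k & forall i, b i = \sum_j C i j *: b' j}.
  by apply: (@choice _ _ (fun i c => b i = \sum_j c j *: b' j)) => i; apply/b's.
have [D HD] : {D : 'I_e -> 'I_d -> k & forall i, b' i = \sum_j D i j *: b j}.
  by apply: (@choice _ _ (fun i c => b' i = \sum_j c j *: b j)) => i; apply/bs.
apply: (@mulmx1_min _ _ _ (\matrix_(i, j) C i j) (\matrix_(i, j) D i j)).
apply/matrixP => i j; rewrite !mxE; under eq_bigr do rewrite !mxE.
apply/eqP; rewrite -subr_eq0; apply/eqP.
apply: (bf (fun j => \sum_l C i l * D l j - (i == j)%:R)).
under eq_bigr do rewrite scalerBl; rewrite sumrB.
rewrite [X in _ - X](bigD1 i) //= eqxx scale1r [X in _ - (_ + X)]big1 ?addr0; last first.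
  by move=> l; rewrite eq_sym => /negbTE ->; rewrite scale0r.
apply/eqP; rewrite subr_eq0 [X in _ == X]HC; apply/eqP.
under eq_bigr do rewrite scaler_suml; rewrite exchange_big /=.
apply: eq_bigr => l _; rewrite HD scaler_sumr.
by apply: eq_bigr => m _; rewrite scalerA.
Qed.

Lemma has_dim_unique S d e : has_dim S d -> has_dim S e -> d = e.
Proof. by move=> Sd Se; apply/eqP; rewrite eqn_leq !(@has_dim_le S). Qed.

Lemma has_dim_neq0 S d : has_dim S d -> (0 < d)%N -> exists2 x, S x & x != 0.
Proof.
case: d => // d [b [bf bs]] _; exists (b ord0); first exact: (has_dim_basis_mem bs).
apply/eqP => b0; have := bf (fun j => (j == ord0)%:R) _ ord0.
rewrite eqxx => H; suff /eqP : (1 : k) = 0 by rewrite oner_eq0.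
by apply: H; rewrite sum_delta.
Qed.

(** A nontrivial relation expresses one vector through the others, which can then be dropped without
    changing the span. *)
Lemma span_has_dim S n (b : 'I_n -> M) :
  (forall x, S x <-> exists c : 'I_n -> k, x = \sum_i c i *: b i) ->
  exists d, has_dim S d.
Proof.
elim: n => [|n IH] in b *; first by exists 0%N, b; split=> // c _ [].
move=> span.
have [free|] := pselect (forall c : 'I_n.+1 -> k, \sum_i c i *: b i = 0 -> forall i, c i = 0).
  by exists n.+1, b.
move=> /existsNP[c /not_implyP[c0 /existsNP[i0 ci0]]].
apply: (IH (fun i => b (lift i0 i))) => x.
have bi0 : b i0 = \sum_i (- (c i0)^-1 * c (lift i0 i)) *: b (lift i0 i).
  move: c0; rewrite (bigD1_ord i0) //= => /eqP; rewrite addr_eq0 => /eqP e.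
  have ci0n : c i0 != 0 by apply/eqP.
  rewrite -[LHS]scale1r -(mulVf ci0n) -scalerA e scalerN -scaleNr scaler_sumr.
  by apply: eq_bigr => i _; rewrite scalerA.
split=> [/span[a ->]|[a ->]].
  exists (fun i => a i0 * (- (c i0)^-1 * c (lift i0 i)) + a (lift i0 i)).
  rewrite (bigD1_ord i0) //= bi0 scaler_sumr -big_split.
  by apply: eq_bigr => i _ /=; rewrite scalerA scalerDl.
apply/span; exists (fun i => if unlift i0 i is Some j then a j else 0).
rewrite (bigD1_ord i0) //= unlift_none scale0r add0r.
by apply: eq_bigr => i _; rewrite liftK.
Qed.

(** Coordinates are chosen for elements of [S] only, so [f] is linear on [S] and unconstrained
    elsewhere; it is a coordinate that does not vanish at [x0], normalised there. *)
Lemma dual_functional S d x0 : has_dim S d -> S x0 -> x0 != 0 ->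
  exists2 f : M -> k, f x0 = 1 & forall a x y, S x -> S y ->
    f (a *: x + y) = a * f x + f y.
Proof.
move=> [b [bf bs]] Sx0 x0n.
have [C HC] : {C : M -> 'I_d -> k & forall x, S x -> x = \sum_j C x j *: b j}.
  apply: (@choice _ _ (fun x c => S x -> x = \sum_j c j *: b j)) => x.
  by have [/bs[c e]|nS] := pselect (S x); [exists c | exists (fun=> 0)].
have [m Cm] : exists m, C x0 m <> 0.
  apply: contrapT => /forallNP H; case/eqP: x0n; rewrite (HC _ Sx0) big1 // => j _.
  have -> : C x0 j = 0 by apply: contrapT; exact: H.
  by rewrite scale0r.
exists (fun x => C x m / C x0 m); first by rewrite divff //; apply/eqP.
move=> a x y Sx Sy; rewrite mulrA -mulrDl; congr (_ / _).
have Sxy : S (a *: x + y).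
  apply/bs; exists (fun j => a * C x j + C y j).
  rewrite {1}(HC _ Sx) {1}(HC _ Sy) scaler_sumr -big_split; apply: eq_bigr => j _.
  by rewrite scalerDl scalerA.
apply/eqP; rewrite -subr_eq0; apply/eqP.
apply: (bf (fun j => C (a *: x + y) j - (a * C x j + C y j))).
under eq_bigr do rewrite scalerBl; rewrite sumrB -HC //.
under eq_bigr do rewrite scalerDl -scalerA; rewrite big_split /=.
by rewrite -scaler_sumr -!HC // subrr.
Qed.

End Dimension.

Lemma has_dim_image (k : fieldType) (M N : lmodType k) (f : {linear M -> N})
    (S : set M) (S' : set N) d :
  has_dim S d -> (forall y, S' y <-> exists2 x, S x & f x = y) ->
  exists e, has_dim S' e.
Proof.
move=> [b [_ bs]] im; apply: (@span_has_dim _ _ _ d (f \o b)) => y.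
split=> [/im[x /bs[c ->] <-]|[c ->]].
  by exists c; rewrite linear_sum; apply: eq_bigr => i _; rewrite linearZ.
apply/im; exists (\sum_i c i *: b i); first by apply/bs; exists c.
by rewrite linear_sum; apply: eq_bigr => i _; rewrite linearZ.
Qed.

(** Dimension is additive along a short exact sequence of subspaces. [S2] is not assumed
    finite-dimensional: its basis is made of the images of a basis of [S1] and of lifts of a basis
    of [S3]. *)
Lemma has_dim_exact (k : fieldType) (M1 M2 M3 : lmodType k)
    (f : {linear M1 -> M2}) (g : {linear M2 -> M3})
    (S1 : set M1) (S2 : set M2) (S3 : set M3) d1 d3 :
  has_dim S1 d1 -> has_dim S3 d3 ->
  (forall x, S1 x -> S2 (f x)) ->
  (forall a x y, S2 x -> S2 y -> S2 (a *: x + y)) ->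
  (forall x, S1 x -> f x = 0 -> x = 0) ->
  (forall y, S2 y -> g y = 0 <-> exists2 x, S1 x & f x = y) ->
  (forall z, S3 z <-> exists2 y, S2 y & g y = z) ->
  has_dim S2 (d1 + d3).
Proof.
move=> [b1 [f1 s1]] [b3 [f3 s3]] S12 lin2 inj mid sur.
have Sb3 := has_dim_basis_mem s3.
have Sb1 := has_dim_basis_mem s1.
have [l Hl] : {l : 'I_d3 -> M2 & forall i, S2 (l i) /\ g (l i) = b3 i}.
  by apply: (@choice _ _ (fun i y => S2 y /\ g y = b3 i)) => i;
    have /sur[y] := Sb3 i; exists y.
have S10 : S1 0 by apply/s1; exists (fun=> 0); rewrite big1 // => i _; rewrite scale0r.
have S20 : S2 0 by rewrite -(linear0 f); exact: S12.
have S2D x y : S2 x -> S2 y -> S2 (x + y) by move=> ? ?; rewrite -[x]scale1r; exact: lin2.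
have S2Z a x : S2 x -> S2 (a *: x) by move=> ?; rewrite -[_ *: _]addr0; exact: lin2.
have S2sum n (c : 'I_n -> k) (h : 'I_n -> M2) :
    (forall i, S2 (h i)) -> S2 (\sum_i c i *: h i).
  by move=> Hh; apply: big_ind => // i _; exact: S2Z.
have gf x : S1 x -> g (f x) = 0.
  by move=> Sx; apply/(mid _ (S12 _ Sx)); exists x.
have glin (c : 'I_d3 -> k) : g (\sum_i c i *: l i) = \sum_i c i *: b3 i.
  by rewrite linear_sum; apply: eq_bigr => i _; rewrite linearZ /= (Hl i).2.
have flin (c : 'I_d1 -> k) : f (\sum_i c i *: b1 i) = \sum_i c i *: f (b1 i).
  by rewrite linear_sum; apply: eq_bigr => i _; rewrite linearZ.
rewrite -[d1]card_ord -[d3]card_ord -card_sum.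
apply: (has_dim_finType
  (b := fun i => match i with inl i => f (b1 i) | inr i => l i end)).
  move=> c; rewrite big_sumType /= => e.
  have e3 : \sum_i c (inr i) *: b3 i = 0.
    move/(congr1 g): e; rewrite linearD linear0 glin -flin gf ?add0r //.
    by apply/s1; exists (fun i => c (inl i)).
  have c3 := f3 (fun i => c (inr i)) e3.
  move: e; rewrite [X in _ + X]big1 ?addr0; last by move=> i _; rewrite c3 scale0r.
  rewrite -flin => /inj e.
  have c1 := f1 (fun i => c (inl i)) (e _).
  by case=> i; [apply: c1 => //; apply/s1; exists (fun i => c (inl i)) | apply: c3].
move=> y; split.
  move=> Sy; have /s3[c3 e3] : S3 (g y) by apply/sur; exists y.
  have Sl : S2 (\sum_i c3 i *: l i) by apply: S2sum => i; exact: (Hl i).1.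
  have Sd : S2 (y - \sum_i c3 i *: l i) by rewrite -scaleN1r; apply: S2D => //; exact: S2Z.
  have /(mid _ Sd)[x /s1[c1 ->] ex] : g (y - \sum_i c3 i *: l i) = 0.
    by rewrite linearB /= glin e3 subrr.
  exists (fun i => match i with inl i => c1 i | inr i => c3 i end).
  by rewrite big_sumType /= -flin ex subrK.
move=> [c ->]; rewrite big_sumType /=; apply: S2D; apply: S2sum => i.
  exact: S12.
exact: (Hl i).1.
Qed.

Lemma has_dim_ffun (k : fieldType) (M : lmodType k) (J : finType)
    (S : J -> set M) (d : J -> nat) : (forall a, has_dim (S a) (d a)) ->
  has_dim [set f : {ffun J -> M} | forall a, S a (f a)] (\sum_a d a).
Proof.
move=> H.
pose b a := sval (cid (H a)).
have bf a : forall c : 'I_(d a) -> k, \sum_i c i *: b a i = 0 -> forall i, c i = 0.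
  exact: (svalP (cid (H a))).1.
have bs a : forall x, S a x <-> exists c : 'I_(d a) -> k, x = \sum_i c i *: b a i.
  exact: (svalP (cid (H a))).2.
have -> : (\sum_a d a)%N = #|{: {a : J & 'I_(d a)}}|.
  by rewrite card_tagged sumnE big_map big_enum; apply: eq_bigr => a _; rewrite card_ord.
pose B (u : {a : J & 'I_(d a)}) : {ffun J -> M} :=
  [ffun a => if a == tag u then b (tag u) (tagged u) else 0].
have BE (c : {a : J & 'I_(d a)} -> k) a :
    (\sum_u c u *: B u) a = \sum_(i < d a) c (Tagged (fun a => 'I_(d a)) i) *: b a i.
  rewrite sum_ffunE (eq_bigr (fun u : {a : J & 'I_(d a)} =>
    (if a == tag u then c u *: b (tag u) (tagged u) else 0))); last first.
    by move=> u _; rewrite !ffunE; case: ifP; rewrite ?scaler0.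
  rewrite -big_mkcond /=.
  have := sig_big_dep (op := +%R) (idx := 0) (pred1 a) (fun _ => xpredT)
    (fun j (i : 'I_(d j)) => c (Tagged (fun a => 'I_(d a)) i) *: b j i).
  rewrite big_pred1_eq => ->; apply: eq_big => [[j i]|[j i] _] //=.
  by rewrite andbT eq_sym.
apply: (has_dim_finType (b := B)).
  move=> c c0 [a i]; apply: (bf a (fun i => c (Tagged (fun a => 'I_(d a)) i))).
  by have := BE c a; rewrite c0 ffunE => <-.
move=> f; split=> [Sf|[c ->] a]; last first.
  by rewrite BE; apply/bs; exists (fun i => c (Tagged (fun a => 'I_(d a)) i)).
have [c Hc] : exists c : forall a, 'I_(d a) -> k, forall a, f a = \sum_i c a i *: b a i.
  have Hf a : exists c : 'I_(d a) -> k, f a = \sum_i c i *: b a i by apply/bs; exact: Sf.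
  by exists (fun a => sval (cid (Hf a))) => a; exact: (svalP (cid (Hf a))).
by exists (fun u => c (tag u) (tagged u)); apply/ffunP => a; rewrite BE.
Qed.

(** * The socle and the dimensions of the graded pieces *)

(* The algebra is a vector space [M] with an explicit product, as MathComp has no
   structure for algebras that may be zero. *)
Section Socle.
Variables (k : fieldType) (M : lmodType k) (mul : M -> M -> M).
Variables (I A : finType) (src tgt : A -> I) (e : I -> M) (v w : A -> M).
Variable pr : nat -> {linear M -> M}.
Local Infix "**" := mul (at level 40, left associativity).

Hypothesis mulA : forall x y z, x ** (y ** z) = x ** y ** z.
Hypothesis mulPl : forall a x y z, (a *: x + y) ** z = a *: (x ** z) + y ** z.
Hypothesis mulPr : forall a x y z, z ** (a *: x + y) = a *: (z ** x) + z ** y.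
Hypothesis sum_el : forall x, \sum_i e i ** x = x.
Hypothesis sum_er : forall x, \sum_i x ** e i = x.
Hypothesis eM : forall i j, e i ** e j = if i == j then e i else 0.
Hypothesis e_neq0 : forall i, e i != 0.
Hypothesis prK : forall m n x, pr m (pr n x) = if m == n then pr n x else 0.
Hypothesis sum_pr : forall x, exists N, x = \sum_(n < N) pr n x.
Hypothesis prM : forall m n x y, pr m x = x -> pr n y = y -> pr (m + n) (x ** y) = x ** y.
Hypothesis pr_e : forall i, pr 0 (e i) = e i.
Hypothesis pr0_span : forall x, pr 0 x = x -> exists c : I -> k, x = \sum_i c i *: e i.
Hypothesis pr_v : forall a, pr 1 (v a) = v a.
Hypothesis pr_w : forall a, pr 1 (w a) = w a.
Hypothesis ev : forall i a, e i ** v a = if i == src a then v a else 0.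
Hypothesis ve : forall a, v a ** e (tgt a) = v a.
Hypothesis ew : forall a, e (tgt a) ** w a = w a.
Hypothesis we : forall a j, w a ** e j = if src a == j then w a else 0.
Hypothesis w_span : exists C : A -> A -> k, forall a, w a = \sum_b C a b *: v b.
Hypothesis gen_w : forall n z, pr n.+1 z = z -> exists2 y : A -> M,
  (forall a, pr n (y a) = y a) & z = \sum_a y a ** w a.
Hypothesis syzygy_w : forall y : A -> M, (forall a, y a ** e (tgt a) = y a) ->
  \sum_a y a ** w a = 0 -> exists x, forall a, y a = x ** v a.
Hypothesis rel_vw : forall x, \sum_a x ** v a ** w a = 0.
Variable y : I -> nat.
Hypothesis y_gt0 : forall i, (0 < y i)%N.
Hypothesis y_sub : forall l, (2 * y l <= \sum_(a | tgt a == l) y (src a))%N.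

Let mul0l z : 0 ** z = 0.
Proof. by have := mulPl (-1) 0 0 z; rewrite scaler0 addr0 scaleN1r addNr. Qed.
Let mul0r z : z ** 0 = 0.
Proof. by have := mulPr (-1) 0 0 z; rewrite scaler0 addr0 scaleN1r addNr. Qed.
Let mulDl x x' z : (x + x') ** z = x ** z + x' ** z.
Proof. by have := mulPl 1 x x' z; rewrite !scale1r. Qed.
Let mulDr x x' z : z ** (x + x') = z ** x + z ** x'.
Proof. by have := mulPr 1 x x' z; rewrite !scale1r. Qed.
Let mulZl a x z : (a *: x) ** z = a *: (x ** z).
Proof. by have := mulPl a x 0 z; rewrite mul0l !addr0. Qed.
Let mulZr a x z : z ** (a *: x) = a *: (z ** x).
Proof. by have := mulPr a x 0 z; rewrite mul0r !addr0. Qed.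
Let mul_suml J (r : seq J) (F : J -> M) z :
  (\sum_(j <- r) F j) ** z = \sum_(j <- r) F j ** z.
Proof. exact: (big_morph (mul^~ z) (fun x x' => mulDl x x' z) (mul0l z)). Qed.
Let mul_sumr J (r : seq J) (F : J -> M) z :
  z ** (\sum_(j <- r) F j) = \sum_(j <- r) z ** F j.
Proof. exact: (big_morph (mul z) (fun x x' => mulDr x x' z) (mul0r z)). Qed.

Definition row_piece i n : set M := [set x | e i ** x = x /\ pr n x = x].
Definition piece n i j : set M := [set x | [/\ e i ** x = x, x ** e j = x & pr n x = x]].

Let rowP i n a x x' : row_piece i n x -> row_piece i n x' -> row_piece i n (a *: x + x').
Proof. by move=> [e1 p1] [e2 p2]; split; rewrite ?mulPr ?linearP ?e1 ?e2 ?p1 ?p2. Qed.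
Let row0 i n : row_piece i n 0. Proof. by split; rewrite ?mul0r ?linear0. Qed.
Let row_e i n x j : row_piece i n x -> row_piece i n (x ** e j).
Proof.
move=> [e1 p1]; split; first by rewrite mulA e1.
by have := prM p1 (pr_e j); rewrite addn0.
Qed.
Let row_v i n x a : row_piece i n x -> row_piece i n.+1 (x ** v a).
Proof.
move=> [e1 p1]; split; first by rewrite mulA e1.
by have := prM p1 (pr_v a); rewrite addn1.
Qed.
Let row_w i n x a : row_piece i n x -> row_piece i n.+1 (x ** w a).
Proof.
move=> [e1 p1]; split; first by rewrite mulA e1.
by have := prM p1 (pr_w a); rewrite addn1.
Qed.
Let row_ei i n x : pr n x = x -> row_piece i n (e i ** x).
Proof.
move=> p; split; first by rewrite mulA eM eqxx.
by have := prM (pr_e i) p; rewrite add0n.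
Qed.

Let gen_row i n z : row_piece i n.+1 z -> exists t : A -> M,
  [/\ forall a, row_piece i n (t a), forall a, t a ** e (tgt a) = t a
    & z = \sum_a t a ** w a].
Proof.
move=> [ez pz]; have [t pt zt] := gen_w pz.
exists (fun a => e i ** t a ** e (tgt a)); split=> [a|a|].
- by apply: row_e; exact: row_ei.
- by rewrite -mulA eM eqxx.
rewrite -ez zt mul_sumr; apply: eq_bigr => a _.
by rewrite -!mulA ew.
Qed.

Let pr_mulv_piece m x a : pr m.+1 (pr m x ** v a) = pr m x ** v a.
Proof. by rewrite -addn1; apply: prM => //; rewrite prK eqxx. Qed.

Let pr_mulv n x a : pr n.+1 (x ** v a) = pr n x ** v a.
Proof.
have [N eN] := sum_pr x.
transitivity (\sum_(m < N) pr n (pr m x) ** v a).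
  rewrite {1}eN mul_suml linear_sum; apply: eq_bigr => m _.
  by rewrite -pr_mulv_piece !prK eqSS; case: eqP => _; rewrite ?mul0l ?pr_mulv_piece.
by rewrite -mul_suml -linear_sum -eN.
Qed.

Let pr0_mulv x a : pr 0 (x ** v a) = 0.
Proof.
have [N ->] := sum_pr x; rewrite mul_suml linear_sum big1 // => m _.
by rewrite -pr_mulv_piece prK.
Qed.

(** The solution provided by [syzygy_w] need not be homogeneous; since the [t a] are, cutting it by
    [e i] and [pr n] leaves a solution. *)
Let syzygy_row i n (t : A -> M) : (forall a, row_piece i n.+1 (t a)) ->
  (forall a, t a ** e (tgt a) = t a) -> \sum_a t a ** w a = 0 ->
  exists2 x, row_piece i n x & forall a, t a = x ** v a.
Proof.
move=> rt te t0; have [x Hx] := syzygy_w te t0.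
exists (e i ** pr n x); first by apply: row_ei; rewrite prK eqxx.
move=> a; have [et pt] := rt a.
by rewrite -mulA -pr_mulv -Hx pt et.
Qed.

(** No [x ** v a] has a component of degree 0. This replaces the row in degree -1 and starts the
    recursion of dimensions. *)
Let syzygy_row0 i (t : A -> M) : (forall a, row_piece i 0 (t a)) ->
  (forall a, t a ** e (tgt a) = t a) -> \sum_a t a ** w a = 0 -> forall a, t a = 0.
Proof.
move=> rt te t0 a; have [x Hx] := syzygy_w te t0.
by have [_ <-] := rt a; rewrite Hx pr0_mulv.
Qed.

(** An endomorphism is a function on all of [M] that is constrained on one row only. Commuting with
    the [e j] means preserving the decomposition by end vertices. *)
Definition row_endo i n (f : M -> M) :=
  [/\ forall a x x', row_piece i n x -> row_piece i n x' ->
        f (a *: x + x') = a *: f x + f x',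
      forall x, row_piece i n x -> row_piece i n (f x)
    & forall x j, row_piece i n x -> f (x ** e j) = f x ** e j].

Definition compatible i n (f g : M -> M) :=
  forall x a, row_piece i n x -> g (x ** v a) = f x ** v a.

(** A brick is usually a module with only scalar endomorphisms; here the module is the pair of rows
    [n] and [n.+1]. *)
Definition brick i n := forall f g, row_endo i n f -> row_endo i n.+1 g ->
  compatible i n f g -> exists c, (forall x, row_piece i n x -> f x = c *: x) /\
    (forall x, row_piece i n.+1 x -> g x = c *: x).

Definition socle_free i n := forall x, row_piece i n x ->
  (forall a, x ** v a = 0) -> x = 0.

Let endo0 i n f : row_endo i n f -> f 0 = 0.
Proof.
move=> [lf _ _]; have := lf (-1) 0 0 (row0 i n) (row0 i n).
by rewrite scaler0 addr0 scaleN1r addNr.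
Qed.

Let row_sum i n (J : finType) (c : J -> k) (F : J -> M) :
  (forall j, row_piece i n (F j)) -> row_piece i n (\sum_j c j *: F j).
Proof.
move=> HF; apply: big_ind => //= [x x' rx rx'|j _].
  by rewrite -[x]scale1r; exact: rowP.
by rewrite -[_ *: _]addr0; apply: rowP.
Qed.

Let endo_sum i n f (J : finType) (c : J -> k) (F : J -> M) : row_endo i n f ->
  (forall j, row_piece i n (F j)) -> f (\sum_j c j *: F j) = \sum_j c j *: f (F j).
Proof.
move=> ef HF; have [lf _ _] := ef.
have [//] : row_piece i n (\sum_j c j *: F j) /\
    f (\sum_j c j *: F j) = \sum_j c j *: f (F j).
elim: (index_enum J) => [|j s [IHr IH]]; first by rewrite !big_nil (endo0 ef).
by rewrite !big_cons; split; [exact: rowP | rewrite lf ?IH].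
Qed.

(** Compatibility is imposed on the arrows [v], while rows are generated by means of the dual arrows
    [w]; since the [w] are combinations of the [v], it carries over by linearity of [g]. *)
Let compatible_w i n f g x a : row_endo i n.+1 g -> compatible i n f g ->
  row_piece i n x -> g (x ** w a) = f x ** w a.
Proof.
move=> eg co rx; have [C HC] := w_span; rewrite HC !mul_sumr.
transitivity (g (\sum_b C a b *: (x ** v b))).
  by congr (g _); apply: eq_bigr => b _; rewrite mulZr.
rewrite (endo_sum _ eg); last by move=> b; exact: row_v.
by apply: eq_bigr => b _; rewrite mulZr co.
Qed.

(** Row [n.+1] is generated by row [n], so [f] determines [g]. *)
Let scalar_up i n f g c : row_endo i n.+1 g -> compatible i n f g ->
  (forall x, row_piece i n x -> f x = c *: x) ->
  forall x, row_piece i n.+1 x -> g x = c *: x.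
Proof.
move=> eg co fc x rx; have [t [rt te ->]] := gen_row rx.
transitivity (g (\sum_a 1 *: (t a ** w a))).
  by congr (g _); apply: eq_bigr => a _; rewrite scale1r.
rewrite (endo_sum _ eg) ?scaler_sumr; last by move=> a; exact: row_w.
apply: eq_bigr => a _; rewrite scale1r (compatible_w _ eg co (rt a)) fc //.
Qed.

Let row_piece0 i x : row_piece i 0 x -> exists c, x = c *: e i.
Proof.
move=> [ex px]; have [c ec] := pr0_span px; exists (c i).
rewrite -{1}ex {1}ec mul_sumr (bigD1 i) //= big1 ?addr0 => [|j ne].
  by rewrite mulZr eM eqxx.
by rewrite mulZr eM eq_sym (negbTE ne) scaler0.
Qed.

Let row_piece_e i : row_piece i 0 (e i).
Proof. by split; rewrite ?eM ?eqxx ?pr_e. Qed.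

Lemma brick0 i : brick i 0.
Proof.
move=> f g ef eg co; have [lf sf _] := ef.
have [c fc] := row_piece0 (sf _ (row_piece_e i)).
have Hf x : row_piece i 0 x -> f x = c *: x.
  case/row_piece0 => d ->; have := lf d _ 0 (row_piece_e i) (row0 _ _).
  by rewrite (endo0 ef) !addr0 => ->; rewrite fc !scalerA mulrC.
by exists c; split=> //; exact: scalar_up eg co Hf.
Qed.

Lemma brick_up i n : brick i n -> socle_free i n -> brick i n.+1.
Proof.
move=> br sf f g ef eg co; have [lf stf gf] := ef.
(* The family [f (x ** v a)] is a syzygy, because its sum against the [w a] is the value of [g] at
   the relation, which is 0. The resulting [x'] is the value at [x] of an endomorphism one row
   below. *)
have ex x : row_piece i n x ->
    exists2 x', row_piece i n x' & forall a, f (x ** v a) = x' ** v a.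
  move=> rx; apply: (@syzygy_row i n (fun a => f (x ** v a))).
  - by move=> a; apply: stf; exact: row_v.
  - by move=> a; rewrite -gf -?mulA ?ve //; exact: row_v.
  rewrite (eq_bigr (fun a => 1 *: g (x ** v a ** w a))); last first.
    by move=> a _; rewrite scale1r (compatible_w _ eg co) //; exact: row_v.
  rewrite -(endo_sum _ eg); last by move=> a; apply: row_w; exact: row_v.
  by under eq_bigr do rewrite scale1r; rewrite rel_vw (endo0 eg).
have [h Hh] : {h : M -> M & forall x, row_piece i n x ->
    row_piece i n (h x) /\ forall a, f (x ** v a) = h x ** v a}.
  apply: (@choice _ _ (fun x x' => row_piece i n x ->
    row_piece i n x' /\ forall a, f (x ** v a) = x' ** v a)) => x.
  have [rx|nr] := pselect (row_piece i n x); last by exists 0.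
  by have [x' r' H'] := ex x rx; exists x'.
(* The free socle makes [x'] unique, and uniqueness makes the chosen function [h] linear and
   compatible with the vertices. *)
have uniq x x' : row_piece i n x -> row_piece i n x' ->
    (forall a, x ** v a = x' ** v a) -> x = x'.
  move=> rx rx' H; apply/eqP; rewrite -subr_eq0; apply/eqP; apply: sf.
    by rewrite addrC -scaleN1r; exact: rowP.
  by move=> a; rewrite addrC -scaleN1r mulPl H scaleN1r addNr.
have eh : row_endo i n h.
  split=> [a x x' rx rx'|x rx|x j rx]; last 2 first.
  - exact: (Hh x rx).1.
  - apply: uniq; [exact: (Hh _ (row_e j rx)).1 | exact: row_e (Hh x rx).1 | ].
    move=> a; rewrite -(Hh _ (row_e j rx)).2 -!mulA ev; case: eqP => _.
      exact: (Hh x rx).2.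
    by rewrite !mul0r (endo0 ef).
  apply: uniq; [exact: (Hh _ (rowP _ rx rx')).1 | | ].
    by apply: rowP; [exact: (Hh x rx).1 | exact: (Hh x' rx').1].
  move=> b; rewrite -(Hh _ (rowP _ rx rx')).2 !mulPl.
  by rewrite lf ?(Hh _ rx).2 ?(Hh _ rx').2 //; exact: row_v.
have [c [_ fc]] := br h f eh ef (fun x a rx => (Hh x rx).2 a).
by exists c; split=> //; exact: scalar_up eg co fc.
Qed.

Let piece_row n i j x : piece n i j x -> row_piece i n x. Proof. by case. Qed.

Let pieceP n i j a x x' : piece n i j x -> piece n i j x' -> piece n i j (a *: x + x').
Proof.
by move=> [e1 r1 p1] [e2 r2 p2]; split; rewrite ?mulPr ?mulPl ?linearP ?e1 ?e2 ?r1 ?r2 ?p1 ?p2.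
Qed.

Let piece0 n i j : piece n i j 0. Proof. by split; rewrite ?mul0r ?mul0l ?linear0. Qed.

Let piece_e n i j x : row_piece i n x -> piece n i j (x ** e j).
Proof. by move=> rx; have [? ?] := row_e j rx; split=> //; rewrite -mulA eM eqxx. Qed.

(* [t] stands for the element [\sum_a t_a (x) w_a] of [M (x) V]. *)
Definition arrow_piece n i j : set {ffun A -> M} :=
  [set t | forall a, (if src a == j then piece n i (tgt a) else [set 0]) (t a)].

Let has_dim_set0 : has_dim ([set 0] : set M) 0.
Proof.
exists (fun=> 0); split=> [c _ []//|x]; split=> [->|[c ->]].
  by exists (fun=> 0); rewrite big_ord0.
by rewrite big_ord0.
Qed.

Let has_dim_arrow n i j d : (forall l, has_dim (piece n i l) (d l)) ->
  has_dim (arrow_piece n i j) (\sum_(a | src a == j) d (tgt a)).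
Proof.
move=> H; rewrite big_mkcond; 
apply: (has_dim_ffun (S := fun a => if src a == j then piece n i (tgt a) else [set 0])
  (d := fun a => if src a == j then d (tgt a) else 0%N)) => a.
by case: ifP.
Qed.

Let wsum_fun (t : {ffun A -> M}) := \sum_a t a ** w a.
Let wsum_linear : linear wsum_fun.
Proof.
move=> c t t'; rewrite /wsum_fun scaler_sumr -big_split; apply: eq_bigr => a _ /=.
by rewrite !ffunE mulPl.
Qed.
Let wsum : {linear {ffun A -> M} -> M} :=
  HB.pack wsum_fun (GRing.isLinear.Build _ _ _ _ wsum_fun wsum_linear).

Let vmul_fun (x : M) : {ffun A -> M} := [ffun a => x ** v a].
Let vmul_linear : linear vmul_fun.
Proof. by move=> c x x'; apply/ffunP => a; rewrite !ffunE mulPl. Qed.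
Let vmul : {linear M -> {ffun A -> M}} :=
  HB.pack vmul_fun (GRing.isLinear.Build _ _ _ _ vmul_fun vmul_linear).

Let arrow_row n i j t a : arrow_piece n i j t -> row_piece i n (t a).
Proof. by move/(_ a); case: ifP => _; [apply: piece_row | move=> ->]. Qed.

Let arrow_tgt n i j t a : arrow_piece n i j t -> t a ** e (tgt a) = t a.
Proof. by move/(_ a); case: ifP => _; [case | move=> ->; rewrite mul0l]. Qed.

Let wsum_image n i j z : piece n.+1 i j z <-> exists2 t, arrow_piece n i j t & wsum t = z.
Proof.
split=> [rz|[t Ht <-]].
  have [t [rt te zt]] := gen_row (piece_row rz); have [_ zj _] := rz.
  exists [ffun a => if src a == j then t a else 0].
    move=> a; rewrite ffunE; case: ifP => // _.
    by have [? ?] := rt a; split.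
  rewrite /= /wsum_fun -[RHS]zj zt mul_suml; apply: eq_bigr => a _.
  by rewrite ffunE -mulA we; case: ifP => _; rewrite ?mul0l ?mul0r.
have rs : row_piece i n.+1 (wsum t).
  rewrite /= /wsum_fun (eq_bigr (fun a => 1 *: (t a ** w a))); last first.
    by move=> a _; rewrite scale1r.
  by apply: row_sum => a; apply: row_w; exact: (arrow_row a Ht).
have [? ?] := rs; split=> //; rewrite /= /wsum_fun mul_suml; apply: eq_bigr => a _.
rewrite -mulA we; have := Ht a; case: ifP => // _ ->.
by rewrite !mul0l.
Qed.

(** Finiteness follows from the surjection of the arrow pieces onto the next degree alone, so
    dimensions are available before any injectivity is known. *)
Lemma piece_finite n i j : exists d, has_dim (piece n i j) d.
Proof.
elim: n i j => [|n IH] i j.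
  case: (eqVneq i j) => [<-|ne]; last first.
    exists 0%N, (fun=> 0); split=> [c _ []//|x]; split=> [px|[c ->]]; last first.
      by rewrite big_ord0.
    exists (fun=> 0); rewrite big_ord0; have [c ec] := row_piece0 (piece_row px).
    by have [_ <- _] := px; rewrite ec mulZl eM (negbTE ne) scaler0.
  exists 1%N, (fun=> e i); split=> [c|x].
    rewrite big_ord1 => /eqP; rewrite scaler_eq0 (negbTE (e_neq0 i)) orbF => /eqP c0 j'.
    by rewrite ord1.
  split=> [px|[c ->]].
    by have [c ->] := row_piece0 (piece_row px); exists (fun=> c); rewrite big_ord1.
  rewrite big_ord1 -[_ *: _]addr0; apply: pieceP => //.
  by split; rewrite ?eM ?eqxx ?pr_e.
have [d Hd] : {d : I -> nat & forall l, has_dim (piece n i l) (d l)}.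
  by apply: (@choice _ _ (fun l d => has_dim (piece n i l) d)) => l; exact: IH.
exact: (has_dim_image (f := wsum) (has_dim_arrow j Hd) (@wsum_image n i j)).
Qed.

Definition piece_dim n i j : nat := sval (cid (piece_finite n i j)).

Lemma piece_dimP n i j : has_dim (piece n i j) (piece_dim n i j).
Proof. exact: svalP. Qed.

Lemma piece_dim0 i j : piece_dim 0 i j = (i == j).
Proof.
apply: (has_dim_unique (piece_dimP 0 i j)); case: (eqVneq i j) => [<-|ne].
  exists (fun=> e i); split=> [c|x].
    rewrite big_ord1 => /eqP; rewrite scaler_eq0 (negbTE (e_neq0 i)) orbF => /eqP c0 j'.
    by rewrite ord1.
  split=> [px|[c ->]].
    by have [c ->] := row_piece0 (piece_row px); exists (fun=> c); rewrite big_ord1.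
  rewrite big_ord1 -[_ *: _]addr0; apply: pieceP => //.
  by split; rewrite ?eM ?eqxx ?pr_e.
exists (fun=> 0); split=> [c _ []//|x]; split=> [px|[c ->]]; last first.
  by rewrite big_ord0.
exists (fun=> 0); rewrite big_ord0; have [c ec] := row_piece0 (piece_row px).
by have [_ <- _] := px; rewrite ec mulZl eM (negbTE ne) scaler0.
Qed.

Let arrowP n i j a t t' : arrow_piece n i j t -> arrow_piece n i j t' ->
  arrow_piece n i j (a *: t + t').
Proof.
move=> Ht Ht' b; have := Ht b; have := Ht' b; rewrite !ffunE; case: ifP => _.
  by move=> ? ?; exact: pieceP.
by move=> -> ->; rewrite scaler0 addr0.
Qed.

(** The exact sequence of [piece_dimSS] with 0 in place of the missing piece of degree -1. *)
Lemma piece_dim1 i j :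
  piece_dim 1 i j = (\sum_(a | src a == j) piece_dim 0 i (tgt a))%N.
Proof.
apply/esym/(has_dim_unique (has_dim_arrow j (piece_dimP 0 i))).
rewrite -[piece_dim 1 i j]add0n.
apply: (has_dim_exact (f := vmul) (g := wsum) has_dim_set0 (piece_dimP 1 i j)) => //.
- by move=> _ ->; rewrite linear0 => a; rewrite ffunE; case: ifP.
- exact: arrowP.
- move=> t Ht; split=> [t0|[x -> <-]]; last by rewrite !linear0.
  exists 0 => //; rewrite linear0; apply/ffunP => a; rewrite ffunE; apply/esym.
  by apply: (@syzygy_row0 i t _ _ t0) => b; [exact: (arrow_row b Ht) | exact: arrow_tgt Ht].
Qed.

(** The sequence from row [n] through row [n.+1] tensored with V to row [n.+2] is always right
    exact; [socle_free] says precisely that its first map is injective. *)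
Lemma piece_dimSS n i j : socle_free i n ->
  (\sum_(a | src a == j) piece_dim n.+1 i (tgt a) = piece_dim n i j + piece_dim n.+2 i j)%N.
Proof.
move=> sf; apply: (has_dim_unique (has_dim_arrow j (piece_dimP n.+1 i))).
apply: (has_dim_exact (f := vmul) (g := wsum) (piece_dimP n i j) (piece_dimP n.+2 i j)).
- move=> x px a; rewrite ffunE; have [_ xj _] := px.
  rewrite -xj -mulA ev eq_sym; case: ifP => _; last by rewrite mul0r.
  have [? ?] := row_v a (piece_row px); split=> //.
  by rewrite -mulA ve.
- exact: arrowP.
- move=> x px /ffunP x0; apply: sf (piece_row px) _ => a.
  by have := x0 a; rewrite !ffunE.
- move=> t Ht; split=> [t0|[x px <-]]; last first.
    by rewrite /= /wsum_fun; under eq_bigr do rewrite ffunE; exact: rel_vw.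
  have [|||x rx Hx] := @syzygy_row i n t.
  + by move=> a; exact: (arrow_row a Ht).
  + by move=> a; exact: (arrow_tgt a Ht).
  + exact: t0.
  (* The preimage [x] may end at several vertices. Its part ending at [j] has the same image, as
     [t a] vanishes unless [a] starts at [j]. *)
  exists (x ** e j); first exact: piece_e.
  apply/ffunP => a; rewrite ffunE -mulA ev; case: eqP => [e'|ne]; first by rewrite -Hx.
  have := Ht a; case: eqP => [e'|_ ->]; last by rewrite mul0r.
  by case: ne.
exact: wsum_image.
Qed.

Let weight i n := (\sum_j y j * piece_dim n i j)%N.

(** Exchanging the sums moves the adjacency from the dimensions to [y], where subharmonicity
    applies. *)
Let weight_swap i n :
  (2 * weight i n <= \sum_j y j * \sum_(a | src a == j) piece_dim n i (tgt a))%N.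
Proof.
have -> : (\sum_j y j * \sum_(a | src a == j) piece_dim n i (tgt a) =
    \sum_l (\sum_(a | tgt a == l) y (src a)) * piece_dim n i l)%N.
  transitivity (\sum_a y (src a) * piece_dim n i (tgt a))%N.
    under eq_bigr do rewrite big_distrr /=.
    rewrite (exchange_big_dep xpredT) //=; apply: eq_bigr => a _.
    by rewrite (big_pred1 (src a)) // => j; rewrite eq_sym.
  under [RHS]eq_bigr do rewrite big_distrl /=.
  rewrite (exchange_big_dep xpredT) //=; apply: eq_bigr => a _.
  by rewrite (big_pred1 (tgt a)) // => j; rewrite eq_sym.
rewrite /weight big_distrr; apply: leq_sum => l _ /=.
by rewrite mulnA leq_mul2r y_sub orbT.
Qed.

Let weight0 i : weight i 0 = y i.
Proof.
rewrite /weight (bigD1 i) //= piece_dim0 eqxx muln1 big1 ?addn0 // => j ne.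
by rewrite piece_dim0 eq_sym (negbTE ne) muln0.
Qed.

(** A socle element would give a nonzero endomorphism of the pair that is zero on row [n.+1]. As
    positive weight makes that row nonzero, no scalar behaves in this way. *)
Let brick_socle_free i n : brick i n -> (0 < weight i n.+1)%N -> socle_free i n.
Proof.
move=> br; rewrite lt0n sum_nat_eq0 => /forallPn[j].
rewrite /= muln_eq0 negb_or => /andP[_]; rewrite -lt0n => dj.
have [z pz z0] := has_dim_neq0 (piece_dimP n.+1 i j) dj.
move=> x0 rx0 x0v; apply/eqP; apply: contrapT => /negP x0n.
(* Cutting [x0] to one end vertex puts it in a finite-dimensional piece, where a functional exists,
   and lets the rank one map commute with the vertices. *)
have [l xl] : exists l, x0 ** e l != 0.
  apply: contrapT => /forallNP H; case/eqP: x0n; rewrite -(sum_er x0) big1 // => l _.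
  by apply/eqP; apply: contrapT => /negP; exact: H.
pose x1 := x0 ** e l.
have px1 : piece n i l x1 by exact: piece_e.
have x1v a : x1 ** v a = 0.
  by rewrite /x1 -mulA ev; case: ifP => _; rewrite ?mul0r.
have [f f1 lf] := dual_functional (piece_dimP n i l) px1 xl.
(* the rank one endomorphism onto the line of x1, paired with 0 *)
pose al x := f (x ** e l) *: x1.
have f0 : f 0 = 0.
  by have := lf (-1) 0 0 (piece0 _ _ _) (piece0 _ _ _); rewrite scaler0 addr0 mulN1r addNr.
have eal : row_endo i n al.
  split=> [a x x' rx rx'|x rx|x j' rx].
  - by rewrite /al mulPl lf ?scalerDl ?scalerA //; exact: piece_e.
  - by rewrite /al -[_ *: _]addr0; apply: rowP => //; exact: piece_row px1.
  rewrite /al mulZl /x1 -!mulA !eM eq_sym; case: ifP => [/eqP->//|_].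
  by rewrite !mul0r f0 scale0r scaler0.
have e0 : row_endo i n.+1 (fun=> 0).
  by split=> *; rewrite ?scaler0 ?addr0 ?mul0l //.
have [|c [fc gc]] := br al (fun=> 0) eal e0.
  by move=> x a _; rewrite /al mulZl x1v scaler0.
have c0 : c = 0.
  apply/eqP; have /esym/eqP := gc z (piece_row pz).
  by rewrite scaler_eq0 (negbTE z0) orbF.
have := fc x1 (piece_row px1); rewrite c0 scale0r /al.
have [_ -> _] := px1; rewrite f1 scale1r => x10.
by move: xl; rewrite -/x1 x10 eqxx.
Qed.

(** The claims feed each other: the dimension formula for row [n.+2] needs a free socle in row [n],
    which in turn needs the brick property and a nonzero row [n.+1]. The formula makes the weights
    convex, [w_n + w_(n+2) >= 2 w_(n+1)], so a strict increase persists. *)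
Lemma brick_all i n : brick i n /\ (0 < weight i n < weight i n.+1)%N.
Proof.
elim: n => [|n [br lt]].
  split; first exact: brick0.
  have := weight_swap i 0; rewrite weight0.
  have -> : weight i 1 = (\sum_j y j * \sum_(a | src a == j) piece_dim 0 i (tgt a))%N.
    by apply: eq_bigr => j _; rewrite piece_dim1.
  by have := y_gt0 i; lia.
have sf : socle_free i n by apply: brick_socle_free br _; lia.
split; first exact: brick_up.
have := weight_swap i n.+1.
have -> : (\sum_j y j * \sum_(a | src a == j) piece_dim n.+1 i (tgt a) =
    weight i n + weight i n.+2)%N.
  by rewrite -big_split; apply: eq_bigr => j _; rewrite piece_dimSS // mulnDr.
by lia.
Qed.

Lemma socle_free_all i n : socle_free i n.
Proof.
have [br lt] := brick_all i n; apply: brick_socle_free br _; lia.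
Qed.

Lemma socle_eq0 x : (forall a, x ** v a = 0) -> x = 0.
Proof.
move=> xv; rewrite -(sum_el x) big1 // => i _.
have [N ->] := sum_pr x; rewrite mul_sumr big1 // => n _.
apply: (@socle_free_all i n); first by apply: row_ei; rewrite prK eqxx.
move=> a; rewrite -mulA; suff -> : pr n x ** v a = 0 by rewrite mul0r.
by rewrite -pr_mulv xv linear0.
Qed.

Theorem piece_dims : exists d : nat -> I -> I -> nat,
  [/\ forall n i j, has_dim (piece n i j) (d n i j),
      forall i j, d 0%N i j = (i == j),
      forall i j, d 1%N i j = (\sum_(a | src a == j) d 0 i (tgt a))%N
    & forall n i j, (\sum_(a | src a == j) d n.+1 i (tgt a) = d n i j + d n.+2 i j)%N].
Proof.
exists piece_dim; split; [exact: piece_dimP|exact: piece_dim0|exact: piece_dim1|].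
by move=> n i j; apply: piece_dimSS; exact: socle_free_all.
Qed.

End Socle.

(** * The linear resolution *)

(** Projections make directness immediate: [pr n] isolates the [n]-th term of a sum of homogeneous
    elements. *)
Lemma graded_group_proj (M : zmodType) (gr : nat -> set M) (pr : nat -> M -> M) :
  (forall n x, gr n x <-> pr n x = x) ->
  (forall n x y, pr n (x - y) = pr n x - pr n y) ->
  (forall m n x, pr m (pr n x) = if m == n then pr n x else 0) ->
  (forall x, exists N, x = \sum_(n < N) pr n x) -> graded_group gr.
Proof.
move=> grE prB prK sum_pr.
have pr0 n : pr n 0 = 0 by have := prB n 0 0; rewrite !subrr.
have prN n x : pr n (- x) = - pr n x by rewrite -[- x]sub0r prB pr0 sub0r.
have prD n x y : pr n (x + y) = pr n x + pr n y by rewrite -{1}[y]opprK prB prN opprK.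
split=> [n|n x y /grE ex /grE ey|x|N y yP y0 n nN].
- by apply/grE.
- by apply/grE; rewrite prB ex ey.
- have [N e] := sum_pr x; exists N, (fun n => pr n x) => // n.
  by apply/grE; rewrite prK eqxx.
have := congr1 (pr n) y0; rewrite (big_morph (pr n) (prD n) (pr0 n)) pr0.
rewrite (bigD1 (Ordinal nN)) //= (grE _ _).1 // big1 ?addr0 // => m ne.
rewrite -((grE _ _).1 (yP m)) prK; case: eqP => // e.
by case/eqP: ne; apply: val_inj.
Qed.

Section DualBasis.
Variables (A : pzRingType) (P : lmodType A) (J : finType).
Variables (b : J -> P) (phi : J -> {linear P -> A^o}).
Hypothesis phiE : forall x, x = \sum_j (phi j x : A) *: b j.

(** The easy half of the dual basis criterion: lift the images of the [b j] and recombine with the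
    [phi j]. It covers left ideals of idempotents, whose generators are not free. *)
Lemma dual_basis_projective : projective_module P.
Proof.
move=> M N g f sur.
have [m Hm] : {m : J -> M & forall j, g (m j) = f (b j)}.
  by apply: (@choice _ _ (fun j m => g m = f (b j))) => j; exact: sur.
pose h x := \sum_j (phi j x : A) *: m j.
have lh : linear h.
  move=> a x y; rewrite /h scaler_sumr -big_split; apply: eq_bigr => j _ /=.
  by rewrite linearP /= scalerDl scalerA.
exists (HB.pack_for {linear P -> M} h (GRing.isLinear.Build _ _ _ _ h lh)) => x.
rewrite /= /h linear_sum [in RHS](phiE x) linear_sum; apply: eq_bigr => j _.
by rewrite !linearZ /= Hm.
Qed.

Lemma dual_basis_generated (gr : nat -> set P) d : (forall j, gr d (b j)) ->
  generated_in_degree gr d.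
Proof.
move=> gb x; exists [seq (phi j x : A, b j) | j <- enum J].
  by move=> _ /mapP[j _ ->]; exact: gb.
by rewrite big_map big_enum /= {1}(phiE x).
Qed.

End DualBasis.

Section ArrowModule.
Variables (A : pzRingType) (J : finType) (u : J -> A).

(* The direct sum of the left ideals [A u_a], for idempotents [u_a]. *)
Definition arrow_pred (f : {ffun J -> A^o}) := [forall a, f a * u a == f a :> A].

Lemma arrow_submod_closed : submod_closed arrow_pred.
Proof.
split=> [|c f g /forallP ef /forallP eg].
  by apply/forallP => a; rewrite ffunE mul0r.
apply/forallP => a; rewrite !ffunE; have /eqP ea := ef a; have /eqP eb := eg a.
by rewrite mulrDl -[in X in X == _]mulrA ea eb.
Qed.

HB.instance Definition _ := GRing.isSubmodClosed.Build A {ffun J -> A^o} arrow_pred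
  arrow_submod_closed.

Record arrow_mod := ArrowMod { arrow_val :> {ffun J -> A^o}; _ : arrow_val \in arrow_pred }.
HB.instance Definition _ := [isSub for arrow_val].
HB.instance Definition _ := [Choice of arrow_mod by <:].
HB.instance Definition _ := [SubChoice_isSubLmodule of arrow_mod by <:].

End ArrowModule.

(** * Koszulness from the exact three-term complex *)

Section KoszulComplex.
Variables (A : pzRingType) (gr : nat -> set A) (pr : nat -> A -> A).
Variables (I J : finType) (tgt : J -> I) (e : I -> A) (v w : J -> A).
Variables (k : pzRingType) (co : I -> A -> k).

Hypothesis grE : forall n x, gr n x <-> pr n x = x.
Hypothesis prB : forall n x y, pr n (x - y) = pr n x - pr n y.
Hypothesis prK : forall m n x, pr m (pr n x) = if m == n then pr n x else 0.
Hypothesis sum_pr : forall x, exists N, x = \sum_(n < N) pr n x.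
Hypothesis prM : forall m n x y, pr m x = x -> pr n y = y -> pr (m + n) (x * y) = x * y.
Hypothesis pr_e : forall i, pr 0 (e i) = e i.
Hypothesis pr_v : forall a, pr 1 (v a) = v a.
Hypothesis pr_w : forall a, pr 1 (w a) = w a.
Hypothesis sum_e : \sum_i e i = 1.
Hypothesis eM : forall i j, e i * e j = if i == j then e i else 0.
Hypothesis ve : forall a, v a * e (tgt a) = v a.
Hypothesis ew : forall a, e (tgt a) * w a = w a.
Hypothesis gen_w : forall n z, pr n.+1 z = z -> exists2 y : J -> A,
  (forall a, pr n (y a) = y a) & z = \sum_a y a * w a.
Hypothesis syzygy_w : forall y : J -> A, (forall a, y a * e (tgt a) = y a) ->
  \sum_a y a * w a = 0 -> exists x, forall a, y a = x * v a.
Hypothesis rel_vw : \sum_a v a * w a = 0.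
Hypothesis socle0 : forall x, (forall a, x * v a = 0) -> x = 0.
Hypothesis e_comm : forall i x, pr 0 x = x -> e i * x = x * e i.
Hypothesis e_inv : forall i x, pr 0 x = x ->
  e i * x = 0 \/ exists2 u, pr 0 u = u & u * (e i * x) = e i.
Hypothesis coB : forall i x y, co i (x - y) = co i x - co i y.
Hypothesis coM : forall i x y, co i (x * y) = co i x * co i y.
Hypothesis co1 : forall i, co i 1 = 1.
Hypothesis co_pos : forall i n x, pr n.+1 x = x -> co i x = 0.
Hypothesis co_sur : forall f : I -> k, exists x, forall i, co i x = f i.
Hypothesis co_inj : forall x, pr 0 x = x -> (forall i, co i x = 0) -> x = 0.

Let pr0 n : pr n 0 = 0. Proof. by have := prB n 0 0; rewrite !subrr. Qed.
Let prN n x : pr n (- x) = - pr n x.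
Proof. by rewrite -[- x]sub0r prB pr0 sub0r. Qed.
Let prD n x y : pr n (x + y) = pr n x + pr n y.
Proof. by rewrite -{1}[y]opprK prB prN opprK. Qed.
Let pr_sum n K (r : seq K) (F : K -> A) : pr n (\sum_(j <- r) F j) = \sum_(j <- r) pr n (F j).
Proof. exact: (big_morph (pr n) (prD n) (pr0 n)). Qed.
Let co0 i : co i 0 = 0. Proof. by have := coB i 0 0; rewrite !subrr. Qed.
Let coN i x : co i (- x) = - co i x.
Proof. by rewrite -[- x]sub0r coB co0 sub0r. Qed.
Let coD i x y : co i (x + y) = co i x + co i y.
Proof. by rewrite -{1}[y]opprK coB coN opprK. Qed.
Let co_sum i K (r : seq K) (F : K -> A) : co i (\sum_(j <- r) F j) = \sum_(j <- r) co i (F j).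
Proof. exact: (big_morph (co i) (coD i) (co0 i)). Qed.

Let pr_homog m n x : pr m x = x -> pr n x = if n == m then x else 0.
Proof. by move=> <-; rewrite prK. Qed.

Let pr_mulr d y n x : pr d y = y -> pr (n + d) (x * y) = pr n x * y.
Proof.
move=> yd; have [N eN] := sum_pr x.
transitivity (\sum_(m < N) pr n (pr m x) * y); last by rewrite -mulr_suml -pr_sum -eN.
rewrite {1}eN mulr_suml pr_sum; apply: eq_bigr => m _.
have h : pr (m + d) (pr m x * y) = pr m x * y by apply: prM => //; rewrite prK eqxx.
by rewrite (pr_homog _ h) prK eqn_add2r; case: eqP; rewrite ?mul0r.
Qed.

Let pr1 : pr 0 1 = 1.
Proof. by rewrite -sum_e pr_sum; apply: eq_bigr => i _; rewrite pr_e. Qed.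

Lemma koszul_graded_ring : graded_ring gr.
Proof.
split; first exact: (graded_group_proj grE prB prK sum_pr).
  exact/grE.
by move=> m n x y /grE ex /grE ey; apply/grE; exact: prM.
Qed.

(** By [e_inv] any nonzero element of the block of [e i] generates [e i], so a left ideal is
    determined by the [e i] it contains, and the remaining blocks form a complement. *)
Lemma koszul_semisimple0 : semisimple0 gr.
Proof.
move=> L [Lgr L0 LB LM].
have gr0 x : gr 0%N x <-> pr 0 x = x by exact: grE.
have LN x : L x -> L (- x) by rewrite -sub0r; exact: LB.
have LD x y : L x -> L y -> L (x + y) by move=> Lx /LN Ly; rewrite -[y]opprK; exact: LB.
exists [set x | gr 0%N x /\ forall i, L (e i) -> e i * x = 0]; split.
- split=> [x []//||x y [gx Hx] [gy Hy]|a x ga [gx Hx]].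
  + by split; [apply/gr0; rewrite pr0 | move=> i _; rewrite mulr0].
  + split; first by apply/gr0; rewrite prB; congr (_ - _); exact/gr0.
    by move=> i Li; rewrite mulrBr Hx // Hy // subrr.
  split; first by apply/gr0; rewrite -[0%N]addn0; apply: prM; exact/gr0.
  by move=> i Li; rewrite mulrA (e_comm _ ((gr0 a).1 ga)) -mulrA Hx // mulr0.
- move=> x Lx [gx Hx]; rewrite -[x]mul1r -sum_e mulr_suml big1 // => i _.
  case: (e_inv i ((gr0 x).1 gx)) => // -[u pu eu]; apply: Hx; rewrite -eu.
  apply: (LM); first exact/gr0.
  by apply: LM => //; apply/gr0.
move=> x gx; have px := (gr0 x).1 gx.
exists (\sum_(i | `[< L (e i) >]) e i * x), (\sum_(i | ~~ `[< L (e i) >]) e i * x).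
have gex i : gr 0%N (e i * x) by apply/gr0; rewrite -[0%N]addn0; apply: prM.
split.
- apply: big_ind => // i /asboolP Li; rewrite e_comm //; apply: (LM) => //.
- split.
    apply/gr0; rewrite -big_filter pr_sum; apply: eq_bigr => i _; exact/gr0.
  move=> j Lj; rewrite mulr_sumr big1 // => i /asboolP Li.
  by rewrite mulrA eM; case: eqP => [ji|_]; [case: Li; rewrite -ji | rewrite mul0r].
have {1}-> : x = \sum_i e i * x by rewrite -mulr_suml sum_e mul1r.
exact: (bigID (fun i => `[< L (e i) >])).
Qed.

Let Ao : lmodType A := A^o.

(** Projections for the grading shifted by [d]; the test guards against truncated subtraction. *)
Let spr d n (x : A) := if (n < d)%N then 0 else pr (n - d) x.

Let sprB d n x y : spr d n (x - y) = spr d n x - spr d n y.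
Proof. by rewrite /spr; case: ifP; rewrite ?subr0 ?prB. Qed.

Let sprK d m n x : spr d m (spr d n x) = if m == n then spr d n x else 0.
Proof.
rewrite /spr; case: (ltnP m d) => md; case: (ltnP n d) => nd; rewrite ?pr0 ?if_same //.
  by case: eqP => // ?; lia.
by rewrite prK; case: eqP => ?; case: eqP => // ?; lia.
Qed.

Let sum_prw x N : x = \sum_(n < N) pr n x -> forall N', (N <= N')%N ->
  x = \sum_(n < N') pr n x.
Proof.
move=> eN N' NN'.
have pz n : (N <= n)%N -> pr n x = 0.
  move=> Nn; rewrite eN pr_sum big1 // => m _; rewrite prK; case: eqP => // e'.
  by have := ltn_ord m; lia.
rewrite {1}eN -(subnKC NN') big_split_ord /= [X in _ = _ + X]big1 ?addr0 // => n _.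
by apply: pz; exact: leq_addr.
Qed.

Let sum_sprw d x N : x = \sum_(n < N) pr n x -> forall N', (N + d <= N')%N ->
  x = \sum_(n < N') spr d n x.
Proof.
move=> eN N' NN'.
have -> : N' = (d + (N' - d))%N by lia.
rewrite big_split_ord /= big1 ?add0r => [|i _]; last by rewrite /spr /= ltn_ord.
rewrite [LHS](sum_prw eN (N' := N' - d)); last by lia.
by apply: eq_bigr => i _; rewrite /spr ltnNge leq_addr /= addKn.
Qed.

Let sum_spr d x : exists N, x = \sum_(n < N) spr d n x.
Proof.
have [N eN] := sum_pr x; exists (N + d)%N; exact: (sum_sprw eN (leqnn _)).
Qed.

Let sgr d n : set A := [set x | spr d n x = x].

Let sprM d m n x y : pr m x = x -> spr d n y = y -> spr d (m + n) (x * y) = x * y.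
Proof.
rewrite /spr; case: ltnP => nd px py; first by rewrite -py mulr0 pr0 if_same.
case: ltnP => mnd; first by lia.
by rewrite -addnBA //; exact: prM.
Qed.

Let graded_shift d : graded_module gr (sgr d : nat -> set Ao).
Proof.
split; first exact: (@graded_group_proj A (sgr d) (spr d) _ (@sprB d) (@sprK d) (@sum_spr d)).
by move=> m n a x /grE pa px; exact: sprM.
Qed.

Let Ao_phi : unit -> {linear Ao -> A^o} := fun=> idfun.

Let Ao_dual (x : Ao) : x = \sum_(j : unit) (Ao_phi j x : A) *: (1 : Ao).
Proof.
rewrite (bigD1 tt) //= big1 ?addr0; last by case.
exact: esym (mulr1 x).
Qed.

Let Ao_projective : projective_module Ao.
Proof. exact: dual_basis_projective Ao_dual. Qed.

Let Ao_generated d : generated_in_degree (sgr d : nat -> set Ao) d.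
Proof.
apply: (dual_basis_generated Ao_dual) => _.
by rewrite /sgr /= /spr ltnn subnn pr1.
Qed.

(** The middle term of the complex. As [w a] starts at [tgt a], only the part of its coefficient
    that ends at [tgt a] matters, whence one left ideal of a vertex for each arrow. *)
Let R1 : lmodType A := arrow_mod (fun a => e (tgt a)).

Let R1P (f : R1) a : f a * e (tgt a) = f a.
Proof. by case: f => f /= /forallP /(_ a)/eqP. Qed.

Let R1_make (f : J -> A) (Hf : forall a, f a * e (tgt a) = f a) : R1.
Proof.
exists [ffun a => f a : A^o].
by apply/forallP => a; rewrite ffunE; apply/eqP.
Defined.

Let R1_ext (f g : R1) : (forall a, f a = g a) -> f = g.
Proof. by move=> H; apply: val_inj; apply/ffunP => a; exact: H. Qed.

Let spr_e d n x i : spr d n (x * e i) = spr d n x * e i.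
Proof.
rewrite /spr; case: ifP; rewrite ?mul0r // => _.
by rewrite -(@pr_mulr 0 _ _ _ (pr_e i)) addn0.
Qed.

Let prR1 (n : nat) (f : R1) : R1.
Proof.
apply: (@R1_make (fun a => spr 1 n (f a))) => a.
by rewrite -spr_e R1P.
Defined.

Let grR1 n : set R1 := [set f | forall a, spr 1 n (f a) = f a].

Let R1_graded : graded_module gr grR1.
Proof.
have sumE N (F : 'I_N -> R1) a : (\sum_(n < N) F n : R1) a = \sum_(n < N) F n a.
  have -> : \val (\sum_(n < N) F n) = \sum_(n < N) \val (F n).
    by rewrite raddf_sum.
  by rewrite sum_ffunE.
split; last first.
  by move=> m n a x /grE pa px b; rewrite /= ffunE; exact: sprM.
apply: (@graded_group_proj R1 grR1 prR1).
- move=> n f; split=> [H|<- a]; last by rewrite /= !ffunE sprK eqxx.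
  by apply: R1_ext => a; rewrite /= ffunE H.
- by move=> n f g; apply: R1_ext => a; rewrite /= !ffunE sprB.
- move=> m n f; apply: R1_ext => a; rewrite /= !ffunE sprK.
  by case: ifP; rewrite /= !ffunE.
move=> f.
have [N HN] : exists N, forall a, f a = \sum_(n < N) pr n (f a).
  have [B HB] : {B : J -> nat & forall a, f a = \sum_(n < B a) pr n (f a)}.
    by apply: (@choice _ _ (fun a B => f a = \sum_(n < B) pr n (f a))) => a; exact: sum_pr.
  exists (\max_a B a) => a; apply: sum_prw (HB a) _ _.
  exact: leq_bigmax.
exists (N + 1)%N; apply: R1_ext => a; rewrite sumE.
rewrite [LHS](sum_sprw (d := 1) (HN a) (leqnn _)).
by apply: eq_bigr => n _; rewrite /= ffunE.
Qed.

Let delta (a : J) : R1.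
Proof.
apply: (@R1_make (fun b => if b == a then e (tgt a) else 0)) => b.
by case: eqP => [->|_]; rewrite ?eM ?eqxx ?mul0r.
Defined.

Let ev_lin a : linear (fun f : R1 => f a : A^o).
Proof. by move=> c f g; rewrite /= !ffunE. Qed.

Let evR1 a : {linear R1 -> Ao} :=
  HB.pack_for {linear R1 -> Ao} (fun f : R1 => f a : A^o)
    (GRing.isLinear.Build _ _ _ _ _ (ev_lin a)).

Let evR1P (f : R1) : f = \sum_a (evR1 a f : A) *: delta a.
Proof.
apply: R1_ext => a.
have -> : \val (\sum_a (evR1 a f : A) *: delta a) = \sum_a \val ((evR1 a f : A) *: delta a).
  by rewrite raddf_sum.
rewrite sum_ffunE (bigD1 a) //= big1 ?addr0 => [|b ba].
  by rewrite !ffunE eqxx /= [RHS]R1P.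
by rewrite !ffunE eq_sym (negbTE ba) scaler0.
Qed.

Let R1_projective : projective_module R1.
Proof. exact: dual_basis_projective evR1P. Qed.

Let R1_generated : generated_in_degree grR1 1.
Proof.
apply: (dual_basis_generated evR1P) => a b; rewrite /spr ltnn subnn /= ffunE.
by case: ifP => _; [exact: pr_e | exact: pr0].
Qed.

Let Z : lmodType A := {ffun void -> A^o}.

Let Z_eq (x y : Z) : x = y. Proof. by apply/ffunP; case. Qed.

Let Z_phi : void -> {linear Z -> Ao} := fun a => match a with end.

Let Z_dual (x : Z) : x = \sum_(j : void) (Z_phi j x : A) *: (0 : Z).
Proof. exact: Z_eq. Qed.

Let Z_graded : graded_module gr (fun=> setT : set Z).
Proof.
split=> //; split=> // x; exists 0%N, (fun=> 0) => //; exact: Z_eq.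
Qed.

Let d0_fun (f : R1) : Ao := \sum_a f a * w a.
Let d0_lin : linear d0_fun.
Proof.
move=> c f g; rewrite /d0_fun scaler_sumr -big_split; apply: eq_bigr => a _ /=.
by rewrite !ffunE mulrDl; congr (_ + _); exact: esym (mulrA _ _ _).
Qed.
Let d0 : {linear R1 -> Ao} :=
  HB.pack_for {linear R1 -> Ao} d0_fun (GRing.isLinear.Build _ _ _ _ _ d0_lin).

Let d1_fun (x : Ao) : R1.
Proof.
by apply: (@R1_make (fun a => (x : A) * v a)) => a; rewrite -mulrA ve.
Defined.
Let d1_lin : linear d1_fun.
Proof.
move=> c x y; apply: R1_ext => a; rewrite /= !ffunE mulrDl.
by congr (_ + _); exact: esym (mulrA _ _ _).
Qed.
Let d1 : {linear Ao -> R1} :=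
  HB.pack_for {linear Ao -> R1} d1_fun (GRing.isLinear.Build _ _ _ _ _ d1_lin).

Let zero_lin (M N : lmodType A) : linear (fun _ : M => 0 : N).
Proof. by move=> c x y; rewrite scaler0 addr0. Qed.
Let zero_map (M N : lmodType A) : {linear M -> N} :=
  HB.pack_for {linear M -> N} (fun _ : M => 0 : N)
    (GRing.isLinear.Build _ _ _ _ _ (@zero_lin M N)).

(** The ring acts on functions on the vertices through the characters [co i], which kill positive
    degrees; this realises the quotient by the positive part. *)
Let K0_scale (a : A) (f : {ffun I -> k}) : {ffun I -> k} := [ffun i => co i a * f i].
Let K0_scaleA a b f : K0_scale a (K0_scale b f) = K0_scale (a * b) f.
Proof. by apply/ffunP => i; rewrite !ffunE coM mulrA. Qed.
Let K0_scale1 f : K0_scale 1 f = f.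
Proof. by apply/ffunP => i; rewrite ffunE co1 mul1r. Qed.
Let K0_scaleDr a f g : K0_scale a (f + g) = K0_scale a f + K0_scale a g.
Proof. by apply/ffunP => i; rewrite !ffunE mulrDr. Qed.
Let K0_scaleDl f a b : K0_scale (a + b) f = K0_scale a f + K0_scale b f.
Proof. by apply/ffunP => i; rewrite !ffunE coD mulrDl. Qed.
Let K0 : lmodType A := HB.pack_for (lmodType A) {ffun I -> k}
  (GRing.Zmodule_isLmodule.Build A {ffun I -> k} K0_scaleA K0_scale1 K0_scaleDr K0_scaleDl).

Let aug_fun (x : Ao) : K0 := [ffun i => co i x].
Let aug_lin : linear aug_fun.
Proof. by move=> c x y; apply/ffunP => i; rewrite !ffunE coD coM. Qed.
Let aug : {linear Ao -> K0} :=
  HB.pack_for {linear Ao -> K0} aug_fun (GRing.isLinear.Build _ _ _ _ _ aug_lin).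

Let aug_ker (x : A) : aug x = 0 <-> positive_part gr x.
Proof.
split=> [/ffunP x0|[N [y Hy ->]]]; last first.
  apply/ffunP => i; rewrite !ffunE co_sum big1 // => n _; apply: co_pos.
  exact/grE/Hy.
have [N eN] := sum_pr x; have eN1 := sum_prw eN (leqnSn N).
exists N, (fun n => pr n.+1 x) => [n|]; first by apply/grE; rewrite prK eqxx.
rewrite [LHS]eN1 big_ord_recl /= (_ : pr 0 x = 0) ?add0r //.
apply: co_inj; first by rewrite prK eqxx.
move=> i; have := x0 i; rewrite !ffunE {1}eN1 co_sum big_ord_recl big1 ?addr0 // => n _.
by apply: (@co_pos _ n); rewrite prK eqxx.
Qed.

Let aug_sur z : exists x, aug x = z.
Proof.
by have [x Hx] := co_sur z; exists x; apply/ffunP => i; rewrite ffunE.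
Qed.

Let exact0 (x : Ao) : aug x = 0 <-> exists y, d0 y = x.
Proof.
rewrite aug_ker; split=> [[N [y Hy ->]]|[f <-]].
  have [t Ht] : {t : nat -> R1 & forall n, d0 (t n) = y n}.
    apply: (@choice _ _ (fun n f => d0 f = y n)) => n.
    have [z _ yE] := gen_w ((grE _ _).1 (Hy n)).
    have [f Hf] : exists f : R1, forall a, f a = z a * e (tgt a).
      have h a : z a * e (tgt a) * e (tgt a) = z a * e (tgt a) by rewrite -mulrA eM eqxx.
      by exists (R1_make h) => a; rewrite /= ffunE.
    exists f; rewrite /= /d0_fun yE; apply: eq_bigr => a _.
    by rewrite Hf -mulrA ew.
  by exists (\sum_(n < N) t n); rewrite linear_sum; apply: eq_bigr => n _.
apply/aug_ker/ffunP => i; rewrite !ffunE /= /d0_fun co_sum big1 // => a _.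
by rewrite coM (@co_pos i 0 (w a)) ?mulr0.
Qed.

Let exact1 (f : R1) : d0 f = 0 <-> exists x, d1 x = f.
Proof.
split=> [f0|[x <-]].
  have [x Hx] := syzygy_w (R1P f) f0.
  by exists x; apply: R1_ext => a; rewrite /= ffunE Hx.
rewrite /= /d0_fun; under eq_bigr do rewrite ffunE -mulrA.
by rewrite -mulr_sumr rel_vw mulr0.
Qed.

Let res (i : nat) : lmodType A :=
  match i with 0 => Ao | 1 => R1 | 2 => Ao | _ => Z end.

Let grr (i : nat) : nat -> set (res i) :=
  match i return nat -> set (res i) with
  | 0 => sgr 0 | 1 => grR1 | 2 => sgr 2 | _ => fun=> setT end.

Let dr (i : nat) : {linear res i.+1 -> res i} :=
  match i return {linear res i.+1 -> res i} with
  | 0 => d0 | 1 => d1 | 2 => zero_map Z Ao | i'.+3 => zero_map Z Z end.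

Lemma koszul_linear_resolution : has_linear_resolution gr.
Proof.
have spr0 n x : spr 0 n x = pr n x by rewrite /spr ltn0 subn0.
exists K0, aug, res, grr, dr, aug; split.
- by split; [exact: aug_sur | exact: aug_ker].
- case=> [|[|[|i]]] /=.
  + by split; [exact: graded_shift | exact: Ao_projective | exact: Ao_generated].
  + by split; [exact: R1_graded | exact: R1_projective | exact: R1_generated].
  + by split; [exact: graded_shift | exact: Ao_projective | exact: Ao_generated].
  split; [exact: Z_graded | exact: dual_basis_projective Z_dual |].
  exact: (dual_basis_generated Z_dual).
- split; last first.
    move=> n x; rewrite /= /sgr /= spr0 => px; apply/ffunP => i.
    by rewrite !ffunE; exact: co_pos px.
  case=> [|[|[|i]]] n x //=.
  + move=> Hx; rewrite /sgr /= spr0 /d0_fun pr_sum; apply: eq_bigr => a _.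
    have := Hx a; rewrite /spr; case: n Hx => [|n] Hx /=.
      by move=> <-; rewrite mul0r pr0.
    by rewrite subn1 /= => pf; rewrite -addn1 prM.
  + rewrite /sgr /= {1}/spr; case: ifP => n2 px a; rewrite /= ffunE.
      by rewrite -px mul0r /spr pr0 if_same.
    have n1 : (n < 1)%N = false by lia.
    rewrite /spr n1; have -> : (n - 1 = (n - 2) + 1)%N by lia.
    exact: prM.
  + by move=> _; rewrite /sgr /= /spr pr0 if_same.
- by split; [exact: aug_sur | exact: exact0].
case=> [|[|[|i]]] x /=.
- exact: exact1.
(* Injectivity at the left end of the complex: the kernel of [d1] is the socle. *)
- split=> [x0|[y <-]].
    exists (0 : Z); apply/esym/socle0 => a.
    by have := congr1 (fun f : R1 => f a) x0; rewrite /= !ffunE.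
  exact: (linear0 d1).
- by split=> // _; exists (0 : Z); exact: Z_eq.
- by split=> // _; exists (0 : Z); exact: Z_eq.
Qed.

Theorem koszul_of_complex : koszul gr.
Proof.
split; [exact: koszul_graded_ring | exact: koszul_semisimple0 |].
exact: koszul_linear_resolution.
Qed.

End KoszulComplex.

(** * Path algebras and quadratic ideals *)

Local Notation pcomp := Defs.pcomp.

HB.lock Definition linext (k : fieldType) (Q : quiver) (W : lmodType k)
    (g : qpath Q -> W) (x : pathalg k Q) : W :=
  \sum_(p <- msupp x) mcoeff p x *: g p.

HB.lock Definition vtx_coef (k : fieldType) (Q : quiver) (i : qvtx Q)
  (x : pathalg k Q) : k := mcoeff (ptriv i) x.

Section PathAlgebraBasis.
Variables (k : fieldType) (Q : quiver).
Local Notation T := (pathalg k Q).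
Local Notation pb := (@pbasis k Q).

Lemma pathalg_ind (P : T -> Prop) : P 0 ->
  (forall x y, P x -> P y -> P (x + y)) -> (forall a x, P x -> P (a *: x)) ->
  (forall p, P (pb p)) -> forall x, P x.
Proof.
move=> P0 PD PZ Pb x; rewrite (pathalgE x).
by apply: big_ind => // p _; apply: PZ.
Qed.

Section LinearExtension.
Variables (W : lmodType k) (g : qpath Q -> W).

Lemma linextw (d : {fset qpath Q}) (x : T) : (msupp x `<=` d)%fset ->
  linext g x = \sum_(p <- d) mcoeff p x *: g p.
Proof.
move=> s; rewrite linext.unlock (big_fset_incl _ s) //= => p _ /mcoeff_outdom ->.
by rewrite scale0r.
Qed.

Lemma linext_linear : linear (linext g).
Proof.
move=> a x y.
have sx : (msupp x `<=` msupp x `|` msupp y)%fset by exact: fsubsetUl.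
have sy : (msupp y `<=` msupp x `|` msupp y)%fset by exact: fsubsetUr.
have sxy : (msupp (a *: x + y)%R `<=` msupp x `|` msupp y)%fset.
  by apply: fsubset_trans (msuppD_le _ _) _; apply: fsetSU; exact: msuppZ_le.
rewrite (linextw sx) (linextw sy) (linextw sxy) scaler_sumr -big_split.
by apply: eq_bigr => p _ /=; rewrite mcoeffD mcoeffZ scalerDl scalerA.
Qed.

HB.instance Definition _ := GRing.isLinear.Build k T W _ (linext g) linext_linear.

Lemma linext_basis p : linext g (pb p) = g p.
Proof.
rewrite pbasis.unlock (linextw (msuppU_le (k := p) (x := 1))) big_seq_fset1.
by rewrite mcoeffUU scale1r.
Qed.

End LinearExtension.

Definition vtx (i : qvtx Q) : T := pb (ptriv i).
Definition arw (b : qarr Q) : T := pb (parr b).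

Lemma pbasisM p q : pb p * pb q = oapp pb 0 (pcomp p q).
Proof. by rewrite -[LHS]/(pathalg_mul _ _) pathalg_mulUU pprod.unlock. Qed.

Lemma vtx_mul i p : vtx i * pb p = if i == pstart p then pb p else 0.
Proof. by rewrite pbasisM pcomp_triv_l; case: ifP. Qed.

Lemma mul_vtx i p : pb p * vtx i = if pend p == i then pb p else 0.
Proof. by rewrite pbasisM pcomp_triv_r; case: ifP. Qed.

Lemma vtxM i j : vtx i * vtx j = if i == j then vtx i else 0.
Proof. by rewrite vtx_mul; case: eqP => //= ->. Qed.

Lemma sum_vtx : \sum_i vtx i = 1 :> T.
Proof. by []. Qed.

Lemma vtx_arw i b : vtx i * arw b = if i == qsrc b then arw b else 0.
Proof. exact: vtx_mul. Qed.

Lemma arw_vtx i b : arw b * vtx i = if qtgt b == i then arw b else 0.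
Proof. exact: mul_vtx. Qed.

Lemma pcomp_some (p q : qpath Q) : pend p = pstart q ->
  exists2 u, pcomp p q = Some u & val u = ((val p).1, (val p).2 ++ (val q).2).
Proof.
move=> e; have := pcomp_val e; case: (pcomp p q) => // u [<-].
by exists u.
Qed.

Lemma path_last (p : qpath Q) : p = ptriv (pstart p) \/
  exists p' b, [/\ pend p' = qsrc b, pcomp p' (parr b) = Some p & plen p = (plen p').+1].
Proof.
case: p => -[i s]; case/lastP: s => [|s b] c.
  by left; apply: val_inj.
right; have [c' e] : chain i s /\ qsrc b = last i (map (@qtgt Q) s).
  have : chain i (rcons s b) by exact: c.
  by rewrite -cats1 chain_cat /= andbT => /andP[? /eqP].
exists (@QPath Q (i, s) c'), b; split=> //; last by rewrite /plen /= size_rcons.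
have [|u -> eu] := @pcomp_some (@QPath Q (i, s) c') (parr b).
  by rewrite /pend /pstart /= -e.
by congr Some; apply: val_inj; rewrite eu /= cats1.
Qed.

Lemma plen_pcomp (p q u : qpath Q) : pcomp p q = Some u -> plen u = (plen p + plen q)%N.
Proof.
rewrite /pcomp; case: eqP => // e; case: insubP => // v _ ev [<-].
by rewrite /plen ev size_cat.
Qed.

Definition degproj (n : nat) : T -> T :=
  linext (fun p => if plen p == n then pb p else 0).
HB.instance Definition _ n :=
  GRing.isLinear.Build k T T _ (degproj n) (linext_linear _).

Lemma degproj0 n : degproj n 0 = 0.
Proof. exact: (linear0 (degproj n)). Qed.
Lemma degprojD n x y : degproj n (x + y) = degproj n x + degproj n y.
Proof. exact: (linearD (degproj n)). Qed.
Lemma degprojZ n a x : degproj n (a *: x) = a *: degproj n x.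
Proof. by rewrite linearZ. Qed.

Lemma degproj_basis n p : degproj n (pb p) = if plen p == n then pb p else 0.
Proof. exact: linext_basis. Qed.

Lemma degprojK m n x : degproj m (degproj n x) = if m == n then degproj n x else 0.
Proof.
move: x; apply: pathalg_ind => [|x y ex ey|a x ex|p].
- by rewrite !degproj0; case: ifP.
- by rewrite !degprojD ex ey; case: ifP => // _; exact: addr0.
- by rewrite !degprojZ ex; case: ifP; rewrite ?scaler0.
rewrite degproj_basis; case: eqP => [e|ne].
  by rewrite degproj_basis e eq_sym.
by rewrite degproj0; case: ifP.
Qed.

Lemma sum_degproj x : exists N, x = \sum_(n < N) degproj n x.
Proof.
have [N HN] : exists N, forall p, p \in msupp x -> (plen p < N)%N.
  exists (\max_(p <- msupp x) plen p).+1 => p px; rewrite ltnS.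
  exact: leq_bigmax_seq.
exists N; rewrite {1}(pathalgE x).
transitivity (\sum_(n < N) \sum_(p <- msupp x) mcoeff p x *: degproj n (pb p)).
  rewrite exchange_big /= big_seq [RHS]big_seq; apply: eq_bigr => p px.
  rewrite (bigD1 (Ordinal (HN p px))) //= degproj_basis eqxx.
  rewrite big1 ?addr0 // => i ne; rewrite degproj_basis.
  case: eqP => [e|]; last by rewrite scaler0.
  by case/eqP: ne; apply: val_inj; rewrite /= e.
apply: eq_bigr => n _; rewrite [in RHS](pathalgE x) linear_sum /=.
by apply: eq_bigr => p _; rewrite linearZ.
Qed.

Lemma pathalg_degE n x : pathalg_deg n x <-> degproj n x = x.
Proof.
split=> [H|<- p].
  rewrite [x in LHS](pathalgE x) [RHS](pathalgE x) linear_sum big_seq [RHS]big_seq.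
  by apply: eq_bigr => p /H e; rewrite linearZ /= degproj_basis e eqxx.
rewrite -mcoeff_neq0 /degproj linext.unlock raddf_sum /= => H; apply: contrapT => ne.
case/eqP: H; rewrite big1 // => q _; rewrite mcoeffZ.
case: eqP => [eq|_]; last by rewrite mcoeff0 mulr0.
rewrite pbasis.unlock mcoeffU; case: eqP => [e|]; last by rewrite mulr0.
by case: ne; rewrite -e.
Qed.

Lemma pathalg_deg_basis p : pathalg_deg (plen p) (pb p).
Proof. by apply/pathalg_degE; rewrite degproj_basis eqxx. Qed.

Lemma pathalg_deg_ind n (P : T -> Prop) : P 0 ->
  (forall x y, P x -> P y -> P (x + y)) -> (forall a x, P x -> P (a *: x)) ->
  (forall p, plen p = n -> P (pb p)) -> forall x, pathalg_deg n x -> P x.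
Proof.
move=> P0 PD PZ Pb x Hx; rewrite (pathalgE x) big_seq.
by apply: big_ind => // p px; apply: PZ; apply: Pb; exact: Hx.
Qed.

Lemma pathalg_degM m n (x y : T) : pathalg_deg m x -> pathalg_deg n y ->
  pathalg_deg (m + n) (x * y).
Proof.
move=> Hx Hy; apply/pathalg_degE.
move: x Hx; apply: pathalg_deg_ind => [|x z ex ez|a x ex|p ep].
- by rewrite mul0r degproj0.
- by rewrite mulrDl degprojD ex ez.
- by rewrite -pathalg_scaleAl degprojZ ex.
move: y Hy; apply: pathalg_deg_ind => [|x z ex ez|a x ex|q eq].
- by rewrite mulr0 degproj0.
- by rewrite mulrDr degprojD ex ez.
- by rewrite -pathalg_scaleAr degprojZ ex.
rewrite pbasisM; case e: (pcomp p q) => [u|] /=; last by rewrite degproj0.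
by rewrite degproj_basis (plen_pcomp e) ep eq eqxx.
Qed.

(* Removal of a final arrow [b]; paths not ending with [b] are sent to [None]. *)
Definition pdel (b : qarr Q) (p : qpath Q) : option (qpath Q) :=
  if (pword p).2 is a :: s then
    if last a s == b then insub ((pword p).1, belast a s) else None
  else None.

Definition rdel (b : qarr Q) : T -> T :=
  linext (fun p => oapp pb 0 (pdel b p)).
HB.instance Definition _ b :=
  GRing.isLinear.Build k T T _ (rdel b) (linext_linear _).

Lemma pdel_comp b c (p u : qpath Q) : pcomp p (parr c) = Some u ->
  pdel b u = if c == b then Some p else None.
Proof.
rewrite /pcomp; case: eqP => // e; case: insubP => // v _ ev [<-].
rewrite /pdel ev /=; case: p e ev => -[i [|a s]] /= ch e ev.
  by case: ifP => // _; case: insubP => [w _ ew|/negP[]//]; congr Some; apply: val_inj.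
rewrite last_cat /=; case: ifP => // _; rewrite cats1 belast_rcons.
by case: insubP => [w _ ew|/negP[]//]; congr Some; apply: val_inj.
Qed.

Lemma rdel0 b : rdel b 0 = 0.
Proof. exact: (linear0 (rdel b)). Qed.
Lemma rdelD b x y : rdel b (x + y) = rdel b x + rdel b y.
Proof. exact: (linearD (rdel b)). Qed.
Lemma rdelZ b a x : rdel b (a *: x) = a *: rdel b x.
Proof. by rewrite linearZ. Qed.

(** The vertex factor remains because multiplying by [arw c] kills the paths of [x] that do not end
    at the source of [c]. *)
Lemma rdel_mul b c x : rdel b (x * arw c) = if c == b then x * vtx (qsrc c) else 0.
Proof.
move: x; apply: pathalg_ind => [|x z ex ez|a x ex|p].
- by rewrite !mul0r rdel0; case: ifP.
- by rewrite !mulrDl rdelD ex ez; case: ifP => // _; exact: addr0.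
- by rewrite -!pathalg_scaleAl rdelZ ex; case: ifP; rewrite ?scaler0.
rewrite pbasisM mul_vtx; case: (pend p =P qsrc c) => [e|ne].
  have [u eu _] := @pcomp_some p (parr c) e.
  by rewrite eu /= /rdel linext_basis (pdel_comp b eu); case: ifP.
have -> : pcomp p (parr c) = None by rewrite /pcomp; case: eqP.
by rewrite rdel0; case: ifP.
Qed.

Lemma pathalg_right_ind (P : T -> Prop) : P 0 ->
  (forall x y, P x -> P y -> P (x + y)) -> (forall a x, P x -> P (a *: x)) ->
  (forall i, P (vtx i)) -> (forall x b, P (x * arw b)) -> forall x, P x.
Proof.
move=> P0 PD PZ Pv Pa; apply: pathalg_ind => // p.
case: (path_last p) => [->|[p' [b [_ e _]]]]; first exact: Pv.
by have := Pa (pb p') b; rewrite pbasisM e.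
Qed.

Local Notation vtx_coef := (@vtx_coef k Q).

Lemma vtx_coef_linear i : linear (vtx_coef i : T -> k^o).
Proof. by move=> a x y; rewrite vtx_coef.unlock mcoeffD mcoeffZ. Qed.

HB.instance Definition _ i :=
  GRing.isLinear.Build k T k^o _ (vtx_coef i) (vtx_coef_linear i).

Lemma vtx_coef0 i : vtx_coef i 0 = 0.
Proof. exact: (linear0 (vtx_coef i)). Qed.
Lemma vtx_coefD i x y : vtx_coef i (x + y) = vtx_coef i x + vtx_coef i y.
Proof. exact: (linearD (vtx_coef i)). Qed.
Lemma vtx_coefZ i a x : vtx_coef i (a *: x) = a * vtx_coef i x.
Proof. by rewrite linearZ. Qed.

Lemma vtx_coef_basis i p : vtx_coef i (pb p) = (p == ptriv i)%:R.
Proof. by rewrite vtx_coef.unlock pbasis.unlock mcoeffU. Qed.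

(** A trivial path factors only as itself times itself, so this coefficient is a character. *)
Lemma vtx_coefM i x y : vtx_coef i (x * y) = vtx_coef i x * vtx_coef i y.
Proof.
move: x; apply: pathalg_ind => [|x z ex ez|a x ex|p].
- by rewrite mul0r !vtx_coef0 mul0r.
- by rewrite mulrDl !vtx_coefD ex ez mulrDl.
- apply: etrans (congr1 (vtx_coef i) (esym (pathalg_scaleAl a x y))) _.
  apply: etrans (vtx_coefZ i a _) _; rewrite ex mulrA; congr (_ * _).
  exact/esym/vtx_coefZ.
move: y; apply: pathalg_ind => [|x z ex ez|a x ex|q].
- by rewrite mulr0 !vtx_coef0 mulr0.
- by rewrite mulrDr !vtx_coefD ex ez mulrDr.
- apply: etrans (congr1 (vtx_coef i) (esym (pathalg_scaleAr a _ x))) _.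
  apply: etrans (vtx_coefZ i a _) _; rewrite ex mulrCA; congr (_ * _).
  exact/esym/vtx_coefZ.
rewrite pbasisM !vtx_coef_basis -natrM mulnb.
have triv u j : plen u = 0%N -> (u == ptriv j) = (pstart u == j).
  case: u => -[i' [|//]] ? _; apply/eqP/eqP => [->//|/= <-]; exact: val_inj.
case e: (pcomp p q) => [u|] /=.
  have lu := plen_pcomp e; rewrite vtx_coef_basis; congr ((nat_of_bool _)%:R).
  apply/eqP/andP => [eu|[/eqP ep /eqP eq]].
    have : (plen p + plen q = 0)%N by rewrite -lu eu.
    move/eqP; rewrite addn_eq0 => /andP[/eqP p0 /eqP q0].
    move: e; rewrite /pcomp; case: eqP => // e1; case: insubP => // v _ ev [evu].
    have ps : pstart p = i by rewrite /pstart -[i]/(pstart (ptriv i)) -eu -evu /pstart ev.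
    rewrite !triv // -e1 ps; split=> //.
    by rewrite /pend (size0nil p0) /= -/(pstart p) ps.
  by move: e; rewrite ep eq pcomp_triv_l eqxx => -[<-].
rewrite vtx_coef0; case: eqP => [ep|_]; last by [].
by case: eqP => [eq|//]; move: e; rewrite ep eq pcomp_triv_l eqxx.
Qed.

End PathAlgebraBasis.

Section QuadraticIdeal.
Variables (k : fieldType) (Q : quiver) (G : set (pathalg k Q)).
Hypothesis G2 : forall g, G g -> pathalg_deg 2 g.
Local Notation T := (pathalg k Q).
Local Notation pb := (@pbasis k Q).
Local Notation B := (bqalg G).

Lemma ideal_gen_sum J (r : seq J) (F : J -> T) :
  (forall j, ideal_gen G (F j)) -> ideal_gen G (\sum_(j <- r) F j).
Proof. by move=> H; apply: big_ind => //; [exact: ideal_gen0|exact: ideal_genD]. Qed.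

Lemma ideal_gen_mem g : G g -> ideal_gen G g.
Proof.
move=> Gg; exists [:: (1, g, 1)]; first by move=> t; rewrite inE => /eqP ->.
by rewrite big_seq1 mul1r mulr1.
Qed.

Lemma ideal_gen_ind (P : T -> Prop) : P 0 ->
  (forall x y, P x -> P y -> P (x + y)) -> (forall a x, P x -> P (a *: x)) ->
  (forall p g q, G g -> P (pb p * g * pb q)) -> forall x, ideal_gen G x -> P x.
Proof.
move=> P0 PD PZ PG x [s sG ->]; rewrite big_seq; apply: big_ind => // -[[x1 g] y] /sG /= Gg.
move: x1; apply: pathalg_ind => [|x1 z ex ez|a x1 ex|p].
- by rewrite !mul0r.
- by rewrite !mulrDl; exact: PD.
- by rewrite -!pathalg_scaleAl; exact: PZ.
move: y; apply: pathalg_ind => [|y z ey ez|a y ey|q].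
- by rewrite mulr0.
- by rewrite mulrDr; exact: PD.
- by rewrite -pathalg_scaleAr; exact: PZ.
exact: PG.
Qed.

(** The ideal is homogeneous because its generators are; hence the grading by length descends to the
    quotient. *)
Lemma ideal_degproj n x : ideal_gen G x -> ideal_gen G (degproj n x).
Proof.
move: x; apply: ideal_gen_ind => [|x y ex ey|a x ex|p g q Gg].
- by rewrite degproj0; exact: ideal_gen0.
- by rewrite degprojD; exact: ideal_genD.
- by rewrite degprojZ; exact: ideal_genZ.
have /pathalg_degE e := pathalg_degM (pathalg_degM (@pathalg_deg_basis k Q p) (G2 Gg))
  (@pathalg_deg_basis k Q q).
rewrite -e degprojK; case: ifP => _; last exact: ideal_gen0.
by rewrite e; apply: ideal_genMr; apply: ideal_genMl; exact: ideal_gen_mem.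
Qed.

Lemma ideal_vtx_coef i x : ideal_gen G x -> vtx_coef i x = 0.
Proof.
move: x; apply: ideal_gen_ind => [|x y ex ey|a x ex|p g q Gg].
- by rewrite vtx_coef0.
- by rewrite vtx_coefD ex ey addr0.
- by rewrite vtx_coefZ ex mulr0.
have g0 : vtx_coef i g = 0.
  rewrite vtx_coef.unlock; apply/mcoeff_outdom/negP => /(G2 Gg).
  by [].
by rewrite !vtx_coefM g0 mulr0 mul0r.
Qed.

Definition bqproj (n : nat) (x : B) : B := bqpi G (degproj n (repr x)).

Lemma bqprojE n x : bqproj n (bqpi G x) = bqpi G (degproj n x).
Proof.
by apply/bqpiP; rewrite -linearB; apply: ideal_degproj; exact: repr_bqpi.
Qed.

Lemma bqproj_linear n : linear (bqproj n).
Proof.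
move=> a; elim/bqpi_ind => x; elim/bqpi_ind => y.
have H u v : bqpi G (a *: u + v) = a *: bqpi G u + bqpi G v.
  by rewrite bqpiD bqpiZ.
have -> : bqproj n (a *: bqpi G x + bqpi G y) = bqproj n (bqpi G (a *: x + y)).
  by congr (bqproj n _); exact: esym (H _ _).
by rewrite bqprojE degprojD degprojZ H !bqprojE.
Qed.

Definition bqcoef (i : qvtx Q) (x : B) : k := vtx_coef i (repr x).

Lemma bqcoefE i x : bqcoef i (bqpi G x) = vtx_coef i x.
Proof.
apply/eqP; rewrite -subr_eq0 -linearB; apply/eqP; apply: ideal_vtx_coef.
exact: repr_bqpi.
Qed.

Lemma bqalg_degE n x : bqalg_deg n x <-> bqproj n x = x.
Proof.
split=> [[y /pathalg_degE e <-]|<-]; first by rewrite bqprojE e.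
by exists (degproj n (repr x)) => //; apply/pathalg_degE; rewrite degprojK eqxx.
Qed.

Lemma bqprojK m n x : bqproj m (bqproj n x) = if m == n then bqproj n x else 0.
Proof.
elim/bqpi_ind: x => x; rewrite !bqprojE degprojK; by case: ifP.
Qed.

Lemma bqpi_sum J (r : seq J) (F : J -> T) :
  bqpi G (\sum_(j <- r) F j) = \sum_(j <- r) bqpi G (F j).
Proof. by apply: (big_morph _ (@bqpiD _ _ G)). Qed.

Lemma sum_bqproj x : exists N, x = \sum_(n < N) bqproj n x.
Proof.
elim/bqpi_ind: x => x; have [N e] := sum_degproj x; exists N.
by rewrite {1}e bqpi_sum; apply: eq_bigr => n _; rewrite bqprojE.
Qed.

Lemma bqalg_degM m n (x y : B) : bqalg_deg m x -> bqalg_deg n y ->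
  bqalg_deg (m + n) (x * y).
Proof.
move=> [u Hu <-] [v Hv <-]; exists (u * v); first exact: pathalg_degM.
exact: bqpiM.
Qed.

End QuadraticIdeal.

(** * Dual arrows of a modulated graph *)

Section Families.
Variables (k : fieldType) (W : lmodType k) (J : finType).

Lemma sum_scaler (F : J -> W) (c : J -> k) z :
  (forall b, F b = c b *: z) -> \sum_b F b = (\sum_b c b) *: z.
Proof. by move=> H; rewrite scaler_suml; apply: eq_bigr => b _; exact: H. Qed.

Lemma dual_family_inv (u w : J -> W) (C D : J -> J -> k) :
  (forall a, w a = \sum_b C a b *: u b) ->
  (forall b b', \sum_a D b a * C a b' = (b == b')%:R) ->
  forall b, u b = \sum_a D b a *: w a.
Proof.
move=> HC HD b.
have e b' : \sum_a (D b a * C a b') *: u b' = (b == b')%:R *: u b'.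
  by rewrite -HD; exact: sum_scaler.
transitivity (\sum_a \sum_b' (D b a * C a b') *: u b').
  rewrite exchange_big /=; under eq_bigr do rewrite e.
  rewrite (bigD1 b) //= big1 => [|b' ne]; first by rewrite eqxx scale1r addr0.
  by rewrite eq_sym (negbTE ne) scale0r.
apply: eq_bigr => a _; rewrite HC scaler_sumr.
by apply: eq_bigr => b' _; rewrite scalerA.
Qed.

End Families.

Section DualArrows.
Variables (k : fieldType) (Ga : modulated_graph k).
Local Notation I := (mgvtx Ga).
Local Notation V := (@mgspace k Ga).
Local Notation E := (@mgform k Ga).
Local Notation Q := (mgquiver Ga).
Local Notation J := (qarr Q).
Local Notation T := (pathalg k Q).
Local Notation arw := (@arw k Q).
Local Notation vtx := (@vtx k Q).

(** For an arrow [a] from i to j the dual vector lies in [V j i], so [dual_arw a] runs from the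
    target of [a] back to its source. *)
Definition dual_arw (a : J) : T := @mginj k Ga _ _ (mgdual (tagged a)).

Definition arw_coef (b : J) (x : T) : k := mcoeff (parr b) x.

Lemma arw_coef_lincomb n (c : 'I_n -> k) (F : 'I_n -> T) b :
  arw_coef b (\sum_x c x *: F x) = \sum_x c x * arw_coef b (F x).
Proof.
rewrite /arw_coef raddf_sum; apply: eq_bigr => x _ /=; exact: mcoeffZ.
Qed.

Lemma arw_coef_sum n (c : 'I_n -> k) (F : 'I_n -> J) b :
  arw_coef b (\sum_x c x *: arw (F x)) = \sum_(x | F x == b) c x.
Proof.
rewrite arw_coef_lincomb [RHS]big_mkcond; apply: eq_bigr => x _ /=.
rewrite /arw_coef /arw pbasis.unlock mcoeffU.
have -> : (parr (F x) == parr b) = (F x == b).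
  by apply/eqP/eqP => [[_ ->]|->].
by case: eqP => _; rewrite ?mulr1 ?mulr0.
Qed.

Lemma mgarrow_inj i j : injective (@mgarrow k Ga i j).
Proof. by move=> x y /eqP; rewrite eq_Tagged => /eqP. Qed.

Lemma arw_coef_mginj i j (v : V i j) (a : 'I_(mgadj i j)) :
  arw_coef (mgarrow a) (mginj v) = coord (vbasis {:V i j}) a v.
Proof.
rewrite /mginj arw_coef_sum (big_pred1 a) // => x.
exact: (inj_eq (@mgarrow_inj i j)).
Qed.

Lemma arw_coef_mginj_supp i j (v : V i j) (b : J) : tag b != (i, j) ->
  arw_coef b (mginj v) = 0.
Proof.
move=> ne; rewrite /mginj arw_coef_sum big1 // => x /eqP e.
by case/eqP: ne; rewrite -e.
Qed.

Lemma mginj_sum_arw i j (v : V i j) :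
  mginj v = \sum_b arw_coef b (mginj v) *: arw b.
Proof.
have := sig_big_dep (op := +%R) (idx := 0) (pred1 (i, j)) (fun _ => xpredT)
  (fun ij (x : 'I_(mgadj ij.1 ij.2)) =>
     arw_coef (mgarrow x) (mginj v) *: arw (mgarrow x)).
rewrite big_pred1_eq => e; rewrite {1}/mginj.
transitivity (\sum_(x < mgadj i j) arw_coef (mgarrow x) (mginj v) *: arw (mgarrow x)).
  by apply: eq_bigr => x _; rewrite arw_coef_mginj.
rewrite [LHS]e [RHS](bigID (fun b : J => tag b == (i, j))) /=.
rewrite [X in _ = _ + X]big1 => [|b ne]; last by rewrite arw_coef_mginj_supp // scale0r.
apply: etrans (esym (addr0 _)); apply: eq_big => [[[i' j'] x]|[[i' j'] x] _] //=.
by rewrite andbT.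
Qed.

Lemma mginj_inj i j (v : V i j) : (forall b, arw_coef b (mginj v) = 0) -> v = 0.
Proof.
move=> H; rewrite (coord_vbasis (memvf v)) big1 // => a _.
by rewrite -arw_coef_mginj H scale0r.
Qed.

Lemma mginj_basis i j (a : 'I_(mgadj i j)) :
  mginj (vbasis {:V i j})`_a = arw (mgarrow a).
Proof.
have fr : free (vbasis {:V i j}) by exact: basis_free (vbasisP _).
rewrite /mginj (bigD1 a) //= big1 => [|b ne]; rewrite coord_free //.
  by rewrite eqxx scale1r addr0.
by rewrite eq_sym (negbTE ne) scale0r.
Qed.

Lemma vtx_mginj l i j (v : V i j) : vtx l * mginj v = if l == i then mginj v else 0.
Proof.
rewrite /mginj mulr_sumr; case: (eqVneq l i) => [->|ne].
  by apply: eq_bigr => a _; rewrite -(pathalg_scaleAr _ (vtx i)) vtx_arw eqxx.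
rewrite big1 // => a _.
by rewrite -(pathalg_scaleAr _ (vtx l)) vtx_arw /= (negbTE ne) scaler0.
Qed.

Lemma mginj_vtx l i j (v : V i j) : mginj v * vtx l = if j == l then mginj v else 0.
Proof.
rewrite /mginj mulr_suml; case: (eqVneq j l) => [<-|ne].
  by apply: eq_bigr => a _; rewrite -(pathalg_scaleAl _ _ (vtx j)) arw_vtx eqxx.
rewrite big1 // => a _.
by rewrite -(pathalg_scaleAl _ _ (vtx l)) arw_vtx /= (negbTE ne) scaler0.
Qed.

Lemma vtx_dual_arw l (a : J) : vtx l * dual_arw a = if l == qtgt a then dual_arw a else 0.
Proof. exact: vtx_mginj. Qed.

Lemma dual_arw_vtx l (a : J) : dual_arw a * vtx l = if qsrc a == l then dual_arw a else 0.
Proof. exact: mginj_vtx. Qed.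

Lemma pathalg_deg_arw (b : J) : pathalg_deg 1 (arw b).
Proof. exact: pathalg_deg_basis. Qed.

Lemma pathalg_deg_sum n (K : Type) (r : seq K) (F : K -> T) :
  (forall x, pathalg_deg n (F x)) -> pathalg_deg n (\sum_(x <- r) F x).
Proof.
move=> H; apply/pathalg_degE; rewrite linear_sum /=.
by apply: eq_bigr => x _; apply/pathalg_degE.
Qed.

Lemma pathalg_degZ n a (x : T) : pathalg_deg n x -> pathalg_deg n (a *: x).
Proof. by move=> /pathalg_degE H; apply/pathalg_degE; rewrite degprojZ H. Qed.

Lemma pathalg_deg_mginj i j (v : V i j) : pathalg_deg 1 (mginj v).
Proof. by apply: pathalg_deg_sum => x; apply: pathalg_degZ; exact: pathalg_deg_arw. Qed.

Lemma pathalg_deg_mgcoev g : range (@mgcoev k Ga) g -> pathalg_deg 2 g.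
Proof.
move=> [i _ <-]; apply: pathalg_deg_sum => j; apply: pathalg_deg_sum => a.
by apply: (pathalg_degM (m := 1) (n := 1)); exact: pathalg_deg_mginj.
Qed.

(** The sum of the relations at all vertices; multiplying by [vtx i] recovers the one at [i], so
    this element alone generates the ideal. *)
Definition total_rel : T := \sum_a arw a * dual_arw a.

Lemma mgcoevE i : mgcoev i = vtx i * total_rel.
Proof.
rewrite /mgcoev /total_rel mulr_sumr.
have := sig_big_dep (op := +%R) (idx := 0) (fun ij : I * I => ij.1 == i) (fun _ => xpredT)
  (fun ij (x : 'I_(mgadj ij.1 ij.2)) => arw (mgarrow x) * dual_arw (mgarrow x)).
have -> : \sum_(ij : I * I | ij.1 == i) \sum_(x < mgadj ij.1 ij.2)
    arw (mgarrow x) * dual_arw (mgarrow x) =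
    \sum_j \sum_(x < mgadj i j) arw (mgarrow x) * dual_arw (mgarrow x).
  rewrite -(big_pred1_eq +%R i (fun i => \sum_j \sum_(x < mgadj i j)
     arw (mgarrow x) * dual_arw (mgarrow x))) pair_big_dep /=.
  by apply: eq_bigl => -[i' j'] /=; rewrite andbT.
move=> e.
transitivity (\sum_j \sum_(x < mgadj i j) arw (mgarrow x) * dual_arw (mgarrow x)).
  by apply: eq_bigr => j _; apply: eq_bigr => x _; rewrite mginj_basis.
rewrite e [RHS](bigID (fun b : J => (tag b).1 == i)) /=.
rewrite [X in _ = _ + X]big1 => [|b ne]; last first.
  by rewrite mulrA vtx_arw /= eq_sym (negbTE ne) mul0r.
apply: etrans (esym (addr0 _)); apply: eq_big => [[[i' j'] x]|[[i' j'] x]] /=.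
  by rewrite andbT.
by rewrite andbT => /eqP <-; rewrite mulrA vtx_arw eqxx.
Qed.

Definition dual_mx : 'M[k]_#|J| :=
  \matrix_(a, b) arw_coef (enum_val b) (dual_arw (enum_val a)).

Lemma mginj_lin i j : linear (@mginj k Ga i j).
Proof.
move=> c x y; rewrite /mginj scaler_sumr -big_split; apply: eq_bigr => a _ /=.
by rewrite linearP scalerDl scalerA.
Qed.

Lemma mginj_sum i j n (c : 'I_n -> k) (F : 'I_n -> V i j) :
  mginj (\sum_x c x *: F x) = \sum_x c x *: mginj (F x).
Proof.
pose f : {linear V i j -> T} :=
  HB.pack_for {linear V i j -> T} (@mginj k Ga i j)
   (GRing.isLinear.Build _ _ _ _ _ (@mginj_lin i j)).
rewrite -[LHS]/(f _) linear_sum; apply: eq_bigr => x _.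
by rewrite linearZ.
Qed.

Lemma mgdual_free i j (c : 'I_(mgadj i j) -> k) :
  \sum_a c a *: (mgdual a : V j i) = 0 -> forall a, c a = 0.
Proof.
move=> c0 a.
have : mgE j i (\sum_b c b *: mgdual b) (vbasis {:V i j})`_a = 0.
  by rewrite c0 linear0 lfunE.
rewrite linear_sum sum_lfunE (bigD1 a) //= big1 => [|b ne].
  by rewrite linearZ scale_lfunE mgEE mgdualP eqxx addr0 => e; rewrite -[LHS]mulr1; exact: e.
by rewrite linearZ scale_lfunE mgEE mgdualP (negbTE ne) scaler0.
Qed.

(** A relation between the rows splits into relations between the dual vectors of each [V j i].
    These are independent because the nondegenerate form pairs them to the identity with a basis of
    [V i j]. *)
Lemma dual_mx_unit : dual_mx \in unitmx.
Proof.
rewrite -row_free_unit; apply: inj_row_free => u u0; apply/rowP => r; rewrite mxE.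
rewrite -(enum_valK r); case: (enum_val r) => -[i j] a.
pose c (b : J) : k := u 0 (enum_rank b).
rewrite -[LHS]/(c (mgarrow a)).
have Hc (b : J) : \sum_x c x * arw_coef b (dual_arw x) = 0.
  have := congr1 (fun M : 'rV_#|J| => M 0 (enum_rank b)) u0.
  rewrite !mxE => e; apply: etrans _ e.
  rewrite (reindex (fun x : 'I_#|J| => enum_val x)) /=; last exact/onW_bij/enum_val_bij.
  by apply: eq_bigr => x _; rewrite mxE /c enum_valK enum_rankK.
apply: (@mgdual_free i j (fun x => c (mgarrow x))).
apply: mginj_inj => b; rewrite mginj_sum.
have -> : arw_coef b (\sum_(x < mgadj i j) c (mgarrow x) *: mginj (mgdual x)) =
    \sum_(x < mgadj i j) c (mgarrow x) * arw_coef b (dual_arw (mgarrow x)).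
  exact: arw_coef_lincomb.
have [tb|tb] := eqVneq (tag b) (j, i); last first.
  by rewrite big1 // => x _; rewrite arw_coef_mginj_supp ?mulr0.
(* At an arrow [b] from j to i only the duals of arrows from i to j have a coefficient, so the full
   sum reduces to one block. *)
apply: etrans _ (Hc b).
have := sig_big_dep (op := +%R) (idx := 0) (pred1 (i, j)) (fun _ => xpredT)
  (fun ij (x : 'I_(mgadj ij.1 ij.2)) => c (mgarrow x) * arw_coef b (dual_arw (mgarrow x))).
rewrite big_pred1_eq => e; rewrite [LHS]e [RHS](bigID (fun b : J => tag b == (i, j))) /=.
rewrite [X in _ = _ + X]big1 => [|[[i' j'] x] ne]; last first.
  rewrite arw_coef_mginj_supp ?mulr0 // tb /=; apply/eqP => -[e1 e2].
  by case/eqP: ne; rewrite /= e1 e2.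
rewrite addr0; apply: eq_big => [[[i' j'] x]|[[i' j'] x] _] //=.
by rewrite andbT.
Qed.

Definition dual_inv (b a : J) : k := invmx dual_mx (enum_rank b) (enum_rank a).

Lemma dual_invr a a' : \sum_b arw_coef b (dual_arw a) * dual_inv b a' = (a == a')%:R.
Proof.
have := congr1 (fun M : 'M[k]_#|J| => M (enum_rank a) (enum_rank a')) (mulmxV dual_mx_unit).
rewrite !mxE (inj_eq enum_rank_inj) => e; apply: etrans _ e.
rewrite (reindex (fun x : 'I_#|J| => enum_val x)) /=; last exact/onW_bij/enum_val_bij.
by apply: eq_bigr => x _; rewrite mxE /dual_inv enum_valK enum_rankK.
Qed.

Lemma dual_invl b b' : \sum_a dual_inv b a * arw_coef b' (dual_arw a) = (b == b')%:R.
Proof.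
have := congr1 (fun M : 'M[k]_#|J| => M (enum_rank b) (enum_rank b')) (mulVmx dual_mx_unit).
rewrite !mxE (inj_eq enum_rank_inj) => e; apply: etrans _ e.
rewrite (reindex (fun x : 'I_#|J| => enum_val x)) /=; last exact/onW_bij/enum_val_bij.
by apply: eq_bigr => x _; rewrite mxE /dual_inv enum_valK enum_rankK.
Qed.

Lemma dual_arw_span a : dual_arw a = \sum_b arw_coef b (dual_arw a) *: arw b.
Proof. exact: mginj_sum_arw. Qed.

Lemma arw_dual_span b : arw b = \sum_a dual_inv b a *: dual_arw a.
Proof. exact: (dual_family_inv dual_arw_span dual_invl). Qed.

(* The coefficient of [dual_arw a] on the right, see [dual_del_dual]. *)
Definition dual_del (a : J) (x : T) : T := \sum_b dual_inv b a *: rdel b x.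

Lemma dual_del_lin a : linear (dual_del a).
Proof.
move=> c x y; rewrite /dual_del scaler_sumr -big_split; apply: eq_bigr => b _ /=.
by rewrite rdelD rdelZ scalerDr !scalerA mulrC.
Qed.
HB.instance Definition _ a :=
  GRing.isLinear.Build k T T _ (dual_del a) (dual_del_lin a).

Lemma dual_del_arw a c x : dual_del a (x * arw c) = dual_inv c a *: (x * vtx (qsrc c)).
Proof.
rewrite /dual_del (bigD1 c) //= big1 => [|b ne]; rewrite rdel_mul.
  by rewrite eqxx addr0.
by rewrite eq_sym (negbTE ne) scaler0.
Qed.

Lemma mul_dual_arw x c :
  x * dual_arw c = \sum_b arw_coef b (dual_arw c) *: (x * arw b).
Proof.
rewrite {1}dual_arw_span mulr_sumr; apply: eq_bigr => b _.
exact: esym (pathalg_scaleAr _ _ _).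
Qed.

(** The coefficient matrix cancels against its inverse. The vertex factors agree because all arrows
    occurring in [dual_arw c] start at the target of [c]. *)
Lemma dual_del_dual a c x :
  dual_del a (x * dual_arw c) = if c == a then x * vtx (qtgt c) else 0.
Proof.
rewrite mul_dual_arw linear_sum /=.
pose e b := arw_coef b (dual_arw c) * dual_inv b a.
apply: etrans (sum_scaler (c := e) (z := x * vtx (qtgt c)) _) _ => [b|].
  rewrite linearZ /= dual_del_arw scalerA /e.
  have [->//|ne] := eqVneq (qsrc b) (qtgt c).
  rewrite (_ : arw_coef b _ = 0) ?mul0r ?scale0r //.
  apply: arw_coef_mginj_supp; apply: contra_neq ne => tb.
  by rewrite /= tb.
by rewrite dual_invr; case: eqP; rewrite ?scale1r ?scale0r.
Qed.

Lemma dual_gen n x : pathalg_deg n.+1 x -> exists2 y : J -> T,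
  (forall a, pathalg_deg n (y a)) & x = \sum_a y a * dual_arw a.
Proof.
move: x; apply: pathalg_deg_ind => [|x x' [y Hy ->] [y' Hy' ->]|c x [y Hy ->]|p ep].
- exists (fun=> 0) => [a|]; first by apply/pathalg_degE; rewrite degproj0.
  by rewrite big1 // => a _; rewrite mul0r.
- exists (fun a => y a + y' a) => [a|].
    by apply/pathalg_degE; rewrite degprojD; congr (_ + _); apply/pathalg_degE.
  by rewrite -big_split; apply: eq_bigr => a _; rewrite mulrDl.
- exists (fun a => c *: y a) => [a|]; first exact: pathalg_degZ.
  by rewrite scaler_sumr; apply: eq_bigr => a _; exact: pathalg_scaleAl.
case: (path_last p) => [e|[p' [b [_ e l]]]]; first by rewrite e in ep.
exists (fun a => dual_inv b a *: pbasis k p') => [a|].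
  by apply: pathalg_degZ; rewrite (_ : n = plen p'); [exact: pathalg_deg_basis | lia].
transitivity (pbasis k p' * arw b); first by rewrite pbasisM e.
rewrite [arw b]arw_dual_span mulr_sumr; apply: eq_bigr => a _.
exact: etrans (esym (pathalg_scaleAr _ _ _)) (pathalg_scaleAl _ _ _).
Qed.

Local Notation G := (range (@mgcoev k Ga)).

(* The ideal is [T R + I V], [R] being [total_rel]; division maps [I V] into [I]
   and [x R] to [x * arw a]. *)
Lemma ideal_dual_del z : ideal_gen G z ->
  exists x, forall a, ideal_gen G (dual_del a z - x * arw a).
Proof.
case=> s sG ->; elim: s sG => [|t s IH] sG.
  exists 0 => a; rewrite big_nil linear0 mul0r subrr; exact: ideal_gen0.
have [|x Hx] := IH; first by move=> u us; apply: sG; rewrite inE us orbT.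
suff [x' Hx'] : exists x', forall a,
    ideal_gen G (dual_del a (t.1.1 * t.1.2 * t.2) - x' * arw a).
  exists (x' + x) => a; rewrite big_cons linearD /= mulrDl opprD addrACA.
  exact: ideal_genD.
have [i _ ti] : G t.1.2 by apply: sG; rewrite inE eqxx.
have It x0 : ideal_gen G (t.1.1 * t.1.2 * x0).
  by apply: ideal_genMr; apply: ideal_genMl; apply: ideal_gen_mem; rewrite -ti; exists i.
(* The right factor is split by its last letter. A vertex leaves the relation exposed and produces
   [x']; an arrow is removed by division, which leaves an element of the ideal. *)
move: {+}t.2; apply: pathalg_right_ind.
- exists 0 => a; rewrite mulr0 linear0 mul0r subrr; exact: ideal_gen0.
- move=> y y' [x1 H1] [x2 H2]; exists (x1 + x2) => a.
  rewrite (mulrDr _ y) linearD /= mulrDl opprD addrACA.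
  exact: ideal_genD.
- move=> c y [x1 H1]; exists (c *: x1) => a.
  rewrite -(pathalg_scaleAr c (t.1.1 * t.1.2) y) linearZ /=.
  rewrite -(pathalg_scaleAl c x1 (arw a)) -scalerBr.
  exact: ideal_genZ.
- move=> j; rewrite -ti mgcoevE.
  have e : t.1.1 * (vtx i * total_rel) * vtx j =
      \sum_a (if qsrc a == j then t.1.1 * vtx i * arw a * dual_arw a else 0).
    rewrite /total_rel mulr_sumr mulr_sumr mulr_suml; apply: eq_bigr => a _.
    rewrite -[t.1.1 * _ * _]mulrA -[vtx i * _ * _]mulrA -[arw a * _ * _]mulrA.
    by rewrite dual_arw_vtx; case: eqP => _; rewrite ?mulr0 // !mulrA.
  (* All terms of [total_rel] are closed paths, so the vertex [j] on the right gives 0 unless it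
     equals [i]. *)
  exists (if i == j then t.1.1 * vtx i else 0) => a.
  suff -> : dual_del a (t.1.1 * (vtx i * total_rel) * vtx j) =
      (if i == j then t.1.1 * vtx i else 0) * arw a by rewrite subrr; exact: ideal_gen0.
  rewrite e linear_sum (bigD1 a) //= big1 => [|b ne]; last first.
    by case: eqP => _; rewrite ?linear0 // dual_del_dual (negbTE ne).
  rewrite addr0; case: (eqVneq (qsrc a) j) => [<-|ne].
    rewrite dual_del_dual eqxx -[_ * vtx (qtgt a)]mulrA arw_vtx eqxx.
    rewrite -[t.1.1 * vtx i * arw a]mulrA vtx_arw.
    by case: eqP => [->|_]; rewrite ?mulr0 ?mul0r // -mulrA vtx_arw eqxx.
  rewrite linear0; case: eqP => [ij|_]; last by rewrite mul0r.
  by rewrite -mulrA vtx_arw ij eq_sym (negbTE ne) mulr0.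
move=> y b; exists 0 => a; rewrite mul0r subr0 mulrA dual_del_arw.
by apply: ideal_genZ; apply: ideal_genMr; exact: It.
Qed.

Lemma total_rel_ideal : ideal_gen G total_rel.
Proof.
rewrite -[total_rel]mul1r -sum_vtx mulr_suml; apply: ideal_gen_sum => i.
by rewrite -mgcoevE; apply: ideal_gen_mem; exists i.
Qed.

End DualArrows.

(** * The preprojective algebra *)

Lemma sum_if_eq (V : zmodType) (I : finType) i (F : I -> V) :
  \sum_j (if i == j then F j else 0) = F i.
Proof. by rewrite -big_mkcond (big_pred1 i) // => j; rewrite eq_sym. Qed.

HB.lock Definition pvtx (k : fieldType) (Ga : modulated_graph k) (i : mgvtx Ga) :
  preproj Ga := bqpi (range (@mgcoev k Ga)) (vtx k (i : qvtx (mgquiver Ga))).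

Section Preprojective.
Variables (k : fieldType) (Ga : modulated_graph k).
Local Notation I := (mgvtx Ga).
Local Notation Q := (mgquiver Ga).
Local Notation J := (qarr Q).
Local Notation T := (pathalg k Q).
Local Notation G := (range (@mgcoev k Ga)).
Local Notation B := (preproj Ga).

Definition ppi (x : T) : B := bqpi G x.
Local Notation pvtx := (@pvtx k Ga).
Lemma pvtxE i : pvtx i = ppi (vtx k (i : qvtx Q)). Proof. by rewrite pvtx.unlock. Qed.
Definition parw (a : J) : B := ppi (arw k a).
Definition pdual (a : J) : B := ppi (dual_arw a).
Definition pproj n (x : B) : B := @bqproj k Q G n x.
Definition pcoef (i : I) (x : B) : k := @bqcoef k Q G i x.

Let G2 := @pathalg_deg_mgcoev k Ga.

Lemma ppi_ind (P : B -> Prop) : (forall x, P (ppi x)) -> forall x, P x.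
Proof. exact: bqpi_ind. Qed.
Lemma ppiD x y : ppi (x + y) = ppi x + ppi y. Proof. exact: bqpiD. Qed.
Lemma ppiM x y : ppi (x * y) = ppi x * ppi y. Proof. exact: bqpiM. Qed.
Lemma ppiZ a x : ppi (a *: x) = a *: ppi x. Proof. exact: bqpiZ. Qed.
Lemma ppi1 : ppi 1 = 1. Proof. exact: bqpi1. Qed.
Lemma ppi0 : ppi 0 = 0. Proof. by []. Qed.
Lemma ppi_sum K (r : seq K) (F : K -> T) :
  ppi (\sum_(j <- r) F j) = \sum_(j <- r) ppi (F j).
Proof. exact: (big_morph ppi ppiD ppi0). Qed.
Lemma ppiP x y : ppi x = ppi y <-> ideal_gen G (x - y). Proof. exact: bqpiP. Qed.
Lemma ppi_eq0 x : ideal_gen G x -> ppi x = 0.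
Proof. by move=> Gx; rewrite -ppi0; apply/ppiP; rewrite subr0. Qed.
Lemma pprojE n x : pproj n (ppi x) = ppi (degproj n x).
Proof. exact: (bqprojE G2). Qed.
Lemma pprojP n : linear (pproj n). Proof. exact: (bqproj_linear G2). Qed.
Lemma pprojK m n x : pproj m (pproj n x) = if m == n then pproj n x else 0.
Proof. exact: (bqprojK G2). Qed.
Lemma sum_pproj x : exists N, x = \sum_(n < N) pproj n x.
Proof. exact: (sum_bqproj G2). Qed.
Lemma preproj_degE n (x : B) : preproj_deg n x <-> pproj n x = x.
Proof. exact: (bqalg_degE G2). Qed.
Lemma pprojM m n x y : pproj m x = x -> pproj n y = y -> pproj (m + n) (x * y) = x * y.
Proof. by move=> /preproj_degE ? /preproj_degE ?; apply/preproj_degE; exact: bqalg_degM. Qed.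
Lemma pcoefE i x : pcoef i (ppi x) = @vtx_coef k Q i x. Proof. exact: (bqcoefE G2). Qed.
Lemma pscaleAl (a : k) (x y : B) : a *: (x * y) = (a *: x) * y.
Proof. exact: bqalg_scaleAl. Qed.
Lemma pscaleAr (a : k) (x y : B) : a *: (x * y) = x * (a *: y).
Proof. exact: bqalg_scaleAr. Qed.
Lemma preproj_compE n i j (x : B) : preproj_comp n i j x <->
  exists2 y, preproj_deg n y & pvtx i * y * pvtx j = x.
Proof. by rewrite pvtx.unlock. Qed.

HB.instance Definition _ n := GRing.isLinear.Build k B B _ (pproj n) (pprojP n).

#[local] Opaque preproj ppi pproj pcoef.

Lemma pproj_ppi n x : pathalg_deg n x -> pproj n (ppi x) = ppi x.
Proof. by move=> /pathalg_degE e; rewrite pprojE e. Qed.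

Lemma pproj_lift n x : pproj n x = x -> exists2 y, pathalg_deg n y & ppi y = x.
Proof.
move: x; apply: ppi_ind => x e; exists (degproj n x).
  by apply/pathalg_degE; rewrite degprojK eqxx.
by rewrite -pprojE.
Qed.

Lemma pvtxM i j : pvtx i * pvtx j = if i == j then pvtx i else 0.
Proof. by rewrite !pvtxE -ppiM vtxM; case: ifP. Qed.

Lemma pvtxMZ i j (c : k) : pvtx i * (c *: pvtx j) = if i == j then c *: pvtx i else 0.
Proof.
apply: etrans (esym (pscaleAr _ _ _)) _; rewrite pvtxM.
by case: eqP => // _; exact: scaler0.
Qed.

Lemma pvtxZM i j (c : k) : (c *: pvtx i) * pvtx j = if i == j then c *: pvtx i else 0.
Proof.
apply: etrans (esym (pscaleAl _ _ _)) _; rewrite pvtxM.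
by case: eqP => // _; exact: scaler0.
Qed.

Lemma sum_pvtx : \sum_i pvtx i = 1.
Proof. by rewrite (eq_bigr _ (fun i _ => pvtxE i)) -ppi_sum sum_vtx ppi1. Qed.

Lemma pproj_vtx i : pproj 0 (pvtx i) = pvtx i.
Proof. by rewrite pvtxE; apply: pproj_ppi; exact: pathalg_deg_basis. Qed.

Lemma pproj_arw a : pproj 1 (parw a) = parw a.
Proof. by apply: pproj_ppi; exact: pathalg_deg_arw. Qed.

Lemma pproj_dual a : pproj 1 (pdual a) = pdual a.
Proof. by apply: pproj_ppi; exact: pathalg_deg_mginj. Qed.

Lemma pvtx_arw i (a : J) : pvtx i * parw a = if i == (qsrc a : I) then parw a else 0.
Proof. by rewrite pvtxE /parw -ppiM vtx_arw; case: ifP. Qed.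

Lemma parw_vtx (a : J) : parw a * pvtx (qtgt a) = parw a.
Proof. by rewrite pvtxE /parw -ppiM arw_vtx eqxx. Qed.

Lemma pvtx_dual (a : J) : pvtx (qtgt a) * pdual a = pdual a.
Proof. by rewrite pvtxE /pdual -ppiM vtx_dual_arw eqxx. Qed.

Lemma pdual_vtx (a : J) j : pdual a * pvtx j = if (qsrc a : I) == j then pdual a else 0.
Proof. by rewrite pvtxE /pdual -ppiM dual_arw_vtx; case: ifP. Qed.

Lemma pdual_span : exists C : J -> J -> k, forall a, pdual a = \sum_b C a b *: parw b.
Proof.
exists (fun a b => arw_coef b (dual_arw a)) => a.
apply: etrans (congr1 ppi (dual_arw_span a)) _; apply: etrans (ppi_sum _ _) _.
by apply: eq_bigr => b _; exact: ppiZ.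
Qed.

Lemma pdual_gen n z : pproj n.+1 z = z -> exists2 y : J -> B,
  (forall a, pproj n (y a) = y a) & z = \sum_a y a * pdual a.
Proof.
move=> /pproj_lift[x dx <-]; have [y dy ->] := dual_gen dx.
exists (fun a => ppi (y a)) => [a|]; first exact: pproj_ppi.
by rewrite ppi_sum; apply: eq_bigr => a _; rewrite ppiM.
Qed.

(** Exactness at the middle of the complex. Lifted to the path algebra, the sum lies in the ideal,
    and division by the dual arrows returns the coefficients, which [ideal_dual_del] identifies with
    multiples of the arrows modulo the ideal. *)
Lemma pdual_syzygy (y : J -> B) : (forall a : J, y a * pvtx (qtgt a) = y a) ->
  \sum_a y a * pdual a = 0 -> exists x, forall a, y a = x * parw a.
Proof.
move=> ye y0.
have [u Hu] : {u : J -> T & forall a, ppi (u a) = y a}.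
  apply: (@choice _ _ (fun a u => ppi u = y a)) => a.
  by move: (y a); apply: ppi_ind => u; exists u.
pose z := \sum_a (u a * vtx k (qtgt a)) * dual_arw a.
have Gz : ideal_gen G z.
  rewrite -[z]subr0; apply/ppiP; rewrite ppi0; apply: etrans _ y0.
  apply: etrans (ppi_sum _ _) _; apply: eq_bigr => a _.
  by rewrite !ppiM -pvtxE Hu ye.
have [x Hx] := ideal_dual_del Gz; exists (ppi x) => a.
rewrite -ye -Hu pvtxE -!ppiM; apply/ppiP.
have := Hx a; rewrite /z linear_sum (bigD1 a) //= dual_del_dual eqxx big1 => [|b ne].
  by rewrite addr0 -mulrA vtxM eqxx.
by rewrite dual_del_dual (negbTE ne).
Qed.

Lemma prel : \sum_a parw a * pdual a = 0.
Proof.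
rewrite /parw /pdual; under eq_bigr do rewrite -ppiM.
by rewrite -ppi_sum; apply: ppi_eq0; exact: total_rel_ideal.
Qed.

Lemma pproj0_span x : pproj 0 x = x -> exists c : I -> k, x = \sum_i c i *: pvtx i.
Proof.
move=> /pproj_lift[y dy <-].
suff [c ->] : exists c : I -> k, y = \sum_i c i *: vtx k (i : qvtx Q).
  by exists c; rewrite ppi_sum; apply: eq_bigr => i _; rewrite pvtxE; exact: ppiZ.
move: y dy; apply: pathalg_deg_ind => [|y y' [c ->] [c' ->]|a y [c ->]|p ep].
- by exists (fun=> 0); rewrite big1 // => i _; rewrite scale0r.
- exists (fun i => c i + c' i); rewrite -big_split; apply: eq_bigr => i _.
  exact: esym (scalerDl _ _ _).
- exists (fun i => a * c i); rewrite scaler_sumr; apply: eq_bigr => i _.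
  exact: scalerA.
case: (path_last p) => [e|[p' [b [_ _ l]]]]; last by rewrite ep in l.
exists (fun i => (i == pstart p)%:R); rewrite (bigD1 (pstart p)) //= eqxx scale1r.
by rewrite big1 ?addr0 => [|i /negbTE ->]; [rewrite {1}e | rewrite scale0r].
Qed.

Lemma pcoefP i a x y : pcoef i (a *: x + y) = a * pcoef i x + pcoef i y.
Proof.
move: x; apply: ppi_ind => x; move: y; apply: ppi_ind => y.
by rewrite -ppiZ -ppiD !pcoefE vtx_coefD vtx_coefZ.
Qed.

Lemma pcoef_vtx i j : pcoef i (pvtx j) = (j == i)%:R.
Proof.
rewrite pvtxE pcoefE vtx_coef_basis; congr (nat_of_bool _)%:R.
by apply/eqP/eqP => [[]|->].
Qed.

Lemma pcoefM i x y : pcoef i (x * y) = pcoef i x * pcoef i y.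
Proof.
move: x; apply: ppi_ind => x; move: y; apply: ppi_ind => y.
by rewrite -ppiM !pcoefE vtx_coefM.
Qed.

Lemma pcoef0 i : pcoef i 0 = 0.
Proof. by rewrite -ppi0 pcoefE vtx_coef0. Qed.

Lemma pcoef_sum i (c : I -> k) : pcoef i (\sum_j c j *: pvtx j) = c i.
Proof.
have H (s : seq I) : pcoef i (\sum_(j <- s) c j *: pvtx j) = \sum_(j <- s) c j * (j == i)%:R.
  elim: s => [|j s IH]; first by rewrite !big_nil pcoef0.
  by rewrite !big_cons pcoefP IH pcoef_vtx.
rewrite H (bigD1 i) //= eqxx mulr1 big1 ?addr0 // => j /negbTE ->.
by rewrite mulr0.
Qed.

Lemma pvtx_neq0 i : pvtx i != 0.
Proof.
apply/eqP => e; have := pcoef_vtx i i; rewrite e pcoef0 eqxx => /eqP.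
by rewrite eq_sym oner_eq0.
Qed.

Lemma pcoef_pos i n x : pproj n.+1 x = x -> pcoef i x = 0.
Proof.
move=> /pproj_lift[y dy <-]; rewrite pcoefE.
move: y dy; apply: pathalg_deg_ind => [|y y' ey ey'|a y ey|p ep].
- exact: vtx_coef0.
- by rewrite vtx_coefD ey ey' addr0.
- by rewrite vtx_coefZ ey mulr0.
by rewrite vtx_coef_basis; case: eqP => // e; rewrite e in ep.
Qed.

Lemma pcoef1 i : pcoef i 1 = 1.
Proof.
rewrite -sum_pvtx (eq_bigr (fun j => 1 *: pvtx j)); first exact: (pcoef_sum i (fun=> 1)).
by move=> j _; rewrite scale1r.
Qed.

Lemma sum_arrows (P : pred (I * I)) (F : I * I -> nat) :
  (\sum_(a : J | P (tag a)) F (tag a) = \sum_(ij | P ij) mgadj ij.1 ij.2 * F ij)%N.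
Proof.
have := sig_big_dep (op := addn) (idx := 0%N) P (fun _ => xpredT)
  (fun ij (x : 'I_(mgadj ij.1 ij.2)) => F ij).
move=> e; transitivity (\sum_(a : J | P (tag a) && true) F (tag a))%N.
  by apply: eq_bigl => a; rewrite andbT.
rewrite -[LHS]e; apply: eq_bigr => ij _.
by rewrite sum_nat_const card_ord.
Qed.

Lemma sum_arrows_src j (F : I -> nat) :
  (\sum_(a : J | (qsrc a : I) == j) F (qtgt a) = \sum_l mgadj j l * F l)%N.
Proof.
apply: etrans (sum_arrows (fun ij => ij.1 == j) (fun ij => F ij.2)) _.
rewrite -(big_pred1_eq addn j (fun j => \sum_l mgadj j l * F l)%N) pair_big_dep /=.
by apply: eq_bigl => -[i' j'] /=; rewrite andbT.
Qed.

Lemma sum_arrows_tgt j (F : I -> nat) :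
  (\sum_(a : J | (qtgt a : I) == j) F (qsrc a) = \sum_l mgadj l j * F l)%N.
Proof.
apply: etrans (sum_arrows (fun ij => ij.2 == j) (fun ij => F ij.1)) _.
transitivity (\sum_l \sum_(j' | j' == j) mgadj l j' * F l)%N.
  by rewrite pair_big_dep.
by apply: eq_bigr => l _; rewrite big_pred1_eq.
Qed.

Hypothesis Hconn : graph_connected (@mgadj k Ga).
Hypothesis HnotADET : ~ ADET_type (@mgadj k Ga).

Lemma preproj_socle_dims :
  (forall x : B, (forall a, x * parw a = 0) -> x = 0) /\
  exists d : nat -> I -> I -> nat,
  [/\ forall n i j, has_dim (preproj_comp n i j : set B) (d n i j),
      forall i j, d 0%N i j = (i == j),
      forall i j, d 1%N i j = mgadj i j
    & forall n i j, (\sum_l d n.+1 i l * mgadj l j = d n i j + d n.+2 i j)%N].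
Proof.
have [y ysub ypos] := not_ADET_subharmonic (@mgadj_sym k Ga) Hconn HnotADET.
have ysub' l : (2 * y l <= \sum_(a : J | (qtgt a : I) == l) y (qsrc a))%N.
  rewrite sum_arrows_tgt; under eq_bigr do rewrite mgadj_sym; exact: ysub.
pose mul (x y : B) : B := x * y.
have h1 x y' z : mul x (mul y' z) = mul (mul x y') z by exact: mulrA.
have h2 a x y' z : mul (a *: x + y') z = a *: mul x z + mul y' z.
  by rewrite /mul mulrDl pscaleAl.
have h3 a x y' z : mul z (a *: x + y') = a *: mul z x + mul z y'.
  by rewrite /mul mulrDr pscaleAr.
have h4 x : \sum_i mul (pvtx i) x = x by rewrite /mul -mulr_suml sum_pvtx mul1r.
have h5 x : \sum_i mul x (pvtx i) = x by rewrite /mul -mulr_sumr sum_pvtx mulr1.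
have h6 x : \sum_a mul (mul x (parw a)) (pdual a) = 0.
  by rewrite /mul; under eq_bigr do rewrite -mulrA; rewrite -mulr_sumr prel mulr0.
pose pr n : {linear B -> B} := pproj n.
split.
  exact: (@socle_eq0 k B mul I J (fun a => qsrc a) (fun a => qtgt a) pvtx parw pdual pr
    h1 h2 h3 h4 h5 pvtxM pvtx_neq0 pprojK sum_pproj pprojM pproj_vtx pproj0_span
    pproj_arw pproj_dual pvtx_arw parw_vtx pvtx_dual pdual_vtx pdual_span
    pdual_gen pdual_syzygy h6 y ypos ysub').
have [d [d1 d2 d3 d4]] := (@piece_dims k B mul I J (fun a => qsrc a) (fun a => qtgt a)
    pvtx parw pdual pr
    h1 h2 h3 h5 pvtxM pvtx_neq0 pprojK sum_pproj pprojM pproj_vtx pproj0_span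
    pproj_arw pproj_dual pvtx_arw parw_vtx pvtx_dual pdual_vtx pdual_span
    pdual_gen pdual_syzygy h6 y ypos ysub').
exists d; split=> //.
- move=> n i j.
  (* An image under multiplication by idempotents on both sides is the same as the set of elements
     that they fix. *)
  suff -> : (preproj_comp n i j : set B) = piece mul pvtx pr n i j by exact: d1.
  apply/seteqP; split=> x.
    case/preproj_compE => z /preproj_degE pz <-; split.
    + by rewrite /mul !mulrA pvtxM eqxx.
    + by rewrite /mul -!mulrA pvtxM eqxx.
    have := pprojM (pprojM (pproj_vtx i) pz) (pproj_vtx j).
    by rewrite add0n addn0.
  case=> ix xj px; apply/preproj_compE; exists x; first exact/preproj_degE.
  exact: etrans (congr1 ( *%R^~ (pvtx j)) ix) xj.
- move=> i j; rewrite d3 (sum_arrows_src j (d 0 i)) (bigD1 i) //= d2 eqxx muln1.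
  by rewrite mgadj_sym big1 ?addn0 // => l ne; rewrite d2 eq_sym (negbTE ne) muln0.
move=> n i j; rewrite -d4 (sum_arrows_src j (d n.+1 i)); apply: eq_bigr => l _.
by rewrite mulnC mgadj_sym.
Qed.

Lemma preproj_koszul : koszul (@preproj_deg k Ga).
Proof.
have cB i x y : pcoef i (x - y) = pcoef i x - pcoef i y.
  by rewrite addrC -scaleN1r pcoefP mulN1r addrC.
apply: (@koszul_of_complex B (@preproj_deg k Ga) pproj I J (fun a => qtgt a)
  pvtx parw pdual k pcoef) => //.
- exact: preproj_degE.
- by move=> n x y; rewrite linearB.
- exact: pprojK.
- exact: sum_pproj.
- exact: pprojM.
- exact: pproj_vtx.
- exact: pproj_arw.
- exact: pproj_dual.
- exact: sum_pvtx.
- exact: pvtxM.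
- exact: parw_vtx.
- exact: pvtx_dual.
- exact: pdual_gen.
- exact: pdual_syzygy.
- exact: prel.
- exact: preproj_socle_dims.1.
- move=> i x /pproj0_span[c ->]; rewrite mulr_sumr mulr_suml; apply: eq_bigr => j _.
  apply: etrans (pvtxMZ _ _ _) _; apply: etrans _ (esym (pvtxZM _ _ _)).
  by rewrite eq_sym; case: eqP => [->|_].
(* In degree 0 the block of the vertex [i] is the line through [pvtx i], so a nonzero element is
   inverted by inverting its scalar. *)
- move=> i x /pproj0_span[c ->].
  have -> : pvtx i * (\sum_j c j *: pvtx j) = c i *: pvtx i.
    apply: etrans (mulr_sumr _ _ _ _) _.
    apply: etrans (sum_if_eq i (fun=> c i *: pvtx i)); apply: eq_bigr => j _.
    by apply: etrans (pvtxMZ _ _ _) _; case: eqP => [->|_].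
  have [->|ci] := eqVneq (c i) 0; first by left; rewrite scale0r.
  right; exists ((c i)^-1 *: pvtx i); first by rewrite linearZ /= pproj_vtx.
  apply: etrans (esym (pscaleAl _ _ _)) _; rewrite pvtxMZ eqxx.
  by apply: etrans (scalerA _ _ _) _; rewrite mulVf //; exact: scale1r.
- exact: pcoefM.
- exact: pcoef1.
- exact: pcoef_pos.
- move=> f; exists (\sum_j f j *: pvtx j) => i; exact: pcoef_sum.
move=> x /pproj0_span[c ->] c0; rewrite big1 // => i _.
by rewrite -(pcoef_sum i c) c0 scale0r.
Qed.

End Preprojective.

(** * The matrix Hilbert series as an inverse power series *)

Section HilbertSeries.
Variable I : finType.
Implicit Types a b : I -> I -> nat.

Lemma natmxM a b :
  natmx a *m natmx b = natmx (fun i j => \sum_l a i l * b l j)%N.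
Proof.
apply/matrixP => i j; rewrite !mxE (big_morph Posz PoszD (erefl _)).
rewrite [RHS](reindex (fun x : 'I_#|I| => enum_val x)) /=; last exact/onW_bij/enum_val_bij.
by apply: eq_bigr => l _; rewrite !mxE PoszM.
Qed.

Lemma natmxD a b : natmx a + natmx b = natmx (fun i j => a i j + b i j)%N.
Proof. by apply/matrixP => i j; rewrite !mxE PoszD. Qed.

(** The recursion yields the product with the denominator on the right. The product on the left also
    needs the coefficients to commute with the adjacency matrix, which they do, being polynomials in
    it. *)
Lemma hilbert_inverse a (d : nat -> I -> I -> nat) :
  (forall i j, d 0%N i j = (i == j)) -> (forall i j, d 1%N i j = a i j) ->
  (forall n i j, (\sum_l d n.+1 i l * a l j = d n i j + d n.+2 i j)%N) ->
  mxseries_inverse (fun n => natmx (d n)) (preproj_denom a).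
Proof.
move=> d0 d1 dS.
have D0 : natmx (d 0%N) = 1%:M.
  by apply/matrixP => i j; rewrite !mxE d0 (inj_eq enum_val_inj); case: eqP.
have D1 : natmx (d 1%N) = natmx a by apply/matrixP => i j; rewrite !mxE d1.
have DS n : natmx (d n.+1) *m natmx a = natmx (d n) + natmx (d n.+2).
  by rewrite natmxM natmxD; apply/matrixP => i j; rewrite !mxE dS.
(* Two consecutive coefficients are carried along because the recursion has order two. *)
have DC n : natmx a *m natmx (d n) = natmx (d n) *m natmx a.
  have [//] : natmx a *m natmx (d n) = natmx (d n) *m natmx a /\
    natmx a *m natmx (d n.+1) = natmx (d n.+1) *m natmx a.
  elim: n => [|n [IH0 IH1]]; first by rewrite D0 D1 mulmx1 mul1mx.
  split=> //; have -> : natmx (d n.+2) = natmx (d n.+1) *m natmx a - natmx (d n).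
    by rewrite DS addrC addKr.
  by rewrite mulmxBr mulmxBl IH0 mulmxA IH1.
have small n m : (m < n.+3)%N -> (m < n)%N -> preproj_denom a (n.+2 - m)%N = 0.
  by move=> _ mn; have [p ->] : exists p, (n.+2 - m = p.+3)%N by exists (n - m).-1; lia.
split; apply: functional_extensionality_dep => -[|[|n]].
- by rewrite /mxseries_mul big_ord1 /= D0 mulmx1.
- rewrite /mxseries_mul big_ord_recl big_ord1 /= D0 D1 mul1mx mulmx1.
  by rewrite addNr.
- rewrite /mxseries_mul !big_ord_recr /= big1 => [|m _]; last first.
    by rewrite small ?mulmx0 //; have := ltn_ord m; lia.
  have -> : (n.+2 - n = 2)%N by lia.
  have -> : (n.+2 - n.+1 = 1)%N by lia.
  by rewrite subnn /= !mulmx1 mulmxN DS add0r addrAC subrr.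
- by rewrite /mxseries_mul big_ord1 /= D0 mulmx1.
- rewrite /mxseries_mul big_ord_recl big_ord1 /= D0 D1 mul1mx mulmx1.
  by rewrite addrN.
rewrite /mxseries_mul !big_ord_recl /= big1 => [|m _]; last first.
  by rewrite mul0mx.
by rewrite /bump /= !subSS !subn0 !mul1mx mulNmx DC DS addr0
  [- _ + _]addrC addrA [_ + natmx (d n)]addrC subrr.
Qed.

End HilbertSeries.

Theorem proposition3p3 (k : closedFieldType) (Ga : modulated_graph k) (lam : k)
    (Hconn : graph_connected (@mgadj k Ga))
    (HnotADET : ~ ADET_type (@mgadj k Ga))
    (Hlam : nondegenerate_eigenvalue (@mgtrace k Ga) lam) :
  koszul (@preproj_deg k Ga) /\
  exists2 h : mxseries (mgvtx Ga),
    matrix_hilbert_series h & mxseries_inverse h (preproj_denom (@mgadj k Ga)).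
Proof.
split; first exact: preproj_koszul.
have [_ [d [d_dim d0 d1 dS]]] := preproj_socle_dims Hconn HnotADET.
exists (fun n => natmx (d n)); last exact: hilbert_inverse.
by exists d.
Qed.
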